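(* Let $q$ be a positive integer. Automorphisms of finite order of the second kind of the loop algebras $L(\mathfrak g,\cdot)$ have even order, and for even $q$ the quasiconjugacy classes of automorphisms of order $q$ of the second kind on the various $L(\mathfrak g,\cdot)$ are in bijection with $\mathcal J^q_{-1}(\mathfrak g)=\{(\varphi_+,\varphi_-)\in(\mathrm{Aut}\,\mathfrak g)^2:\varphi_+^2=\varphi_-^2,\ \varphi_\pm^2 \text{ has order } q/2\}/\sim$, where $\sim$ is the equivalence relation generated by $(\varphi_+,\varphi_-)\sim(\varphi_-,\varphi_+)$ and $(\varphi_+,\varphi_-)\sim(\alpha\varphi_+\alpha^{-1},\beta\varphi_-\beta^{-1})$ for all $\alpha,\beta\in\mathrm{Aut}(\mathfrak g)$ with $\alpha^{-1}\beta\in\big((\mathrm{Aut}\,\mathfrak g)^{\varphi_+^2}\big)_0$. Explicitly, the class $[\varphi_+,\varphi_-]$ corresponds to the quasiconjugacy class of the automorphism $(\varphi u)(t)=\varphi_+(u(-t))$ of $L(\mathfrak g,\varphi_-^{-1}\varphi_+)$.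
   Context: $\mathfrak g$ is a simple Lie algebra over $\mathbb F\in\{\mathbb R,\mathbb C\}$, compact if $\mathbb F=\mathbb R$. $L(\mathfrak g,\sigma)=\{u:\mathbb R\to\mathfrak g\text{ smooth}:u(t+2\pi)=\sigma(u(t))\}$ for $\sigma\in\mathrm{Aut}(\mathfrak g)$, with pointwise bracket. Every automorphism of $L(\mathfrak g,\sigma)$ is of the form $(\varphi u)(t)=\varphi_t(u(\lambda(t)))$ with $\lambda:\mathbb R\to\mathbb R$ a diffeomorphism satisfying $\lambda(t+2\pi)=\lambda(t)+2\pi\epsilon$, $\epsilon\in\{\pm1\}$, and $\varphi_t\in\mathrm{Aut}(\mathfrak g)$ smooth with $\varphi_{t+2\pi}=\sigma\varphi_t\sigma^{-\epsilon}$; it is of the first kind if $\epsilon=1$, of the second kind if $\epsilon=-1$. Automorphisms $\varphi$ of $L(\mathfrak g,\sigma)$ and $\tilde\varphi$ of $L(\mathfrak g,\tilde\sigma)$ are quasiconjugate if $\tilde\varphi=\psi\varphi\psi^{-1}$ for some Lie algebra isomorphism $\psi:L(\mathfrak g,\sigma)\to L(\mathfrak g,\tilde\sigma)$. $(\mathrm{Aut}\,\mathfrak g)^{\gamma}$ denotes the centralizer of $\gamma$ in $\mathrm{Aut}(\mathfrak g)$ and $H_0$ the identity component of a Lie group $H$. *)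

(* Defs.v *)
From Stdlib Require Import Reals Lra Lia Arith.
Open Scope R_scope.

(* A Lie algebra g over F in {R, C} is modelled as R^dim (real coordinates)*)
(* with structure constants; if F = C, it carries additionally a complex   *)
(* structure Jm (J^2 = -1, bracket C-bilinear).  Vectors are nat -> R and  *)
(* matrices nat -> nat -> R; only coordinates < dim are meaningful, and    *)
(* equality is taken on those coordinates (veq / meq).                     *)

Definition vec := nat -> R.
Definition mat := nat -> nat -> R.

Fixpoint rsum (n : nat) (f : nat -> R) : R :=
  match n with O => 0 | S n' => rsum n' f + f n' end.

Record LieData := {
  dim : nat;
  sc : nat -> nat -> nat -> R;   (* [e_i, e_j] = sum_k sc i j k e_k *)
  cx : bool;                     (* true : F = C, false : F = R *)
  Jm : mat                       (* complex structure (used iff cx) *)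
}.

Section LA.
Variable g : LieData.
Let N := dim g.

Definition veq (v w : vec) : Prop := forall i, (i < N)%nat -> v i = w i.
Definition meq (A B : mat) : Prop :=
  forall i j, (i < N)%nat -> (j < N)%nat -> A i j = B i j.

Definition vzero : vec := fun _ => 0.
Definition vadd (v w : vec) : vec := fun i => v i + w i.
Definition vscal (a : R) (v : vec) : vec := fun i => a * v i.
Definition mapply (A : mat) (v : vec) : vec := fun i => rsum N (fun j => A i j * v j).
Definition mmul (A B : mat) : mat := fun i k => rsum N (fun j => A i j * B j k).
Definition mid : mat := fun i j => if Nat.eqb i j then 1 else 0.
Fixpoint mpow (A : mat) (k : nat) : mat :=
  match k with O => mid | S k' => mmul A (mpow A k') end.

Definition br (x y : vec) : vec :=
  fun k => rsum N (fun i => rsum N (fun j => sc g i j k * x i * y j)).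

Definition is_lie : Prop :=
  (forall x, veq (br x x) vzero) /\
  (forall x y z, veq (vadd (br x (br y z)) (vadd (br y (br z x)) (br z (br x y)))) vzero).

Definition cx_structure : Prop :=
  cx g = true ->
  meq (mmul (Jm g) (Jm g)) (fun i j => - mid i j) /\
  (forall x y, veq (br (mapply (Jm g) x) y) (mapply (Jm g) (br x y))).

Definition F_subspace (W : vec -> Prop) : Prop :=
  (forall v w, W v -> veq v w -> W w) /\ W vzero /\
  (forall v w, W v -> W w -> W (vadd v w)) /\
  (forall a v, W v -> W (vscal a v)) /\
  (cx g = true -> forall v, W v -> W (mapply (Jm g) v)).

Definition ideal (W : vec -> Prop) : Prop :=
  F_subspace W /\ forall x y, W x -> W (br y x).

Definition simple : Prop :=
  (exists x y, ~ veq (br x y) vzero) /\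
  forall W, ideal W -> (forall x, W x -> veq x vzero) \/ (forall x, W x).

Definition ad (x : vec) : mat := fun k j => rsum N (fun i => sc g i j k * x i).
Definition killing (x y : vec) : R := rsum N (fun k => mmul (ad x) (ad y) k k).

Definition compact : Prop :=
  forall x, ~ veq x vzero -> killing x x < 0.

Definition simple_lie_alg : Prop :=
  is_lie /\ cx_structure /\ simple /\ (cx g = false -> compact).

Definition F_linear (A : mat) : Prop :=
  cx g = true -> meq (mmul A (Jm g)) (mmul (Jm g) A).

Definition AutG (A : mat) : Prop :=
  F_linear A /\
  (forall x y, veq (mapply A (br x y)) (br (mapply A x) (mapply A y))) /\
  exists B, meq (mmul A B) mid /\ meq (mmul B A) mid.

Definition morder (A : mat) (k : nat) : Prop :=
  (0 < k)%nat /\ meq (mpow A k) mid /\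
  forall j, (0 < j)%nat -> (j < k)%nat -> ~ meq (mpow A j) mid.

Definition in_centralizer_id_comp (gamma a : mat) : Prop :=
  exists p : R -> mat,
    (forall i j, (i < N)%nat -> (j < N)%nat -> continuity (fun t => p t i j)) /\
    meq (p 0) mid /\ meq (p 1) a /\
    forall t, 0 <= t <= 1 -> AutG (p t) /\ meq (mmul (p t) gamma) (mmul gamma (p t)).

Definition smooth (f : R -> R) : Prop :=
  exists D : nat -> R -> R, (forall x, D O x = f x) /\
    forall k x, derivable_pt_lim (D k) x (D (S k) x).

Definition loop := R -> vec.

Definition in_L (sigma : mat) (u : loop) : Prop :=
  (forall i, (i < N)%nat -> smooth (fun t => u t i)) /\
  forall t, veq (u (t + 2 * PI)) (mapply sigma (u t)).

Definition leqL (u v : loop) : Prop := forall t, veq (u t) (v t).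
Definition ladd (u v : loop) : loop := fun t => vadd (u t) (v t).
Definition lscal (a : R) (u : loop) : loop := fun t => vscal a (u t).
Definition lJ (u : loop) : loop := fun t => mapply (Jm g) (u t).
Definition lbr (u v : loop) : loop := fun t => br (u t) (v t).

Definition LHom (s1 s2 : mat) (Phi : loop -> loop) : Prop :=
  (forall u, in_L s1 u -> in_L s2 (Phi u)) /\
  (forall u v, in_L s1 u -> in_L s1 v -> leqL u v -> leqL (Phi u) (Phi v)) /\
  (forall u v, in_L s1 u -> in_L s1 v -> leqL (Phi (ladd u v)) (ladd (Phi u) (Phi v))) /\
  (forall a u, in_L s1 u -> leqL (Phi (lscal a u)) (lscal a (Phi u))) /\
  (cx g = true -> forall u, in_L s1 u -> leqL (Phi (lJ u)) (lJ (Phi u))) /\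
  (forall u v, in_L s1 u -> in_L s1 v -> leqL (Phi (lbr u v)) (lbr (Phi u) (Phi v))).

Definition LIso (s1 s2 : mat) (Phi : loop -> loop) : Prop :=
  LHom s1 s2 Phi /\
  (forall u v, in_L s1 u -> in_L s1 v -> leqL (Phi u) (Phi v) -> leqL u v) /\
  (forall w, in_L s2 w -> exists u, in_L s1 u /\ leqL (Phi u) w).

Definition LAut (s : mat) (Phi : loop -> loop) : Prop := LIso s s Phi.

Fixpoint lpow (Phi : loop -> loop) (k : nat) (u : loop) : loop :=
  match k with O => u | S k' => Phi (lpow Phi k' u) end.

Definition lorder (s : mat) (Phi : loop -> loop) (k : nat) : Prop :=
  (0 < k)%nat /\ (forall u, in_L s u -> leqL (lpow Phi k u) u) /\
  forall j, (0 < j)%nat -> (j < k)%nat ->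
    ~ (forall u, in_L s u -> leqL (lpow Phi j u) u).

(* automorphism of the second kind: (Phi u)(t) = phi_t(u(lam t)) with
   lam(t + 2pi) = lam(t) - 2pi a diffeomorphism, and phi_t in Aut g smooth
   with phi_{t+2pi} = s phi_t s^{-epsilon}, epsilon = -1 *)
Definition second_kind (s : mat) (Phi : loop -> loop) : Prop :=
  exists (lam : R -> R) (phi : R -> mat),
    smooth lam /\
    (exists laminv : R -> R, smooth laminv /\
       (forall x, lam (laminv x) = x) /\ (forall x, laminv (lam x) = x)) /\
    (forall t, lam (t + 2 * PI) = lam t - 2 * PI) /\
    (forall i j, (i < N)%nat -> (j < N)%nat -> smooth (fun t => phi t i j)) /\
    (forall t, AutG (phi t)) /\
    (forall t, meq (phi (t + 2 * PI)) (mmul s (mmul (phi t) s))) /\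
    (forall u, in_L s u -> forall t, veq (Phi u t) (mapply (phi t) (u (lam t)))).

Definition quasiconj (s1 : mat) (Phi1 : loop -> loop) (s2 : mat) (Phi2 : loop -> loop) : Prop :=
  exists psi, LIso s1 s2 psi /\
    forall u, in_L s1 u -> leqL (psi (Phi1 u)) (Phi2 (psi u)).

Definition Phi_pair (ap : mat) : loop -> loop := fun u t => mapply ap (u (- t)).

Definition inJq (q : nat) (ap am : mat) : Prop :=
  AutG ap /\ AutG am /\ meq (mmul ap ap) (mmul am am) /\
  morder (mmul ap ap) (Nat.div q 2).

Inductive pair_rel : mat -> mat -> mat -> mat -> Prop :=
| pr_eq : forall a b a' b', meq a a' -> meq b b' -> pair_rel a b a' b'
| pr_swap : forall a b, pair_rel a b b a
| pr_conj : forall a b al ali be bei,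
    AutG al -> AutG be ->
    meq (mmul al ali) mid -> meq (mmul ali al) mid ->
    meq (mmul be bei) mid -> meq (mmul bei be) mid ->
    in_centralizer_id_comp (mmul a a) (mmul ali be) ->
    pair_rel a b (mmul al (mmul a ali)) (mmul be (mmul b bei))
| pr_sym : forall a b a' b', pair_rel a b a' b' -> pair_rel a' b' a b
| pr_trans : forall a b a' b' a'' b'',
    pair_rel a b a' b' -> pair_rel a' b' a'' b'' -> pair_rel a b a'' b''.

End LA.

(* Main.v *)
(* An isomorphism [psi] between twisted loop algebras has the form
   (psi u)(t) = Q_t (u (th t)).  Indeed the kernel I of u |-> (psi u)(t) is an
   ideal with simple quotient.  If I had no common zero, then [L, I], which is
   a C^oo(S^1)-module because f [w, u] = [f w, u], would have full fibres at
   every point, and a partition of unity would give I = L.  So I consists of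
   the loops vanishing at a point, and th is smooth because psi carries f u to
   (f o th) psi u for periodic f.

   If psi intertwines the automorphisms of two pairs, then
   th (-t) = - th t + 2 pi m, and comparing the two sides at t = 0 and t = pi
   shows that (Q_0, Q_pi) conjugates a pair of consecutive reflections of the
   dihedral group generated by the first pair to the second pair, while
   Q_0^-1 Q_t is a path in the centralizer.  Conversely a path in the
   centralizer can be replaced by a smooth one, because an automorphism A near
   1 lies on the one-parameter group of automorphisms A^t; this path, extended
   equivariantly, is the required gauge transformation.

   Surjectivity: if Phi has finite order, (Phi u)(t) = phi_t (u (lam t)), then
   lam is an involution, hence conjugate to t |-> -t, and averaging over the
   powers of Phi gives a Phi-invariant connection d/dt - X with X_t a
   derivation; parallel transport for it conjugates Phi to the normal form. *)

Require Import Defs.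
From Stdlib Require Import Reals Arith.
From Stdlib Require Import Lra Lia ZArith Zfloor ClassicalEpsilon IndefiniteDescription Setoid Morphisms PSeries_reg Ranalysis5.
From Coquelicot Require Import Coquelicot.
Open Scope R_scope.

(** * Smooth functions *)

(** An isomorphism of loop algebras is an abstract linear bijection with no continuity built in, so
    its smooth form has to be read off from its values on well-chosen test loops. [Aut g] is
    likewise handled purely as a set of matrices. The power [A^t] of an automorphism near 1 is a
    binomial series, and it preserves the bracket by a Rolle argument: the bracket pulled back along
    [A^t] is the same at t = 0 and t = 1, which bounds every coefficient of the derivation defect of
    the logarithm by a small multiple of the sum of all of them. A continuous path in the
    centralizer is never smoothed as a curve. Only its endpoint matters: it is a finite product of
    automorphisms near 1, and smooth paths that are constant outside [0, 1] can be multiplied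
    pointwise. Evenness of the order comes from the parameter alone: the k-th iterate of [lam]
    changes by (-1)^k 2 pi over a period, whereas a trivial iterate of the automorphism makes it a
    translation. Finite order makes [lam] an involution because its square is an increasing map of
    finite order. *)

Lemma choice_lt {T : Type} (x0 : T) (n : nat) (P : nat -> T -> Prop) :
  (forall i, (i < n)%nat -> exists x, P i x) -> exists f, forall i, (i < n)%nat -> P i (f i).
Proof.
  intros H; apply (functional_choice (fun i x => (i < n)%nat -> P i x)); intros i.
  destruct (lt_dec i n) as [Hi|Hi].
  - destruct (H i Hi) as [x Hx]; exists x; intros _; exact Hx.
  - exists x0; intros; contradiction.
Qed.

Lemma derivable_pt_lim_ext_loc (f f2 : R -> R) (x l d : R) :
  0 < d -> (forall y, Rabs (y - x) < d -> f y = f2 y) ->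
  derivable_pt_lim f x l -> derivable_pt_lim f2 x l.
Proof.
  intros Hd He Hf eps Heps.
  destruct (Hf eps Heps) as [dl Hdl].
  assert (Hm : 0 < Rmin dl d) by (apply Rmin_pos; [apply cond_pos | exact Hd]).
  exists (mkposreal _ Hm); simpl; intros h Hh0 Hh.
  rewrite <- !He.
  - apply Hdl; [exact Hh0 | apply Rlt_le_trans with (1 := Hh), Rmin_l].
  - unfold Rminus; rewrite Rplus_opp_r, Rabs_R0; exact Hd.
  - replace (x + h - x) with h by ring. apply Rlt_le_trans with (1 := Hh), Rmin_r.
Qed.

Lemma derivable_pt_lim_ext (f f2 : R -> R) (x l : R) :
  (forall y, f y = f2 y) -> derivable_pt_lim f x l -> derivable_pt_lim f2 x l.
Proof. intros He; apply (derivable_pt_lim_ext_loc f f2 x l 1); [lra | auto]. Qed.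

Lemma derivable_pt_lim_eq (f : R -> R) (x l l2 : R) :
  derivable_pt_lim f x l -> l = l2 -> derivable_pt_lim f x l2.
Proof. intros H <-; exact H. Qed.

Lemma smooth_derivative f :
  smooth f -> exists f', smooth f' /\ forall x, derivable_pt_lim f x (f' x).
Proof.
  intros [D [H0 HD]]; exists (D 1%nat); split.
  - exists (fun k => D (S k)); split; [reflexivity | intros k x; apply HD].
  - intros x; apply derivable_pt_lim_ext with (2 := HD O x); auto.
Qed.

(** The tower of derivatives demanded by [smooth] arises by iterating one choice of derivative
    inside [P]; the subset type carries membership in [P] along the iteration. *)
Lemma smooth_coinduction (P : (R -> R) -> Prop) :
  (forall f, P f -> exists f', P f' /\ forall x, derivable_pt_lim f x (f' x)) ->
  forall f, P f -> smooth f.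
Proof.
  intros Hstep f Hf.
  assert (Hch : forall F : {f | P f}, exists F' : {f | P f},
    forall x, derivable_pt_lim (proj1_sig F) x (proj1_sig F' x)).
  { intros [h Hh]; destruct (Hstep h Hh) as [h' [Hh' Hd]].
    exists (exist _ h' Hh'); exact Hd. }
  destruct (functional_choice _ Hch) as [next Hnext].
  exists (fun k => proj1_sig (Nat.iter k next (exist _ f Hf))); split.
  - reflexivity.
  - intros k x; apply Hnext.
Qed.

(** The atoms [B] are closed under operations whose differentiation rules only involve the same
    operations; [gen_ext] makes the closure invariant under pointwise equality. *)
Inductive gen (B : (R -> R) -> Prop) : (R -> R) -> Prop :=
| gen_base f : B f -> gen B f
| gen_smooth f : smooth f -> gen B f
| gen_const c : gen B (fun _ => c)
| gen_plus f h : gen B f -> gen B h -> gen B (fun x => f x + h x)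
| gen_mult f h : gen B f -> gen B h -> gen B (fun x => f x * h x)
| gen_comp f h : smooth f -> gen B h -> gen B (fun x => f (h x))
| gen_inv f : gen B f -> (forall x, f x <> 0) -> gen B (fun x => / f x)
| gen_ext f h : gen B f -> (forall x, f x = h x) -> gen B h.

(* Coinduction up to algebraic operations: to see that the functions in [B]
   are smooth it suffices to express their derivatives through [B] itself. *)
Lemma smooth_upto (B : (R -> R) -> Prop) :
  (forall f, B f -> exists f', gen B f' /\ forall x, derivable_pt_lim f x (f' x)) ->
  forall f, gen B f -> smooth f.
Proof.
  intros HB; apply smooth_coinduction.
  induction 1 as [f Hf|f Hf|c|f h Hf [f' [Gf Df]] Hh [h' [Gh Dh]]
    |f h Hf [f' [Gf Df]] Hh [h' [Gh Dh]]|f h Hf Hh [h' [Gh Dh]]|f Hf [f' [Gf Df]] Hn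
    |f h Hf [f' [Gf Df]] He].
  - exact (HB f Hf).
  - destruct (smooth_derivative f Hf) as [f' [Sf Df]].
    exists f'; split; [apply gen_smooth; exact Sf | exact Df].
  - exists (fun _ => 0); split; [apply gen_const | intros x; apply derivable_pt_lim_const].
  - exists (fun x => f' x + h' x); split; [apply gen_plus; assumption|].
    intros x; exact (derivable_pt_lim_plus f h x _ _ (Df x) (Dh x)).
  - exists (fun x => f' x * h x + f x * h' x); split.
    + apply gen_plus; apply gen_mult; assumption.
    + intros x; exact (derivable_pt_lim_mult f h x _ _ (Df x) (Dh x)).
  - destruct (smooth_derivative f Hf) as [f' [Sf Df]].
    exists (fun x => f' (h x) * h' x); split.
    + apply gen_mult; [apply gen_comp|]; assumption.
    + intros x; exact (derivable_pt_lim_comp h f x _ _ (Dh x) (Df (h x))).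
  - exists (fun x => (-1) * f' x * (/ f x * / f x)); split.
    + apply gen_mult; [apply gen_mult; [apply gen_const|assumption]|].
      apply gen_mult; apply gen_inv; assumption.
    + intros x.
      assert (D := derivable_pt_lim_div (fun _ => 1) f x _ _
        (derivable_pt_lim_const 1 x) (Df x) (Hn x)).
      apply derivable_pt_lim_ext with (2 := derivable_pt_lim_eq _ _ _ ((-1) * f' x * (/ f x * / f x)) D
        ltac:(unfold Rsqr; field; apply Hn)).
      intros y; unfold div_fct; field; apply Hn.
  - exists f'; split; [exact Gf|].
    intros x; apply derivable_pt_lim_ext with (2 := Df x); exact He.
Qed.

(** With no atoms at all, the up-to principle yields the closure properties of smooth functions
    themselves. *)
Lemma gen_false_smooth f : gen (fun _ => False) f -> smooth f.
Proof. apply smooth_upto; intros h []. Qed.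

Lemma smooth_ext f h : smooth f -> (forall x, f x = h x) -> smooth h.
Proof. intros Hf He; apply gen_false_smooth; apply gen_ext with f; [apply gen_smooth, Hf | exact He]. Qed.

Lemma smooth_const c : smooth (fun _ => c).
Proof. apply gen_false_smooth; apply gen_const. Qed.

Lemma smooth_plus f h : smooth f -> smooth h -> smooth (fun x => f x + h x).
Proof. intros; apply gen_false_smooth; apply gen_plus; apply gen_smooth; assumption. Qed.

Lemma smooth_mult f h : smooth f -> smooth h -> smooth (fun x => f x * h x).
Proof. intros; apply gen_false_smooth; apply gen_mult; apply gen_smooth; assumption. Qed.

Lemma smooth_comp f h : smooth f -> smooth h -> smooth (fun x => f (h x)).
Proof. intros; apply gen_false_smooth; apply gen_comp; [|apply gen_smooth]; assumption. Qed.

Lemma smooth_inv f : smooth f -> (forall x, f x <> 0) -> smooth (fun x => / f x).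
Proof. intros; apply gen_false_smooth; apply gen_inv; [apply gen_smooth|]; assumption. Qed.

Lemma smooth_id : smooth (fun x => x).
Proof.
  apply (smooth_upto (fun f => f = fun x => x)); [|apply gen_base; reflexivity].
  intros f ->; exists (fun _ => 1); split; [apply gen_const|].
  intros x; apply derivable_pt_lim_id.
Qed.

Lemma smooth_scal c f : smooth f -> smooth (fun x => c * f x).
Proof. intros; apply smooth_mult; [apply smooth_const | assumption]. Qed.

Lemma smooth_opp f : smooth f -> smooth (fun x => - f x).
Proof. intros H; apply smooth_ext with (fun x => (-1) * f x); [apply smooth_scal, H | intros; ring]. Qed.

Lemma smooth_minus f h : smooth f -> smooth h -> smooth (fun x => f x - h x).
Proof. intros Hf Hh; apply smooth_plus; [exact Hf | apply smooth_opp, Hh]. Qed.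

Lemma smooth_div f h : smooth f -> smooth h -> (forall x, h x <> 0) -> smooth (fun x => f x / h x).
Proof. intros; apply smooth_mult; [|apply smooth_inv]; assumption. Qed.

Lemma smooth_rsum n (F : nat -> R -> R) :
  (forall i, (i < n)%nat -> smooth (F i)) -> smooth (fun x => rsum n (fun i => F i x)).
Proof.
  induction n as [|n IH]; intros H; simpl.
  - apply smooth_const.
  - apply smooth_plus; [apply IH; intros i Hi; apply H; lia | apply H; lia].
Qed.

Lemma gen_rsum B n (F : nat -> R -> R) :
  (forall i, (i < n)%nat -> gen B (F i)) -> gen B (fun x => rsum n (fun i => F i x)).
Proof.
  induction n as [|n IH]; intros H; simpl.
  - apply gen_const.
  - apply gen_plus; [apply IH; intros i Hi; apply H; lia | apply H; lia].
Qed.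

Lemma smooth_sin_cos : smooth sin /\ smooth cos.
Proof.
  assert (H : forall f, gen (fun f => f = sin \/ f = cos) f -> smooth f).
  { apply smooth_upto; intros f [-> | ->].
    - exists cos; split; [apply gen_base; auto | apply derivable_pt_lim_sin].
    - exists (fun x => (-1) * sin x); split.
      + apply gen_mult; [apply gen_const | apply gen_base; auto].
      + intros x; apply derivable_pt_lim_eq with (1 := derivable_pt_lim_cos x); ring. }
  split; apply H, gen_base; auto.
Qed.

Lemma derivable_pt_lim_continuity_pt f x l : derivable_pt_lim f x l -> continuity_pt f x.
Proof. intros D; apply derivable_continuous_pt; exists l; exact D. Qed.

Lemma smooth_continuity f : smooth f -> continuity f.
Proof.
  intros H x; destruct (smooth_derivative f H) as [f' [_ D]].
  apply derivable_pt_lim_continuity_pt with (1 := D x).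
Qed.

(** The hypothesis reproduces itself: near each point the derivative of [f] is the derivative of the
    local smooth representative, so coinduction applies. *)
Lemma smooth_local f :
  (forall t, exists d h, 0 < d /\ smooth h /\ forall x, Rabs (x - t) < d -> f x = h x) ->
  smooth f.
Proof.
  revert f; apply smooth_coinduction; intros f Hf.
  assert (Hl : forall t, exists l, derivable_pt_lim f t l).
  { intros t; destruct (Hf t) as [d [h [Hd [Hh He]]]].
    destruct (smooth_derivative h Hh) as [h' [_ D]]; exists (h' t).
    apply derivable_pt_lim_ext_loc with (3 := D t) (1 := Hd); intros; symmetry; auto. }
  destruct (functional_choice _ Hl) as [f' HD].
  exists f'; split; [|exact HD].
  intros t; destruct (Hf t) as [d [h [Hd [Hh He]]]].
  destruct (smooth_derivative h Hh) as [h' [Sh D]].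
  exists d, h'; split; [exact Hd | split; [exact Sh|]].
  intros x Hx; apply uniqueness_limite with (1 := HD x).
  (* The ball of this radius around [x] still lies in the ball of radius [d] around [t]. *)
  apply derivable_pt_lim_ext_loc with (d := d - Rabs (x - t)) (3 := D x); [lra|].
  intros y Hy; symmetry; apply He.
  replace (y - t) with ((y - x) + (x - t)) by ring.
  apply Rle_lt_trans with (1 := Rabs_triang _ _); lra.
Qed.

Lemma smooth_antiderivative f (a c : R) :
  smooth f -> exists F, smooth F /\ F a = c /\ forall x, derivable_pt_lim F x (f x).
Proof.
  intros Hf.
  assert (HD : forall x, derivable_pt_lim (fun x => c + RInt f a x) x (f x)).
  { intros x; apply is_derive_Reals.
    replace (f x) with (0 + f x) by ring.
    apply (is_derive_plus (fun _ => c) (fun x => RInt f a x)).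
    - apply @is_derive_const.
    - apply (is_derive_RInt f (fun x => RInt f a x) a x).
      + exists (mkposreal 1 Rlt_0_1); intros b _.
        apply (@RInt_correct R_CompleteNormedModule), (@ex_RInt_continuous R_CompleteNormedModule).
        intros z _; apply continuity_pt_filterlim, smooth_continuity, Hf.
      + apply continuity_pt_filterlim, smooth_continuity, Hf. }
  exists (fun x => c + RInt f a x); split; [|split].
  - apply (smooth_upto (fun h => h = fun x => c + RInt f a x)); [|apply gen_base; reflexivity].
    intros h ->; exists f; split; [apply gen_smooth, Hf | exact HD].
  - rewrite (@RInt_point R_CompleteNormedModule); unfold zero; simpl; ring.
  - exact HD.
Qed.

Lemma deriv_zero_const_on (f : R -> R) (a b : R) :
  a <= b -> (forall x, a <= x <= b -> derivable_pt_lim f x 0) -> f b = f a.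
Proof.
  intros Hab H; destruct (Req_dec a b) as [->|Hne]; [reflexivity|].
  destruct (MVT_cor2 f (fun _ => 0) a b) as [c [Hc _]]; [lra | exact H | lra].
Qed.

Lemma deriv_zero_const (f : R -> R) (a b : R) :
  (forall x, derivable_pt_lim f x 0) -> f b = f a.
Proof.
  intros H; destruct (Rle_dec a b).
  - apply deriv_zero_const_on; auto.
  - symmetry; apply deriv_zero_const_on; [lra | auto].
Qed.

(* The angle is an antiderivative of [c s' - s c']. *)
Lemma angle_lift (c s : R -> R) (t0 : R) (Hc : smooth c) (Hs : smooth s) :
  (forall t, c t * c t + s t * s t = 1) -> (exists th0, c t0 = cos th0 /\ s t0 = sin th0) ->
  exists th, smooth th /\ forall t, cos (th t) = c t /\ sin (th t) = s t.
Proof.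
  intros H1 [th0 [Hc0 Hs0]].
  destruct (smooth_derivative c Hc) as [c' [Sc Dc]].
  destruct (smooth_derivative s Hs) as [s' [Ss Ds]].
  destruct (smooth_antiderivative (fun t => c t * s' t - s t * c' t) t0 th0) as [th [Hth [Hi Dth]]].
  { apply smooth_minus; apply smooth_mult; assumption. }
  exists th; split; [exact Hth|].
  (* Differentiating c^2 + s^2 = 1 gives the orthogonality relation, whence c' = -s w and s' = c w
     with the angular velocity w = c s' - s c'. *)
  assert (Hcs : forall t, c t * c' t + s t * s' t = 0).
  { intros t.
    assert (D := derivable_pt_lim_plus _ _ t _ _
      (derivable_pt_lim_mult c c t _ _ (Dc t) (Dc t)) (derivable_pt_lim_mult s s t _ _ (Ds t) (Ds t))).
    assert (E := uniqueness_limite _ _ _ _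
      (derivable_pt_lim_ext _ (fun _ => 1) _ _ ltac:(intros y; unfold plus_fct, mult_fct; apply H1) D)
      (derivable_pt_lim_const 1 t)).
    lra. }
  assert (Ec : forall t, c' t = - s t * (c t * s' t - s t * c' t)).
  { intros t; transitivity (c' t * (c t * c t + s t * s t)); [rewrite H1; ring|].
    transitivity (c t * (c t * c' t) + s t * s t * c' t); [ring|].
    replace (c t * c' t) with (- (s t * s' t)) by (specialize (Hcs t); lra). ring. }
  assert (Es : forall t, s' t = c t * (c t * s' t - s t * c' t)).
  { intros t; transitivity (s' t * (c t * c t + s t * s t)); [rewrite H1; ring|].
    transitivity (s t * (s t * s' t) + c t * c t * s' t); [ring|].
    replace (s t * s' t) with (- (c t * c' t)) by (specialize (Hcs t); lra). ring. }
  assert (Dcos : forall t, derivable_pt_lim (fun t => cos (th t)) t (- sin (th t) * (c t * s' t - s t * c' t)))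
    by (intros t; apply (derivable_pt_lim_comp th cos t _ _ (Dth t)), derivable_pt_lim_cos).
  assert (Dsin : forall t, derivable_pt_lim (fun t => sin (th t)) t (cos (th t) * (c t * s' t - s t * c' t)))
    by (intros t; apply (derivable_pt_lim_comp th sin t _ _ (Dth t)), derivable_pt_lim_sin).
  (* The point (c, s) rotated back by the angle [th] has zero derivative, so it stays at its initial
     position (1, 0). [HA] and [HB] are its two coordinates. *)
  assert (HA : forall t, c t * cos (th t) + s t * sin (th t) = 1).
  { intros t.
    rewrite (deriv_zero_const (fun t => c t * cos (th t) + s t * sin (th t)) t0 t).
    - rewrite Hi, Hc0, Hs0; generalize (sin2_cos2 th0); unfold Rsqr; lra.
    - intros x; eapply derivable_pt_lim_eq.
      + apply (derivable_pt_lim_plus (fun t => c t * cos (th t)) (fun t => s t * sin (th t))).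
        * apply (derivable_pt_lim_mult c (fun t => cos (th t))); [apply Dc | apply Dcos].
        * apply (derivable_pt_lim_mult s (fun t => sin (th t))); [apply Ds | apply Dsin].
      + cbv beta. generalize (Ec x) (Es x). set (w := c x * s' x - s x * c' x).
        intros E1 E2; rewrite E1, E2; ring. }
  assert (HB : forall t, s t * cos (th t) - c t * sin (th t) = 0).
  { intros t.
    rewrite (deriv_zero_const (fun t => s t * cos (th t) - c t * sin (th t)) t0 t).
    - rewrite Hi, Hc0, Hs0; ring.
    - intros x; eapply derivable_pt_lim_eq.
      + apply (derivable_pt_lim_minus (fun t => s t * cos (th t)) (fun t => c t * sin (th t))).
        * apply (derivable_pt_lim_mult s (fun t => cos (th t))); [apply Ds | apply Dcos].
        * apply (derivable_pt_lim_mult c (fun t => sin (th t))); [apply Dc | apply Dsin].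
      + cbv beta. generalize (Ec x) (Es x). set (w := c x * s' x - s x * c' x).
        intros E1 E2; rewrite E1, E2; ring. }
  intros t; specialize (HA t); specialize (HB t); specialize (H1 t).
  split.
  - transitivity (c t * 1 + s t * 0); [rewrite <- HA, <- HB | ring].
    transitivity (cos (th t) * (c t * c t + s t * s t)); [rewrite H1; ring | ring].
  - transitivity (s t * 1 - c t * 0); [rewrite <- HA, <- HB | ring].
    transitivity (sin (th t) * (c t * c t + s t * s t)); [rewrite H1; ring | ring].
Qed.

(** * Bump functions and inverse functions *)

(* The functions [x^-n exp (-1/x)] span a space closed under differentiation. *)
Definition flat (n : nat) (x : R) : R := if Rlt_dec 0 x then (/ x) ^ n * exp (- / x) else 0.

Lemma flat_pos n x : 0 < x -> 0 < flat n x.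
Proof.
  intros Hx; unfold flat; destruct (Rlt_dec 0 x); [|lra].
  apply Rmult_lt_0_compat; [apply pow_lt, Rinv_0_lt_compat, Hx | apply exp_pos].
Qed.

Lemma flat_nonpos n x : x <= 0 -> flat n x = 0.
Proof. intros Hx; unfold flat; destruct (Rlt_dec 0 x); lra. Qed.

Lemma flat_nonneg n x : 0 <= flat n x.
Proof.
  destruct (Rlt_dec 0 x); [left; apply flat_pos; assumption | right; symmetry; apply flat_nonpos; lra].
Qed.

Lemma pow_le_exp n y : 0 <= y -> y ^ n <= INR (Factorial.fact n) * exp y.
Proof.
  intros Hy.
  assert (Hf : 0 < INR (Factorial.fact n)) by apply INR_fact_lt_0.
  apply Rmult_le_reg_l with (/ INR (Factorial.fact n)); [apply Rinv_0_lt_compat, Hf|].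
  rewrite <- Rmult_assoc, Rinv_l, Rmult_1_l by lra.
  apply Rle_trans with (2 := exp_ge_taylor y n Hy).
  assert (Hp : forall k, 0 <= y ^ k / INR (Factorial.fact k)).
  { intros k; apply Rmult_le_pos; [apply pow_le, Hy|].
    left; apply Rinv_0_lt_compat, INR_fact_lt_0. }
  rewrite Rmult_comm; fold (y ^ n / INR (Factorial.fact n)).
  destruct n as [|n]; [simpl; lra|].
  rewrite tech5.
  assert (H0 : 0 <= sum_f_R0 (fun k => y ^ k / INR (Factorial.fact k)) n).
  { clear Hf; induction n as [|n IH]; simpl sum_f_R0; [apply (Hp O)|].
    apply Rplus_le_le_0_compat; [exact IH | apply (Hp (S n))]. }
  lra.
Qed.

(** This is y^(n+1) <= (n+1)! exp y at y = 1/x. It makes every [flat n] continuous at 0, which is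
    all that its differentiability there requires. *)
Lemma flat_le_linear n x : Rabs (flat n x) <= INR (Factorial.fact (S n)) * Rabs x.
Proof.
  destruct (Rlt_dec 0 x) as [Hx|Hx].
  - rewrite !Rabs_pos_eq by (try apply flat_nonneg; lra).
    unfold flat; destruct (Rlt_dec 0 x); [|lra].
    assert (Hi : 0 < / x) by (apply Rinv_0_lt_compat, Hx).
    assert (H := pow_le_exp (S n) (/ x) ltac:(lra)).
    apply Rmult_le_reg_l with (/ x * exp (/ x)); [apply Rmult_lt_0_compat; [exact Hi | apply exp_pos]|].
    replace (/ x * exp (/ x) * ((/ x) ^ n * exp (- / x)))
      with ((/ x) ^ S n * (exp (/ x) * exp (- / x))) by (simpl; ring).
    rewrite <- exp_plus, Rplus_opp_r, exp_0, Rmult_1_r.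
    replace (/ x * exp (/ x) * (INR (Factorial.fact (S n)) * x))
      with (INR (Factorial.fact (S n)) * exp (/ x) * (/ x * x)) by ring.
    rewrite Rinv_l, Rmult_1_r by lra; exact H.
  - rewrite flat_nonpos by lra; rewrite Rabs_R0.
    apply Rmult_le_pos; [apply pos_INR | apply Rabs_pos].
Qed.

Lemma flat_deriv n x :
  derivable_pt_lim (flat n) x ((- INR n) * flat (S n) x + flat (S (S n)) x).
Proof.
  destruct (Rtotal_order x 0) as [Hx|[->|Hx]].
  - rewrite !flat_nonpos by lra.
    apply derivable_pt_lim_ext_loc with (f := fun _ => 0) (d := - x); [lra| |].
    + intros y Hy; symmetry; apply flat_nonpos; apply Rabs_def2 in Hy; lra.
    + apply derivable_pt_lim_eq with (1 := derivable_pt_lim_const 0 x); ring.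
  - rewrite !flat_nonpos by lra.
    intros eps Heps.
    set (C := INR (Factorial.fact (S (S n)))).
    assert (HC : 0 < C) by apply INR_fact_lt_0.
    assert (Hd : 0 < eps / C) by (apply Rdiv_lt_0_compat; assumption).
    exists (mkposreal _ Hd); simpl; intros h Hh0 Hh.
    rewrite Rplus_0_l, (flat_nonpos n 0) by lra.
    (* Division by [h] raises the index by one, so the difference quotient at 0 is again a flat
       function and tends to 0. *)
    replace ((flat n h - 0) / h - (- INR n * 0 + 0)) with (flat (S n) h).
    + apply Rle_lt_trans with (1 := flat_le_linear (S n) h); fold C.
      apply Rlt_le_trans with (C * (eps / C)); [apply Rmult_lt_compat_l; assumption|].
      right; field; lra.
    + unfold flat; destruct (Rlt_dec 0 h); simpl; field; exact Hh0.
  - apply derivable_pt_lim_ext_loc with (f := fun y => (/ y) ^ n * exp (- / y)) (d := x); [lra| |].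
    + intros y Hy; unfold flat; destruct (Rlt_dec 0 y); [reflexivity|].
      apply Rabs_def2 in Hy; lra.
    + apply is_derive_Reals.
      unfold flat; destruct (Rlt_dec 0 x); [|lra].
      auto_derive; [lra|].
      destruct n as [|n]; [simpl; field; lra|].
      rewrite S_INR; simpl (pred (S n)); simpl pow; field; lra.
Qed.

Lemma smooth_flat n : smooth (flat n).
Proof.
  apply (smooth_upto (fun f => exists n, f = flat n)); [|apply gen_base; exists n; reflexivity].
  intros f [m ->]; exists (fun x => (- INR m) * flat (S m) x + flat (S (S m)) x); split; [|apply flat_deriv].
  apply gen_plus; [apply gen_mult; [apply gen_const|]|]; apply gen_base; eexists; reflexivity.
Qed.

Lemma smooth_step : exists h, smooth h /\ (forall x, x <= 0 -> h x = 0) /\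
  (forall x, 1 <= x -> h x = 1) /\ forall x, 0 <= h x <= 1.
Proof.
  assert (Hp : forall x, 0 < flat 0 x + flat 0 (1 - x)).
  { intros x; destruct (Rlt_dec 0 x).
    - apply Rplus_lt_le_0_compat; [apply flat_pos; assumption | apply flat_nonneg].
    - apply Rplus_le_lt_0_compat; [apply flat_nonneg | apply flat_pos; lra]. }
  exists (fun x => flat 0 x / (flat 0 x + flat 0 (1 - x))); split; [|split; [|split]].
  - assert (S1 : smooth (fun x => flat 0 (1 - x))).
    { apply smooth_comp; [apply smooth_flat | apply smooth_minus; [apply smooth_const | apply smooth_id]]. }
    apply smooth_div; [apply smooth_flat | apply smooth_plus; [apply smooth_flat | exact S1] |].
    intros x; specialize (Hp x); lra.
  - intros x Hx; rewrite (flat_nonpos 0 x) by lra; unfold Rdiv; ring.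
  - intros x Hx; rewrite (flat_nonpos 0 (1 - x)) by lra; rewrite Rplus_0_r.
    apply Rinv_r; specialize (Hp x); rewrite (flat_nonpos 0 (1 - x)) in Hp by lra; lra.
  - intros x; specialize (Hp x).
    assert (H0 := flat_nonneg 0 x); assert (H1 := flat_nonneg 0 (1 - x)).
    split.
    + apply Rmult_le_pos; [exact H0 | left; apply Rinv_0_lt_compat, Hp].
    + apply Rmult_le_reg_r with (1 := Hp); unfold Rdiv; rewrite Rmult_assoc, Rinv_l; lra.
Qed.

Lemma plateau (t0 d : R) : 0 < d ->
  exists b, smooth b /\ (forall t, 0 <= b t) /\ (forall t, Rabs (t - t0) <= d / 2 -> b t = 1) /\
    forall t, d <= Rabs (t - t0) -> b t = 0.
Proof.
  intros Hd; destruct smooth_step as [h [Sh [H0 [H1 Hb]]]].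
  (* Both affine arguments are at least 1 when |t - t0| <= d/2, and one of them is nonpositive as
     soon as |t - t0| >= d. *)
  exists (fun t => h (2 + (- (2 / d)) * (t - t0)) * h (2 + (2 / d) * (t - t0))); split; [|split; [|split]].
  - assert (S1 : forall c, smooth (fun t => h (2 + c * (t - t0)))).
    { intros c; apply smooth_comp; [exact Sh|]. apply smooth_plus; [apply smooth_const|].
      apply smooth_scal, smooth_minus; [apply smooth_id | apply smooth_const]. }
    apply smooth_mult; apply S1.
  - intros t; apply Rmult_le_pos; apply Hb.
  - assert (E : 2 / d * (d / 2) = 1) by (field; lra).
    assert (Hp : 0 < 2 / d) by (apply Rdiv_lt_0_compat; lra).
    intros t Ht; apply Rabs_le_between in Ht.
    rewrite !H1; [ring| |]; nra.
  - assert (E : 2 / d * d = 2) by (field; lra).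
    assert (Hp : 0 < 2 / d) by (apply Rdiv_lt_0_compat; lra).
    intros t Ht; unfold Rabs in Ht; destruct (Rcase_abs (t - t0)).
    + rewrite (H0 (2 + 2 / d * (t - t0))) by nra; ring.
    + rewrite (H0 (2 + - (2 / d) * (t - t0))) by nra; ring.
Qed.

(** Compactness of [a, b] in the form of continuous induction. The local hypothesis transports [P]
    between any two points near [s], in both directions, so the supremum of the points satisfying
    [P] can neither be missed nor stop short of [b]. *)
Lemma interval_induction (P : R -> Prop) (a b : R) : a <= b -> P a ->
  (forall s, a <= s <= b -> exists d, 0 < d /\ forall x y, a <= x <= b -> a <= y <= b ->
     Rabs (x - s) < d -> Rabs (y - s) < d -> P x -> P y) ->
  P b.
Proof.
  intros Hab Pa Hloc.
  destruct (completeness (fun x => a <= x <= b /\ P x)) as [s [Hub Hlub]].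
  - exists b; intros x [Hx _]; lra.
  - exists a; split; [lra | exact Pa].
  - assert (Hs : a <= s <= b).
    { split; [apply Hub; split; [lra | exact Pa] | apply Hlub; intros x [Hx _]; lra]. }
    destruct (Hloc s Hs) as [d [Hd Hstep]].
    assert (Hx : exists x, (a <= x <= b /\ P x) /\ s - d < x).
    { destruct (classic (exists x, (a <= x <= b /\ P x) /\ s - d < x)) as [H|H]; [exact H|].
      exfalso; assert (s <= s - d); [|lra].
      apply Hlub; intros x Hx; destruct (Rle_dec x (s - d)); [assumption|].
      exfalso; apply H; exists x; split; [exact Hx | lra]. }
    destruct Hx as [x [[Hx Px] Hxd]].
    assert (Hxs : x <= s) by (apply Hub; split; assumption).
    (* This point lies strictly beyond the supremum unless [s] is already [b]. *)
    set (y := Rmin b (s + d / 2)).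
    assert (Hy : a <= y <= b /\ s <= y /\ y <= s + d / 2).
    { unfold y; split; [split; [apply Rmin_glb; lra | apply Rmin_l] | split; [apply Rmin_glb; lra | apply Rmin_r]]. }
    assert (Py : P y).
    { apply (Hstep x y); try (unfold Rabs; destruct Rcase_abs); try tauto; lra. }
    assert (Hys : y <= s) by (apply Hub; split; [tauto | exact Py]).
    replace b with y; [exact Py|].
    unfold y in *; destruct (Rle_dec b (s + d / 2)).
    + apply Rmin_left; assumption.
    + rewrite Rmin_right in Hys by lra; lra.
Qed.

Lemma cos_sin_eq_2PI x y : cos x = cos y -> sin x = sin y -> exists k : Z, x = y + 2 * PI * IZR k.
Proof.
  intros Hc Hs.
  assert (H1 : cos (2 * ((x - y) / 2)) = 1).
  { replace (2 * ((x - y) / 2)) with (x - y) by field; rewrite cos_minus, Hc, Hs.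
    generalize (sin2_cos2 y); unfold Rsqr; lra. }
  rewrite cos_2a_sin in H1.
  destruct (sin_eq_0_0 ((x - y) / 2)) as [k Hk]; [nra|].
  exists k; lra.
Qed.

Lemma cos_sin_2PI_Z x (k : Z) : cos (x + 2 * PI * IZR k) = cos x /\ sin (x + 2 * PI * IZR k) = sin x.
Proof.
  assert (Hn : forall x n, cos (x + 2 * PI * INR n) = cos x /\ sin (x + 2 * PI * INR n) = sin x).
  { intros z n; replace (z + 2 * PI * INR n) with (z + 2 * INR n * PI) by ring.
    split; [apply cos_period | apply sin_period]. }
  destruct (Z_le_gt_dec 0 k) as [Hk|Hk].
  - rewrite <- (Z2Nat.id k Hk), <- INR_IZR_INZ; apply Hn.
  - destruct (Hn (x + 2 * PI * IZR k) (Z.to_nat (- k))) as [H1 H2].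
    rewrite INR_IZR_INZ, Z2Nat.id, opp_IZR in H1, H2 by lia.
    replace (x + 2 * PI * IZR k + 2 * PI * - IZR k) with x in H1, H2 by ring.
    split; symmetry; assumption.
Qed.

(** By the intermediate value theorem two different values would force a value halfway between
    consecutive multiples of 2 pi. *)
Lemma continuous_2PI_valued_const (f : R -> R) :
  continuity f -> (forall t, exists k : Z, f t = 2 * PI * IZR k) ->
  exists k : Z, forall t, f t = 2 * PI * IZR k.
Proof.
  intros Hf Hv; destruct (Hv 0) as [k Hk]; exists k; intros t.
  destruct (Hv t) as [m Hm]; rewrite Hm; f_equal; apply f_equal.
  assert (HPI := PI_RGT_0).
  destruct (Z.eq_dec m k) as [E|E]; [exact E | exfalso].
  assert (Habs : exists y, (exists j : Z, y = 2 * PI * (IZR j + / 2)) /\ Rmin (f 0) (f t) <= y <= Rmax (f 0) (f t)).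
  { rewrite Hk, Hm; destruct (Z_lt_ge_dec m k) as [L|L].
    - exists (2 * PI * (IZR m + / 2)); split; [exists m; reflexivity|].
      assert (IZR m + 1 <= IZR k) by (rewrite <- plus_IZR; apply IZR_le; lia).
      rewrite Rmin_right, Rmax_left by nra; split; nra.
    - exists (2 * PI * (IZR k + / 2)); split; [exists k; reflexivity|].
      assert (IZR k + 1 <= IZR m) by (rewrite <- plus_IZR; apply IZR_le; lia).
      rewrite Rmin_left, Rmax_right by nra; split; nra. }
  destruct Habs as [y [[j Hj] Hy]].
  destruct (IVT_gen f 0 t y Hf Hy) as [z [_ Hz]].
  destruct (Hv z) as [i Hi]; rewrite Hi, Hj in Hz.
  assert (E2 : IZR i = IZR j + / 2) by nra.
  assert (E3 : IZR (2 * i) = IZR (2 * j + 1)) by (rewrite plus_IZR, !mult_IZR; lra).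
  apply eq_IZR in E3; lia.
Qed.

(** The lower bound on the derivative makes [mu] expand distances by at least 1/2, hence injective,
    onto, and with a Lipschitz inverse. The constant 1/2 is the one that occurs for mu(t) = (t - lam
    t)/2 with [lam] decreasing. *)
Lemma smooth_inverse (mu mu' : R -> R) :
  smooth mu -> (forall t, derivable_pt_lim mu t (mu' t)) -> (forall t, / 2 <= mu' t) ->
  exists nu, smooth nu /\ (forall x, mu (nu x) = x) /\ (forall x, nu (mu x) = x).
Proof.
  intros Smu Dmu Hlow.
  assert (Hexp : forall s t, s <= t -> (t - s) / 2 <= mu t - mu s).
  { intros s t Hst; destruct (Req_dec s t) as [->|Hne]; [lra|].
    destruct (MVT_cor2 mu mu' s t) as [c [Hc _]]; [lra | auto |].
    specialize (Hlow c); nra. }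
  assert (Hinj : forall s t, mu s = mu t -> s = t).
  { intros s t E; destruct (Rle_dec s t); [specialize (Hexp s t)| specialize (Hexp t s)]; lra. }
  assert (Hsur : forall y, exists x, mu x = y).
  { intros y; set (r := 2 * Rabs (y - mu 0)).
    assert (Hr := Rabs_pos (y - mu 0)).
    assert (H1 := Hexp 0 r ltac:(unfold r; lra)).
    assert (H2 := Hexp (- r) 0 ltac:(unfold r; lra)).
    assert (H3 : - Rabs (y - mu 0) <= y - mu 0 <= Rabs (y - mu 0)) by (apply Rabs_le_between; lra).
    destruct (IVT_gen mu (- r) r y) as [x [_ Hx]].
    - apply smooth_continuity, Smu.
    - rewrite Rmin_left, Rmax_right by (unfold r in *; lra). unfold r in *; lra.
    - exists x; exact Hx. }
  destruct (functional_choice _ Hsur) as [nu Hnu].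
  assert (Hnu2 : forall x, nu (mu x) = x) by (intros x; apply Hinj, Hnu).
  assert (Hmono : forall x y, x <= y -> 0 <= nu y - nu x <= 2 * (y - x)).
  { intros x y Hxy; destruct (Rle_dec (nu x) (nu y)) as [L|L].
    - specialize (Hexp _ _ L); rewrite !Hnu in Hexp; lra.
    - assert (L2 : nu y <= nu x) by lra; specialize (Hexp _ _ L2); rewrite !Hnu in Hexp; lra. }
  assert (Hcont : forall x, continuity_pt nu x).
  { intros x eps Heps; exists (eps / 2); split; [lra|].
    intros y [_ Hy]; simpl in *; unfold Rdist in *.
    destruct (Rle_dec x y) as [L|L].
    - specialize (Hmono x y L). unfold Rabs in *; repeat destruct Rcase_abs; lra.
    - specialize (Hmono y x ltac:(lra)); unfold Rabs in *; repeat destruct Rcase_abs; lra. }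
  assert (Hd : forall x, derivable_pt_lim nu x (/ mu' (nu x))).
  { intros x.
    assert (Prf : forall a, nu (x - 1) <= a <= nu (x + 1) -> derivable_pt mu a)
      by (intros a _; exists (mu' a); apply Dmu).
    assert (Hin : nu (x - 1) <= nu x <= nu (x + 1)).
    { assert (A1 := Hmono (x - 1) x); assert (A2 := Hmono x (x + 1)); lra. }
    assert (Hv : derive_pt mu (nu x) (Prf (nu x) Hin) = mu' (nu x)).
    { apply derive_pt_eq_0, Dmu. }
    assert (D := derivable_pt_lim_recip_interv mu nu (x - 1) (x + 1) x Prf (Hcont x)
      ltac:(lra) ltac:(lra) Hin (fun y _ => Hnu y)).
    rewrite Hv in D; specialize (Hlow (nu x)).
    apply derivable_pt_lim_eq with (1 := D ltac:(lra)); field; lra. }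
  exists nu; split; [|split; assumption].
  destruct (smooth_derivative mu Smu) as [m [Sm Dm]].
  assert (Em : forall t, m t = mu' t) by (intros t; apply uniqueness_limite with (1 := Dm t), Dmu).
  apply (smooth_upto (fun f => f = nu)); [|apply gen_base; reflexivity].
  (* The derivative 1 / mu'(nu) is a smooth function of [nu] itself, as the up-to principle
     requires. *)
  intros f ->; exists (fun x => / m (nu x)); split.
  - apply (gen_comp _ (fun x => / m x)); [|apply gen_base; reflexivity].
    apply smooth_inv; [exact Sm | intros x; rewrite Em; specialize (Hlow x); lra].
  - intros x; rewrite Em; apply Hd.
Qed.

(** * Matrices and automorphisms *)

Lemma rsum_ext n f h : (forall i, (i < n)%nat -> f i = h i) -> rsum n f = rsum n h.
Proof.
  induction n as [|n IH]; intros H; simpl; [reflexivity|].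
  rewrite IH by (intros; apply H; lia); rewrite H by lia; reflexivity.
Qed.

Lemma rsum_0 n : rsum n (fun _ => 0) = 0.
Proof. induction n as [|n IH]; simpl; [reflexivity | rewrite IH; ring]. Qed.

Lemma rsum_zero n f : (forall i, (i < n)%nat -> f i = 0) -> rsum n f = 0.
Proof. intros H; rewrite (rsum_ext n f (fun _ => 0)) by exact H; apply rsum_0. Qed.

Lemma rsum_plus n f h : rsum n (fun i => f i + h i) = rsum n f + rsum n h.
Proof. induction n as [|n IH]; simpl; [ring | rewrite IH; ring]. Qed.

Lemma rsum_scal n c f : rsum n (fun i => c * f i) = c * rsum n f.
Proof. induction n as [|n IH]; simpl; [ring | rewrite IH; ring]. Qed.

Lemma rsum_scal_r n c f : rsum n (fun i => f i * c) = rsum n f * c.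
Proof. induction n as [|n IH]; simpl; [ring | rewrite IH; ring]. Qed.

Lemma rsum_minus n f h : rsum n (fun i => f i - h i) = rsum n f - rsum n h.
Proof. induction n as [|n IH]; simpl; [ring | rewrite IH; ring]. Qed.

Lemma rsum_swap n m (f : nat -> nat -> R) :
  rsum n (fun i => rsum m (fun j => f i j)) = rsum m (fun j => rsum n (fun i => f i j)).
Proof.
  induction n as [|n IH]; simpl.
  - symmetry; apply rsum_0.
  - rewrite IH, rsum_plus; reflexivity.
Qed.

Lemma rsum_delta n j (f : nat -> R) : (j < n)%nat ->
  rsum n (fun i => (if Nat.eqb i j then 1 else 0) * f i) = f j.
Proof.
  induction n as [|n IH]; intros Hj; [lia|]; simpl.
  destruct (Nat.eq_dec j n) as [->|Hne].
  - rewrite Nat.eqb_refl, rsum_zero; [ring|].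
    intros i Hi; rewrite (proj2 (Nat.eqb_neq i n)) by lia; ring.
  - rewrite IH by lia; rewrite (proj2 (Nat.eqb_neq n j)) by lia; ring.
Qed.

Lemma rsum_nonneg n f : (forall i, (i < n)%nat -> 0 <= f i) -> 0 <= rsum n f.
Proof.
  induction n as [|n IH]; intros H; simpl; [lra|].
  apply Rplus_le_le_0_compat; [apply IH; intros; apply H; lia | apply H; lia].
Qed.

Lemma rsum_le n f h : (forall i, (i < n)%nat -> f i <= h i) -> rsum n f <= rsum n h.
Proof.
  induction n as [|n IH]; intros H; simpl; [lra|].
  apply Rplus_le_compat; [apply IH; intros; apply H; lia | apply H; lia].
Qed.

Lemma rsum_const n c : rsum n (fun _ => c) = INR n * c.
Proof. induction n as [|n IH]; [simpl; ring | rewrite S_INR; simpl rsum; rewrite IH; ring]. Qed.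

Lemma rsum_Rabs n f : Rabs (rsum n f) <= rsum n (fun i => Rabs (f i)).
Proof.
  induction n as [|n IH]; simpl; [rewrite Rabs_R0; lra|].
  apply Rle_trans with (1 := Rabs_triang _ _); lra.
Qed.

Lemma rsum_Rabs_le n f c : (forall i, (i < n)%nat -> Rabs (f i) <= c) -> Rabs (rsum n f) <= INR n * c.
Proof.
  intros H; apply Rle_trans with (1 := rsum_Rabs n f); rewrite <- rsum_const; apply rsum_le, H.
Qed.

Lemma rsum_ge_term n f i : (forall k, (k < n)%nat -> 0 <= f k) -> (i < n)%nat -> f i <= rsum n f.
Proof.
  induction n as [|n IH]; intros H Hi; [lia|]; simpl.
  destruct (Nat.eq_dec i n) as [->|Hne].
  - assert (0 <= rsum n f) by (apply rsum_nonneg; intros; apply H; lia); lra.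
  - assert (f i <= rsum n f) by (apply IH; [intros; apply H; lia | lia]).
    assert (0 <= f n) by (apply H; lia); lra.
Qed.

Lemma rsum_derivable n (f f' : nat -> R -> R) t :
  (forall i, (i < n)%nat -> derivable_pt_lim (f i) t (f' i t)) ->
  derivable_pt_lim (fun t => rsum n (fun i => f i t)) t (rsum n (fun i => f' i t)).
Proof.
  induction n as [|n IH]; intros H; simpl.
  - apply derivable_pt_lim_const.
  - apply (derivable_pt_lim_plus (fun t => rsum n (fun i => f i t)) (f n)).
    + apply IH; intros; apply H; lia.
    + apply H; lia.
Qed.

Section LinearAlgebra.
Variable g : LieData.
Let N := dim g.

Notation "A =m= B" := (meq g A B) (at level 70).
Notation "v =v= w" := (veq g v w) (at level 70).
Notation "A ** B" := (mmul g A B) (at level 40, left associativity).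
Notation "A $ v" := (mapply g A v) (at level 45, right associativity).

Global Instance meq_equiv : Equivalence (meq g).
Proof.
  split.
  - intros A i j _ _; reflexivity.
  - intros A B H i j Hi Hj; symmetry; apply H; assumption.
  - intros A B C H1 H2 i j Hi Hj; rewrite H1, H2 by assumption; reflexivity.
Qed.

Global Instance veq_equiv : Equivalence (veq g).
Proof.
  split.
  - intros A i _; reflexivity.
  - intros A B H i Hi; symmetry; apply H; assumption.
  - intros A B C H1 H2 i Hi; rewrite H1, H2 by assumption; reflexivity.
Qed.

Global Instance mmul_proper : Proper (meq g ==> meq g ==> meq g) (mmul g).
Proof.
  intros A A' HA B B' HB i k Hi Hk; unfold mmul; apply rsum_ext; intros j Hj.
  rewrite HA, HB by assumption; reflexivity.
Qed.

Global Instance mapply_proper : Proper (meq g ==> veq g ==> veq g) (mapply g).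
Proof.
  intros A A' HA v v' Hv i Hi; unfold mapply; apply rsum_ext; intros j Hj.
  rewrite HA, Hv by assumption; reflexivity.
Qed.

Global Instance br_proper : Proper (veq g ==> veq g ==> veq g) (br g).
Proof.
  intros x x' Hx y y' Hy k Hk; unfold br; apply rsum_ext; intros i Hi; apply rsum_ext; intros j Hj.
  rewrite Hx, Hy by assumption; reflexivity.
Qed.

Global Instance vadd_proper : Proper (veq g ==> veq g ==> veq g) vadd.
Proof. intros x x' Hx y y' Hy k Hk; unfold vadd; rewrite Hx, Hy by assumption; reflexivity. Qed.

Global Instance vscal_proper a : Proper (veq g ==> veq g) (vscal a).
Proof. intros x x' Hx k Hk; unfold vscal; rewrite Hx by assumption; reflexivity. Qed.

Lemma mmul_assoc A B C : A ** (B ** C) =m= A ** B ** C.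
Proof.
  intros i l Hi Hl; unfold mmul.
  transitivity (rsum N (fun j => rsum N (fun k => A i j * B j k * C k l))).
  - apply rsum_ext; intros j Hj; rewrite <- rsum_scal; apply rsum_ext; intros; ring.
  - rewrite rsum_swap; apply rsum_ext; intros k Hk; rewrite <- rsum_scal_r; reflexivity.
Qed.

Lemma mapply_mmul A B v : (A ** B) $ v =v= A $ B $ v.
Proof.
  intros i Hi; unfold mapply, mmul.
  transitivity (rsum N (fun k => rsum N (fun j => A i j * B j k * v k))).
  - apply rsum_ext; intros k Hk; rewrite <- rsum_scal_r; reflexivity.
  - rewrite rsum_swap; apply rsum_ext; intros j Hj.
    rewrite <- rsum_scal; apply rsum_ext; intros; ring.
Qed.

Lemma mmul_1_l A : mid ** A =m= A.
Proof.
  intros i k Hi Hk; unfold mmul, mid; rewrite <- (rsum_delta N i (fun j => A j k)) by exact Hi.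
  apply rsum_ext; intros j Hj; rewrite Nat.eqb_sym; reflexivity.
Qed.

Lemma mmul_1_r A : A ** mid =m= A.
Proof.
  intros i k Hi Hk; unfold mmul, mid; rewrite <- (rsum_delta N k (fun j => A i j)) by exact Hk.
  apply rsum_ext; intros j Hj; ring.
Qed.

Lemma mapply_1 v : mid $ v =v= v.
Proof.
  intros i Hi; unfold mapply, mid; rewrite <- (rsum_delta N i v) by exact Hi.
  apply rsum_ext; intros j Hj; rewrite Nat.eqb_sym; reflexivity.
Qed.

Lemma mapply_vadd A v w : A $ vadd v w =v= vadd (A $ v) (A $ w).
Proof.
  intros i Hi; unfold mapply, vadd; rewrite <- rsum_plus; apply rsum_ext; intros; ring.
Qed.

Lemma mapply_vscal A a v : A $ vscal a v =v= vscal a (A $ v).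
Proof.
  intros i Hi; unfold mapply, vscal; rewrite <- rsum_scal; apply rsum_ext; intros; ring.
Qed.

Lemma mapply_zero A : A $ vzero =v= vzero.
Proof. intros i Hi; unfold mapply, vzero; apply rsum_zero; intros; ring. Qed.

Definition basis (j : nat) : vec := fun i => if Nat.eqb i j then 1 else 0.

Lemma mapply_basis A j i : (j < N)%nat -> (A $ basis j) i = A i j.
Proof.
  intros Hj; unfold mapply, basis; rewrite <- (rsum_delta N j (fun j => A i j)) by exact Hj.
  apply rsum_ext; intros; ring.
Qed.

Lemma meq_mapply A B : (forall v, A $ v =v= B $ v) -> A =m= B.
Proof.
  intros H i j Hi Hj; rewrite <- !mapply_basis by exact Hj; apply H; exact Hi.
Qed.

Lemma br_vadd_l x y z : br g (vadd x y) z =v= vadd (br g x z) (br g y z).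
Proof.
  intros k Hk; unfold br, vadd; rewrite <- rsum_plus; apply rsum_ext; intros.
  rewrite <- rsum_plus; apply rsum_ext; intros; ring.
Qed.

Lemma br_vadd_r x y z : br g z (vadd x y) =v= vadd (br g z x) (br g z y).
Proof.
  intros k Hk; unfold br, vadd; rewrite <- rsum_plus; apply rsum_ext; intros.
  rewrite <- rsum_plus; apply rsum_ext; intros; ring.
Qed.

Lemma br_vscal_l a x y : br g (vscal a x) y =v= vscal a (br g x y).
Proof.
  intros k Hk; unfold br, vscal; rewrite <- rsum_scal; apply rsum_ext; intros.
  rewrite <- rsum_scal; apply rsum_ext; intros; ring.
Qed.

Lemma br_vscal_r a x y : br g x (vscal a y) =v= vscal a (br g x y).
Proof.
  intros k Hk; unfold br, vscal; rewrite <- rsum_scal; apply rsum_ext; intros.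
  rewrite <- rsum_scal; apply rsum_ext; intros; ring.
Qed.

(** * Inverses and integer powers of automorphisms *)

Definition inverse_of (A B : mat) : Prop := A ** B =m= mid /\ B ** A =m= mid.

Global Instance inverse_of_proper : Proper (meq g ==> meq g ==> iff) inverse_of.
Proof. intros A A' HA B B' HB; unfold inverse_of; rewrite HA, HB; reflexivity. Qed.

(** The epsilon operator makes inversion total. The value is arbitrary for a singular matrix, and
    for an automorphism it is determined only up to [meq], so replacing the argument goes through
    [minv_meq]. *)
Definition minv (A : mat) : mat := epsilon (inhabits mid) (inverse_of A).

Lemma inverse_of_unique A B C : inverse_of A B -> C ** A =m= mid -> C =m= B.
Proof.
  intros [H1 _] H3.
  rewrite <- (mmul_1_r C), <- H1, mmul_assoc, H3, mmul_1_l; reflexivity.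
Qed.

Lemma aut_inverse A : AutG g A -> inverse_of A (minv A).
Proof. intros [_ [_ HB]]; unfold minv; apply epsilon_spec; exact HB. Qed.

Lemma minv_r A : AutG g A -> A ** minv A =m= mid.
Proof. intros H; apply aut_inverse, H. Qed.

Lemma minv_l A : AutG g A -> minv A ** A =m= mid.
Proof. intros H; apply aut_inverse, H. Qed.

Lemma mul_minv_r A B : AutG g A -> B ** A ** minv A =m= B.
Proof. intros H; rewrite <- mmul_assoc, minv_r, mmul_1_r by exact H; reflexivity. Qed.

Lemma mul_minv_l A B : AutG g A -> B ** minv A ** A =m= B.
Proof. intros H; rewrite <- mmul_assoc, minv_l, mmul_1_r by exact H; reflexivity. Qed.

Lemma minv_eq A B : AutG g A -> B ** A =m= mid -> minv A =m= B.
Proof. intros HA HB; symmetry; apply inverse_of_unique with (2 := HB), aut_inverse, HA. Qed.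

Lemma mmul_cancel_l A B C : AutG g A -> A ** B =m= A ** C -> B =m= C.
Proof.
  intros HA E; rewrite <- (mmul_1_l B), <- (mmul_1_l C), <- (minv_l A HA), <- !mmul_assoc, E; reflexivity.
Qed.

Lemma mmul_cancel_r A B C : AutG g A -> B ** A =m= C ** A -> B =m= C.
Proof.
  intros HA E; rewrite <- (mul_minv_r A B HA), E, mul_minv_r by exact HA; reflexivity.
Qed.

Global Instance AutG_proper : Proper (meq g ==> iff) (AutG g).
Proof.
  assert (H : forall A B, A =m= B -> AutG g A -> AutG g B).
  { intros A B E [HF [HL [C HC]]]; split; [|split].
    - intros Hc; rewrite <- E; apply HF, Hc.
    - intros x y; rewrite <- !E; apply HL.
    - exists C; rewrite <- E; exact HC. }
  intros A B E; split; apply H; [exact E | symmetry; exact E].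
Qed.

Lemma AutG_1 : AutG g mid.
Proof.
  split; [|split].
  - intros _; rewrite mmul_1_l, mmul_1_r; reflexivity.
  - intros x y; rewrite !mapply_1; reflexivity.
  - exists mid; split; apply mmul_1_l.
Qed.

Lemma AutG_mul A B : AutG g A -> AutG g B -> AutG g (A ** B).
Proof.
  intros HA HB; split; [|split].
  - intros Hc; rewrite <- mmul_assoc, (proj1 HB Hc), !mmul_assoc, (proj1 HA Hc); reflexivity.
  - intros x y; rewrite !mapply_mmul, (proj1 (proj2 HB)), (proj1 (proj2 HA)); reflexivity.
  - exists (minv B ** minv A); split; rewrite mmul_assoc.
    + rewrite mul_minv_r, minv_r by assumption; reflexivity.
    + rewrite mul_minv_l, minv_l by assumption; reflexivity.
Qed.

Lemma AutG_inverse A B : AutG g A -> inverse_of A B -> AutG g B.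
Proof.
  intros HA [H1 H2]; split; [|split].
  - intros Hc; transitivity (B ** Jm g ** A ** B).
    + rewrite <- !mmul_assoc, H1, mmul_1_r; reflexivity.
    + rewrite <- (mmul_assoc B), <- (proj1 HA Hc), !mmul_assoc, H2, mmul_1_l; reflexivity.
  - intros x y.
    transitivity (B $ br g (A $ B $ x) (A $ B $ y)).
    + rewrite <- !mapply_mmul, H1, !mapply_1; reflexivity.
    + rewrite <- (proj1 (proj2 HA)), <- mapply_mmul, H2, mapply_1; reflexivity.
  - exists A; split; assumption.
Qed.

Lemma AutG_minv A : AutG g A -> AutG g (minv A).
Proof. intros H; apply AutG_inverse with A; [|apply aut_inverse]; exact H. Qed.

Lemma minv_mul A B : AutG g A -> AutG g B -> minv (A ** B) =m= minv B ** minv A.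
Proof.
  intros HA HB; apply minv_eq; [apply AutG_mul; assumption|].
  rewrite mmul_assoc, mul_minv_l, minv_l by assumption; reflexivity.
Qed.

Lemma minv_minv A : AutG g A -> minv (minv A) =m= A.
Proof. intros H; apply minv_eq; [apply AutG_minv, H | apply minv_r, H]. Qed.

Lemma minv_meq A B : AutG g A -> A =m= B -> minv A =m= minv B.
Proof. intros H E; apply minv_eq; [exact H | rewrite E; apply minv_l; rewrite <- E; exact H]. Qed.

Lemma mpow_add A m n : mpow g A (m + n) =m= mpow g A m ** mpow g A n.
Proof.
  induction m as [|m IH]; simpl; [rewrite mmul_1_l; reflexivity|].
  rewrite IH, mmul_assoc; reflexivity.
Qed.

Lemma mpow_S_r A n : mpow g A (S n) =m= mpow g A n ** A.
Proof. rewrite <- Nat.add_1_r, mpow_add; simpl; rewrite mmul_1_r; reflexivity. Qed.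

Global Instance mpow_proper : Proper (meq g ==> eq ==> meq g) (mpow g).
Proof. intros A B E n m <-; induction n as [|n IH]; simpl; [reflexivity | apply mmul_proper; assumption]. Qed.

Lemma AutG_mpow A n : AutG g A -> AutG g (mpow g A n).
Proof. intros H; induction n as [|n IH]; simpl; [apply AutG_1 | apply AutG_mul; assumption]. Qed.

Lemma aut_mapply_cancel A v w : AutG g A -> A $ v =v= A $ w -> v =v= w.
Proof.
  intros HA E; rewrite <- (mapply_1 v), <- (mapply_1 w), <- (minv_l A HA), !mapply_mmul, E; reflexivity.
Qed.

Definition zpow (A : mat) (k : Z) : mat :=
  if Z_le_dec 0 k then mpow g A (Z.to_nat k) else mpow g (minv A) (Z.to_nat (- k)).

Lemma AutG_zpow A k : AutG g A -> AutG g (zpow A k).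
Proof. intros H; unfold zpow; destruct (Z_le_dec 0 k); apply AutG_mpow; [|apply AutG_minv]; exact H. Qed.

Lemma zpow_succ A k : AutG g A -> zpow A (k + 1) =m= zpow A k ** A.
Proof.
  intros HA; unfold zpow; destruct (Z_le_dec 0 k).
  - destruct (Z_le_dec 0 (k + 1)); [|lia].
    replace (Z.to_nat (k + 1)) with (S (Z.to_nat k)) by lia; apply mpow_S_r.
  - replace (Z.to_nat (- k)) with (S (Z.to_nat (- (k + 1)))) by lia.
    rewrite mpow_S_r, mul_minv_l by exact HA.
    destruct (Z_le_dec 0 (k + 1)); [|reflexivity].
    replace k with (-1)%Z by lia; reflexivity.
Qed.

Lemma zpow_0 A : zpow A 0 =m= mid.
Proof. reflexivity. Qed.

Lemma zpow_1 A : zpow A 1 =m= A.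
Proof. unfold zpow; simpl; apply mmul_1_r. Qed.

Lemma zpow_add A k m : AutG g A -> zpow A (k + m) =m= zpow A k ** zpow A m.
Proof.
  intros HA; revert m; apply Z.peano_ind.
  - rewrite Z.add_0_r, zpow_0, mmul_1_r; reflexivity.
  - intros m IH; rewrite <- Z.add_1_r, Z.add_assoc, !zpow_succ, IH, mmul_assoc by exact HA; reflexivity.
  - intros m IH; apply mmul_cancel_r with (1 := HA).
    rewrite <- zpow_succ, <- mmul_assoc, <- zpow_succ by exact HA.
    replace (Z.pred m + 1)%Z with m by lia.
    replace (k + Z.pred m + 1)%Z with (k + m)%Z by lia; exact IH.
Qed.

Lemma zpow_m1_r A : AutG g A -> A ** zpow A (-1) =m= mid.
Proof.
  intros HA; transitivity (zpow A 1 ** zpow A (-1)); [rewrite zpow_1; reflexivity|].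
  rewrite <- zpow_add by exact HA; reflexivity.
Qed.

Lemma zpow_m1_l A : AutG g A -> zpow A (-1) ** A =m= mid.
Proof. intros HA; rewrite <- zpow_succ by exact HA; reflexivity. Qed.

(** * Smooth curves of matrices and vectors *)

Definition msmooth (P : R -> mat) : Prop :=
  forall i j, (i < N)%nat -> (j < N)%nat -> smooth (fun t => P t i j).

Definition vsmooth (v : R -> vec) : Prop := forall i, (i < N)%nat -> smooth (fun t => v t i).

Lemma msmooth_const A : msmooth (fun _ => A).
Proof. intros i j _ _; apply smooth_const. Qed.

Lemma msmooth_mul P Q : msmooth P -> msmooth Q -> msmooth (fun t => P t ** Q t).
Proof.
  intros HP HQ i j Hi Hj; unfold mmul; apply (smooth_rsum N (fun k t => P t i k * Q t k j)); intros k Hk.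
  apply smooth_mult; [apply HP | apply HQ]; assumption.
Qed.

Lemma msmooth_comp P f : msmooth P -> smooth f -> msmooth (fun t => P (f t)).
Proof. intros HP Hf i j Hi Hj; apply (smooth_comp (fun t => P t i j)); [apply HP; assumption | exact Hf]. Qed.

Lemma vsmooth_const v : vsmooth (fun _ => v).
Proof. intros i _; apply smooth_const. Qed.

Lemma vsmooth_mapply P v : msmooth P -> vsmooth v -> vsmooth (fun t => P t $ v t).
Proof.
  intros HP Hv i Hi; unfold mapply; apply (smooth_rsum N (fun k t => P t i k * v t k)); intros k Hk.
  apply smooth_mult; [apply HP | apply Hv]; assumption.
Qed.

Lemma vsmooth_comp v f : vsmooth v -> smooth f -> vsmooth (fun t => v (f t)).
Proof. intros Hv Hf i Hi; apply (smooth_comp (fun t => v t i)); [apply Hv; assumption | exact Hf]. Qed.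

Lemma vsmooth_vadd v w : vsmooth v -> vsmooth w -> vsmooth (fun t => vadd (v t) (w t)).
Proof. intros Hv Hw i Hi; apply smooth_plus; [apply Hv | apply Hw]; assumption. Qed.

Lemma vsmooth_fscal f v : smooth f -> vsmooth v -> vsmooth (fun t => vscal (f t) (v t)).
Proof. intros Hf Hv i Hi; apply smooth_mult; [exact Hf | apply Hv; assumption]. Qed.

Lemma vsmooth_br v w : vsmooth v -> vsmooth w -> vsmooth (fun t => br g (v t) (w t)).
Proof.
  intros Hv Hw k Hk; unfold br.
  apply (smooth_rsum N (fun i t => rsum N (fun j => sc g i j k * v t i * w t j))); intros i Hi.
  apply (smooth_rsum N (fun j t => sc g i j k * v t i * w t j)); intros j Hj.
  apply smooth_mult; [apply smooth_scal, Hv | apply Hw]; assumption.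
Qed.

Lemma vsmooth_ext v w : vsmooth v -> (forall t, v t =v= w t) -> vsmooth w.
Proof.
  intros Hv E i Hi; apply smooth_ext with (fun t => v t i); [apply Hv; assumption|].
  intros t; apply E; assumption.
Qed.

End LinearAlgebra.

(** * Twisted loops *)

Section TwistedExtension.
Variables (E : Type) (eqE : E -> E -> Prop) (T : Z -> E -> E).
Hypothesis eqE_equiv : Equivalence eqE.
Hypothesis T_proper : forall k x y, eqE x y -> eqE (T k x) (T k y).
Hypothesis T_0 : forall x, eqE (T 0%Z x) x.
Hypothesis T_add : forall k m x, eqE (T (k + m)%Z x) (T k (T m x)).

Definition period_index (t : R) : Z := Zfloor ((t + PI) / (2 * PI)).

(** Only the values of [F] on [-pi, pi) enter; the action [T] of Z transports them to the other
    periods. [E] will be [vec] for loops, R with the trivial action for periodic functions, and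
    [mat] with a two-sided action for gauge transformations. *)
Definition twisted_ext (F : R -> E) (t : R) : E :=
  T (period_index t) (F (t - 2 * PI * IZR (period_index t))).

Lemma period_index_spec t : - PI <= t - 2 * PI * IZR (period_index t) < PI.
Proof.
  assert (HPI := PI_RGT_0); unfold period_index.
  destruct (Zfloor_bound ((t + PI) / (2 * PI))) as [H1 H2].
  set (k := IZR (Zfloor ((t + PI) / (2 * PI)))) in *.
  assert (E1 : t + PI = (t + PI) / (2 * PI) * (2 * PI)) by (field; lra).
  set (y := (t + PI) / (2 * PI)) in *; nra.
Qed.

(** Compatibility of [F] near the seam lets each period be described by one formula on an enlarged
    window. The windows overlap, so every point has a neighbourhood governed by a single formula and
    smoothness can be checked locally. *)
Lemma twisted_ext_spec F d :
  0 < d <= PI ->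
  (forall t, Rabs (t + PI) < d -> eqE (F (t + 2 * PI)) (T 1%Z (F t))) ->
  forall t k, Rabs (t - 2 * PI * IZR k) < PI + d -> eqE (twisted_ext F t) (T k (F (t - 2 * PI * IZR k))).
Proof.
  intros Hd HF t k Hk; assert (HPI := PI_RGT_0).
  assert (Hs := period_index_spec t); unfold twisted_ext; set (m := period_index t) in *.
  apply Rabs_def2 in Hk.
  (* Since d <= pi, the window of index [k] meets only the period of [k] and its two neighbours. *)
  assert (Hlt : (m - 2 < k < m + 2)%Z).
  { split; apply lt_IZR; rewrite ?minus_IZR, ?plus_IZR; nra. }
  assert (Hc : k = m \/ k = (m + 1)%Z \/ k = (m - 1)%Z) by lia.
  destruct Hc as [-> | [-> | ->]].
  - reflexivity.
  - rewrite plus_IZR in *; rewrite T_add.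
    replace (t - 2 * PI * IZR m) with (t - 2 * PI * (IZR m + 1) + 2 * PI) by ring.
    apply T_proper, HF; apply Rabs_def1; lra.
  - rewrite minus_IZR in *.
    replace (T m (F (t - 2 * PI * IZR m))) with (T (m - 1 + 1)%Z (F (t - 2 * PI * IZR m)))
      by (f_equal; lia).
    rewrite T_add.
    replace (t - 2 * PI * (IZR m - 1)) with (t - 2 * PI * IZR m + 2 * PI) by ring.
    apply T_proper; symmetry; apply HF; apply Rabs_def1; lra.
Qed.

Lemma period_index_succ t : period_index (t + 2 * PI) = (period_index t + 1)%Z.
Proof.
  assert (HPI := PI_RGT_0); unfold period_index.
  rewrite <- Zfloor_addz; f_equal; field; lra.
Qed.

Lemma twisted_ext_period F t : eqE (twisted_ext F (t + 2 * PI)) (T 1%Z (twisted_ext F t)).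
Proof.
  unfold twisted_ext; rewrite period_index_succ, Z.add_comm, T_add, plus_IZR.
  replace (t + 2 * PI - 2 * PI * (1 + IZR (period_index t))) with (t - 2 * PI * IZR (period_index t)) by ring.
  reflexivity.
Qed.

End TwistedExtension.

(** * Periodic functions *)

Definition periodic (f : R -> R) : Prop := smooth f /\ forall t, f (t + 2 * PI) = f t.

Lemma periodic_Z f k t : periodic f -> f (t + 2 * PI * IZR k) = f t.
Proof.
  intros [_ H]; revert k; apply Z.peano_ind.
  - f_equal; ring.
  - intros k IH; rewrite succ_IZR, <- IH, <- (H (t + 2 * PI * IZR k)); f_equal; ring.
  - intros k IH; rewrite <- IH, <- (H (t + 2 * PI * IZR (Z.pred k))), <- Z.sub_1_r, minus_IZR; f_equal; ring.
Qed.

Lemma periodic_mult f h : periodic f -> periodic h -> periodic (fun t => f t * h t).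
Proof. intros [Sf Pf] [Sh Ph]; split; [apply smooth_mult; assumption | intros t; rewrite Pf, Ph; reflexivity]. Qed.

Lemma periodic_plus f h : periodic f -> periodic h -> periodic (fun t => f t + h t).
Proof. intros [Sf Pf] [Sh Ph]; split; [apply smooth_plus; assumption | intros t; rewrite Pf, Ph; reflexivity]. Qed.

Lemma periodic_const c : periodic (fun _ => c).
Proof. split; [apply smooth_const | reflexivity]. Qed.

Lemma periodic_inv f : periodic f -> (forall t, f t <> 0) -> periodic (fun t => / f t).
Proof. intros [Sf Pf] Hn; split; [apply smooth_inv; assumption | intros t; rewrite Pf; reflexivity]. Qed.

Lemma periodic_cos_sin : periodic cos /\ periodic sin.
Proof.
  split; (split; [apply smooth_sin_cos|]); intros t.
  - rewrite <- (proj1 (cos_sin_2PI_Z t 1)); f_equal; ring.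
  - rewrite <- (proj2 (cos_sin_2PI_Z t 1)); f_equal; ring.
Qed.

Section Loops.
Variable g : LieData.
Let N := dim g.

Notation "A =m= B" := (meq g A B) (at level 70).
Notation "v =v= w" := (veq g v w) (at level 70).
Notation "A ** B" := (mmul g A B) (at level 40, left associativity).
Notation "A $ v" := (mapply g A v) (at level 45, right associativity).

Lemma in_L_Z s u k t : AutG g s -> in_L g s u -> u (t + 2 * PI * IZR k) =v= zpow g s k $ u t.
Proof.
  intros Hs [_ Hu]; revert k; apply Z.peano_ind.
  - replace (t + 2 * PI * IZR 0) with t by ring; symmetry; apply mapply_1.
  - intros k IH.
    replace (t + 2 * PI * IZR (Z.succ k)) with (t + 2 * PI * IZR k + 2 * PI) by (rewrite succ_IZR; ring).
    rewrite Hu, IH, <- mapply_mmul, <- Z.add_1_l, zpow_add, zpow_1 by exact Hs; reflexivity.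
  - intros k IH; apply aut_mapply_cancel with (1 := Hs).
    rewrite <- Hu, <- mapply_mmul.
    rewrite <- (zpow_1 g s) at 1; rewrite <- zpow_add by exact Hs.
    replace (1 + Z.pred k)%Z with k by lia.
    replace (t + 2 * PI * IZR (Z.pred k) + 2 * PI) with (t + 2 * PI * IZR k) by (rewrite <- Z.sub_1_r, minus_IZR; ring).
    exact IH.
Qed.

Lemma in_L_ext s u v : in_L g s u -> leqL g u v -> in_L g s v.
Proof.
  intros [Su Pu] E; split.
  - apply (vsmooth_ext g u v Su E).
  - intros t; rewrite <- !(E _), Pu; reflexivity.
Qed.

Lemma in_L_ladd s u v : in_L g s u -> in_L g s v -> in_L g s (ladd u v).
Proof.
  intros [Su Pu] [Sv Pv]; split; [apply (vsmooth_vadd g u v Su Sv)|].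
  intros t; unfold ladd; rewrite Pu, Pv, mapply_vadd; reflexivity.
Qed.

Definition fscal (f : R -> R) (u : loop) : loop := fun t => vscal (f t) (u t).

Lemma in_L_fscal s f u : periodic f -> in_L g s u -> in_L g s (fscal f u).
Proof.
  intros [Sf Pf] [Su Pu]; split; [apply (vsmooth_fscal g f u Sf Su)|].
  intros t; unfold fscal; rewrite Pu, Pf, mapply_vscal; reflexivity.
Qed.

Lemma in_L_lscal s a u : in_L g s u -> in_L g s (lscal a u).
Proof. apply (in_L_fscal s (fun _ => a)), periodic_const. Qed.

Lemma in_L_lJ s u : AutG g s -> cx g = true -> in_L g s u -> in_L g s (lJ g u).
Proof.
  intros Hs Hc [Su Pu]; split; [apply (vsmooth_mapply g (fun _ => Jm g) u (msmooth_const g _) Su)|].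
  intros t; unfold lJ; rewrite Pu, <- !mapply_mmul, (proj1 Hs Hc); reflexivity.
Qed.

Lemma in_L_lbr s u v : AutG g s -> in_L g s u -> in_L g s v -> in_L g s (lbr g u v).
Proof.
  intros Hs [Su Pu] [Sv Pv]; split; [apply (vsmooth_br g u v Su Sv)|].
  intros t; unfold lbr; rewrite Pu, Pv, (proj1 (proj2 Hs)); reflexivity.
Qed.

Lemma in_L_zero s : in_L g s (fun _ => vzero).
Proof. split; [apply vsmooth_const | intros t; symmetry; apply mapply_zero]. Qed.

Lemma near_period_center t : exists k : Z, forall x, Rabs (x - t) < PI / 2 ->
  Rabs (x - 2 * PI * IZR k) < PI + PI / 2.
Proof.
  assert (HPI := PI_RGT_0); exists (period_index t); intros x Hx.
  assert (H := period_index_spec t); apply Rabs_def2 in Hx; apply Rabs_def1; lra.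
Qed.

(** The support has radius below pi/2 and therefore misses both sides of the seam, where the gluing
    condition reduces to s 0 = 0. *)
Lemma loop_extension s v t0 d : AutG g s -> vsmooth g v -> d < PI / 2 ->
  (forall t, d <= Rabs (t - t0) -> v t =v= vzero) ->
  exists u, in_L g s u /\ forall t, Rabs (t - t0) < PI + PI / 2 -> u t =v= v t.
Proof.
  intros Hs Sv Hd Hv; assert (HPI := PI_RGT_0).
  set (w := twisted_ext vec (fun k x => zpow g s k $ x) (fun t => v (t + t0))).
  assert (Hspec : forall t k, Rabs (t - 2 * PI * IZR k) < PI + PI / 2 ->
    w t =v= zpow g s k $ v (t - 2 * PI * IZR k + t0)).
  { apply (twisted_ext_spec vec (veq g)); [apply veq_equiv| | |lra|].
    - intros k x y E; rewrite E; reflexivity.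
    - intros k m x; rewrite <- mapply_mmul, zpow_add by exact Hs; reflexivity.
    - intros t Ht; apply Rabs_def2 in Ht; rewrite !Hv; [symmetry; apply mapply_zero| |];
        unfold Rabs; destruct Rcase_abs; lra. }
  exists (fun t => w (t - t0)); split; [split|].
  - apply (vsmooth_comp g w (fun t => t - t0)); [|apply smooth_minus; [apply smooth_id | apply smooth_const]].
    intros i Hi; apply smooth_local; intros t.
    destruct (near_period_center t) as [k Hk].
    exists (PI / 2), (fun x => (zpow g s k $ v (x - 2 * PI * IZR k + t0)) i); split; [lra | split].
    + apply (vsmooth_mapply g (fun _ => zpow g s k) (fun x => v (x - 2 * PI * IZR k + t0))); [apply msmooth_const| |exact Hi].
      apply (vsmooth_comp g v (fun x => x - 2 * PI * IZR k + t0) Sv).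
      apply smooth_plus; [apply smooth_minus; [apply smooth_id | apply smooth_const] | apply smooth_const].
    + intros x Hx; apply Hspec; [apply Hk, Hx | exact Hi].
  - intros t; replace (t + 2 * PI - t0) with (t - t0 + 2 * PI) by ring.
    unfold w; rewrite (twisted_ext_period vec (veq g)); [| apply veq_equiv|].
    + rewrite zpow_1; reflexivity.
    + intros k m x; rewrite <- mapply_mmul, zpow_add by exact Hs; reflexivity.
  - intros t Ht; rewrite (Hspec _ 0%Z); rewrite Rmult_0_r, Rminus_0_r; [|exact Ht].
    rewrite zpow_0, mapply_1; replace (t - t0 + t0) with t by ring; reflexivity.
Qed.

Lemma periodic_extension f t0 d : smooth f -> d < PI / 2 ->
  (forall t, d <= Rabs (t - t0) -> f t = 0) ->
  exists h, periodic h /\ forall t, Rabs (t - t0) < PI + PI / 2 -> h t = f t.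
Proof.
  intros Sf Hd Hf; assert (HPI := PI_RGT_0).
  set (T := fun (_ : Z) (x : R) => x).
  assert (Hspec : forall t k, Rabs (t - 2 * PI * IZR k) < PI + PI / 2 ->
    twisted_ext R T (fun t => f (t + t0)) t = f (t - 2 * PI * IZR k + t0)).
  { apply (twisted_ext_spec R eq T); unfold T; [apply eq_equivalence|congruence|reflexivity|lra|].
    intros t Ht; apply Rabs_def2 in Ht; rewrite !Hf; [reflexivity| |];
        unfold Rabs; destruct Rcase_abs; lra. }
  exists (fun t => twisted_ext R T (fun t => f (t + t0)) (t - t0)); split; [split|].
  - apply (smooth_comp (twisted_ext R T (fun t => f (t + t0))) (fun t => t - t0));
      [|apply smooth_minus; [apply smooth_id | apply smooth_const]].
    apply smooth_local; intros t.
    destruct (near_period_center t) as [k Hk].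
    exists (PI / 2), (fun x => f (x - 2 * PI * IZR k + t0)); split; [lra | split].
    + apply smooth_comp; [exact Sf|].
      apply smooth_plus; [apply smooth_minus; [apply smooth_id | apply smooth_const] | apply smooth_const].
    + intros x Hx; apply Hspec, Hk, Hx.
  - intros t; replace (t + 2 * PI - t0) with (t - t0 + 2 * PI) by ring.
    apply (twisted_ext_period R eq T); [apply eq_equivalence | reflexivity].
  - intros t Ht; rewrite (Hspec _ 0%Z); rewrite Rmult_0_r, Rminus_0_r; [|exact Ht].
    f_equal; ring.
Qed.

Lemma periodic_bump t0 d : 0 < d < PI / 2 ->
  exists b, periodic b /\ (forall t, 0 <= b t) /\ (forall t, Rabs (t - t0) <= d / 2 -> b t = 1) /\
    forall t, d <= Rabs (t - t0) < PI + PI / 2 -> b t = 0.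
Proof.
  intros Hd; assert (HPI := PI_RGT_0).
  destruct (plateau t0 d) as [f [Sf [Hnn [H1 H0]]]]; [lra|].
  destruct (periodic_extension f t0 d Sf ltac:(lra) H0) as [b [Pb Hb]].
  exists b; split; [exact Pb | split; [|split]].
  - intros t.
    rewrite <- (periodic_Z b (- period_index (t - t0)) t Pb), opp_IZR.
    rewrite Hb; [apply Hnn|].
    assert (H := period_index_spec (t - t0)); apply Rabs_def1; lra.
  - intros t Ht; rewrite Hb by lra; apply H1, Ht.
  - intros t Ht; rewrite Hb by lra; apply H0; lra.
Qed.

Lemma bump_loop s x t0 d : AutG g s -> 0 < d < PI / 2 ->
  exists u, in_L g s u /\ (forall t, Rabs (t - t0) <= d / 2 -> u t =v= x) /\
    forall t, d <= Rabs (t - t0) < PI + PI / 2 -> u t =v= vzero.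
Proof.
  intros Hs Hd; assert (HPI := PI_RGT_0).
  destruct (plateau t0 d) as [f [Sf [_ [H1 H0]]]]; [lra|].
  destruct (loop_extension s (fun t => vscal (f t) x) t0 d Hs) as [u [Lu Hu]].
  - apply (vsmooth_fscal g f (fun _ => x) Sf), vsmooth_const.
  - lra.
  - intros t Ht i _; unfold vscal, vzero; rewrite H0 by exact Ht; ring.
  - exists u; split; [exact Lu | split]; intros t Ht; rewrite Hu by lra; intros i _; unfold vscal, vzero.
    + rewrite H1 by exact Ht; ring.
    + rewrite H0 by lra; ring.
Qed.

Lemma loop_through s x t0 : AutG g s -> exists u, in_L g s u /\ u t0 =v= x.
Proof.
  intros Hs; assert (HPI := PI_RGT_0).
  destruct (bump_loop s x t0 (PI / 4) Hs ltac:(lra)) as [u [Lu [H _]]].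
  exists u; split; [exact Lu | apply H]; rewrite Rminus_diag, Rabs_R0; lra.
Qed.

(** A bump at [t0] narrower than the distance [e] from [t0] to the nearest translate of [t1]
    vanishes at that translate, and by equivariance at [t1]. *)
Lemma loop_separating s x t0 t1 : AutG g s -> (forall k : Z, t1 <> t0 + 2 * PI * IZR k) ->
  exists u, in_L g s u /\ u t0 =v= x /\ u t1 =v= vzero.
Proof.
  intros Hs Hne; assert (HPI := PI_RGT_0).
  set (k := period_index (t1 - t0)).
  assert (Hk := period_index_spec (t1 - t0)); fold k in Hk.
  assert (Hd : t1 - t0 - 2 * PI * IZR k <> 0) by (specialize (Hne k); lra).
  set (e := t1 - t0 - 2 * PI * IZR k) in *.
  assert (Hpos : 0 < Rabs e) by (apply Rabs_pos_lt, Hd).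
  assert (Hle : Rabs e <= PI) by (unfold Rabs; destruct Rcase_abs; lra).
  destruct (bump_loop s x t0 (Rabs e / 4) Hs ltac:(lra)) as [u [Lu [H1 H0]]].
  exists u; split; [exact Lu | split].
  - apply H1; rewrite Rminus_diag, Rabs_R0; lra.
  - replace t1 with (t0 + e + 2 * PI * IZR k) by (unfold e; ring).
    rewrite (in_L_Z s u k (t0 + e) Hs Lu), (H0 (t0 + e)) by (replace (t0 + e - t0) with e by ring; lra).
    apply mapply_zero.
Qed.

(** The inverse is w |-> chi(nu t) w(nu t). Equivariance is assumed separately for both directions,
    so that [mu] may preserve the orientation or reverse it, as for t |-> -t and t |-> pi - t. *)
Lemma LIso_standard s1 s2 (psi chi : R -> mat) (mu nu : R -> R) :
  msmooth g psi -> msmooth g chi -> (forall t, AutG g (psi t)) ->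
  (forall t, inverse_of g (psi t) (chi t)) ->
  smooth mu -> smooth nu -> (forall x, mu (nu x) = x) -> (forall x, nu (mu x) = x) ->
  (forall u, in_L g s1 u -> forall t, psi (t + 2 * PI) $ u (mu (t + 2 * PI)) =v= s2 $ psi t $ u (mu t)) ->
  (forall w, in_L g s2 w -> forall t,
     chi (nu (t + 2 * PI)) $ w (nu (t + 2 * PI)) =v= s1 $ chi (nu t) $ w (nu t)) ->
  LIso g s1 s2 (fun u t => psi t $ u (mu t)).
Proof.
  intros Spsi Schi Apsi Hinv Smu Snu Hmn Hnm Hper Hper'.
  split; [split; [|split; [|split; [|split; [|split]]]]|split].
  - intros u Lu; split; [|apply Hper, Lu].
    apply (vsmooth_mapply g psi (fun t => u (mu t)) Spsi), (vsmooth_comp g u mu (proj1 Lu) Smu).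
  - intros u v _ _ E t; rewrite (E (mu t)); reflexivity.
  - intros u v _ _ t; unfold ladd; apply mapply_vadd.
  - intros a u _ t; unfold lscal; apply mapply_vscal.
  - intros Hc u _ t; unfold lJ; rewrite <- !mapply_mmul, (proj1 (Apsi t) Hc); reflexivity.
  - intros u v _ _ t; unfold lbr; apply (proj1 (proj2 (Apsi t))).
  - intros u v _ _ E t; rewrite <- (Hmn t); apply (aut_mapply_cancel g (psi (nu t))); [apply Apsi | apply E].
  - intros w Lw; exists (fun t => chi (nu t) $ w (nu t)); split; [split|].
    + apply (vsmooth_mapply g (fun t => chi (nu t)) (fun t => w (nu t))).
      * apply (msmooth_comp g chi nu Schi Snu).
      * apply (vsmooth_comp g w nu (proj1 Lw) Snu).
    + apply Hper', Lw.
    + intros t; rewrite Hnm, <- mapply_mmul, (proj1 (Hinv t)), mapply_1; reflexivity.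
Qed.

End Loops.

(** * Ideals of loop algebras *)

Lemma smooth_close f t0 e : smooth f -> 0 < e ->
  exists d, 0 < d /\ forall t, Rabs (t - t0) < d -> Rabs (f t - f t0) < e.
Proof.
  intros Sf He; destruct (smooth_continuity f Sf t0 e He) as [d [Hd H]].
  exists d; split; [exact Hd|]; intros t Ht.
  destruct (Req_dec t0 t) as [<-|Hne]; [rewrite Rminus_diag, Rabs_R0; exact He|].
  apply H; split; [split; [exact I | exact Hne] | exact Ht].
Qed.

Lemma local_periodic F t0 : smooth F ->
  exists h, periodic h /\ forall t, Rabs (t - t0) < PI / 8 -> h t = F t.
Proof.
  intros SF; assert (HPI := PI_RGT_0).
  destruct (plateau t0 (PI / 4)) as [b [Sb [_ [B1 B0]]]]; [lra|].
  destruct (periodic_extension (fun t => b t * F t) t0 (PI / 4)) as [h [Ph Hh]].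
  - apply smooth_mult; assumption.
  - lra.
  - intros t Ht; rewrite B0 by exact Ht; ring.
  - exists h; split; [exact Ph|]; intros t Ht; rewrite Hh, B1 by lra; ring.
Qed.

Lemma local_reciprocal F t0 : smooth F -> F t0 = 1 ->
  exists h d, periodic h /\ 0 < d /\ forall t, Rabs (t - t0) < d -> h t * F t = 1.
Proof.
  intros SF HF; assert (HPI := PI_RGT_0).
  destruct (smooth_close F t0 (1 / 2) SF ltac:(lra)) as [d [Hd Hcl]].
  destruct (plateau t0 d Hd) as [b [Sb [Bnn [B1 B0]]]].
  (* [F] may vanish away from [t0], so 1/F is replaced by F/G with G = (b F)^2 + (1 - b)^2. This [G]
     is positive everywhere and equals F^2 where b = 1. *)
  set (G := fun t => b t * (b t * (F t * F t)) + (1 - b t) * (1 - b t)).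
  assert (HG : forall t, 0 < G t).
  { intros t; unfold G; destruct (Rlt_dec (Rabs (t - t0)) d) as [L|L].
    - specialize (Hcl t L); rewrite HF in Hcl; apply Rabs_def2 in Hcl.
      assert (0 < F t) by lra.
      destruct (Req_dec (b t) 1) as [-> | Hne]; [nra|].
      apply Rplus_le_lt_0_compat; [|nra].
      replace (b t * (b t * (F t * F t))) with (Rsqr (b t * F t)) by (unfold Rsqr; ring).
      apply Rle_0_sqr.
    - rewrite B0 by lra; lra. }
  destruct (local_periodic (fun t => F t / G t) t0) as [h [Ph Hh]].
  { apply smooth_div; [exact SF| |intros t; specialize (HG t); lra].
    unfold G; apply smooth_plus; [apply smooth_mult; [exact Sb | apply smooth_mult; [exact Sb | apply smooth_mult; exact SF]]|].
    apply smooth_mult; apply smooth_minus; [apply smooth_const | exact Sb | apply smooth_const | exact Sb]. }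
  exists h, (Rmin (PI / 8) (d / 2)); split; [exact Ph | split; [apply Rmin_pos; lra|]].
  intros t Ht.
  assert (H1 := Rmin_l (PI / 8) (d / 2)); assert (H2 := Rmin_r (PI / 8) (d / 2)).
  rewrite Hh by lra; specialize (HG t); unfold G in *; rewrite B1 in * by lra.
  field; nra.
Qed.

Section Structure.
Variable g : LieData.
Let N := dim g.

Notation "A =m= B" := (meq g A B) (at level 70).
Notation "v =v= w" := (veq g v w) (at level 70).
Notation "A ** B" := (mmul g A B) (at level 40, left associativity).
Notation "A $ v" := (mapply g A v) (at level 45, right associativity).

Hypothesis simple_g : simple g.

Definition loop_ideal (s : mat) (I : loop -> Prop) : Prop :=
  (forall u, I u -> in_L g s u) /\
  (forall u v, I u -> leqL g u v -> I v) /\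
  I (fun _ => vzero) /\
  (forall u v, I u -> I v -> I (ladd u v)) /\
  (forall a u, I u -> I (lscal a u)) /\
  (cx g = true -> forall u, I u -> I (lJ g u)) /\
  (forall x u, in_L g s x -> I u -> I (lbr g x u)).

Definition values (I : loop -> Prop) (t : R) (x : vec) : Prop := exists u, I u /\ u t =v= x.

Lemma values_ideal s I t : AutG g s -> loop_ideal s I -> ideal g (values I t).
Proof.
  intros Hs [HL [HE [H0 [HA [HS [HJ HB]]]]]]; split; [split; [|split; [|split; [|split]]]|].
  - intros v w [u [Iu Eu]] E; exists u; split; [exact Iu | rewrite Eu; exact E].
  - exists (fun _ => vzero); split; [exact H0 | reflexivity].
  - intros v w [u [Iu Eu]] [u' [Iu' Eu']]; exists (ladd u u'); split; [apply HA; assumption|].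
    unfold ladd; rewrite Eu, Eu'; reflexivity.
  - intros a v [u [Iu Eu]]; exists (lscal a u); split; [apply HS; assumption|].
    unfold lscal; rewrite Eu; reflexivity.
  - intros Hc v [u [Iu Eu]]; exists (lJ g u); split; [apply HJ; assumption|].
    unfold lJ; rewrite Eu; reflexivity.
  - intros x y [u [Iu Eu]]; destruct (loop_through g s y t Hs) as [w [Lw Ew]].
    exists (lbr g w u); split; [apply HB; assumption|].
    unfold lbr; rewrite Eu, Ew; reflexivity.
Qed.

(** The values at [t] of an ideal of loops form an ideal of [g], so simplicity leaves no choice
    between zero and everything. *)
Lemma values_full s I t : AutG g s -> loop_ideal s I ->
  (exists u, I u /\ ~ u t =v= vzero) -> forall x, values I t x.
Proof.
  intros Hs HI [u [Iu Hu]].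
  destruct (proj2 simple_g _ (values_ideal s I t Hs HI)) as [H|H]; [|exact H].
  exfalso; apply Hu, H; exists u; split; [exact Iu | reflexivity].
Qed.

(* The largest [C^oo(S^1)]-submodule of [I]; it contains [[L, I]]. *)
Definition module_core (s : mat) (I : loop -> Prop) (w : loop) : Prop :=
  in_L g s w /\ forall f, periodic f -> I (fscal f w).

Lemma module_core_ideal s I : AutG g s -> loop_ideal s I -> loop_ideal s (module_core s I).
Proof.
  intros Hs [HL [HE [H0 [HA [HS [HJ HB]]]]]]; split; [|split; [|split; [|split; [|split; [|split]]]]].
  - intros u [H _]; exact H.
  - intros u v [Lu Hu] E; split; [apply in_L_ext with u; assumption|].
    intros f Hf; apply HE with (1 := Hu f Hf); intros t; unfold fscal; rewrite (E t); reflexivity.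
  - split; [apply in_L_zero|]; intros f Hf; apply HE with (1 := H0).
    intros t i _; unfold fscal, vscal, vzero; ring.
  - intros u v [Lu Hu] [Lv Hv]; split; [apply in_L_ladd; assumption|].
    intros f Hf; apply HE with (1 := HA _ _ (Hu f Hf) (Hv f Hf)).
    intros t i _; unfold fscal, ladd, vscal, vadd; ring.
  - intros a u [Lu Hu]; split; [apply in_L_lscal; assumption|].
    intros f Hf; apply HE with (1 := HS a _ (Hu f Hf)).
    intros t i _; unfold fscal, lscal, vscal; ring.
  - intros Hc u [Lu Hu]; split; [apply in_L_lJ; assumption|].
    intros f Hf; apply HE with (1 := HJ Hc _ (Hu f Hf)).
    intros t; unfold fscal, lJ; apply mapply_vscal.
  - intros x u Lx [Lu Hu]; split; [apply in_L_lbr; assumption|].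
    intros f Hf; apply HE with (1 := HB _ _ Lx (Hu f Hf)).
    intros t; unfold fscal, lbr; apply br_vscal_r.
Qed.

Lemma module_core_fscal s I f w : loop_ideal s I -> periodic f -> module_core s I w -> module_core s I (fscal f w).
Proof.
  intros [_ [HE _]] Hf [Lw Hw]; split; [apply in_L_fscal; assumption|].
  intros h Hh; apply HE with (1 := Hw _ (periodic_mult h f Hh Hf)).
  intros t i _; unfold fscal, vscal; ring.
Qed.

Lemma module_core_lbr s I x u : AutG g s -> loop_ideal s I -> in_L g s x -> I u -> module_core s I (lbr g x u).
Proof.
  intros Hs [HL [HE [_ [_ [_ [_ HB]]]]]] Lx Iu; split; [apply in_L_lbr; auto|].
  intros f Hf; apply HE with (lbr g (fscal f x) u).
  - apply HB; [apply in_L_fscal; assumption | exact Iu].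
  - intros t; unfold fscal, lbr; apply br_vscal_l.
Qed.

(** Take x, y with [x, y] nonzero and realise them at [t] by a loop and, since [I] is full at [t],
    by an element of [I]. Their bracket lies in the core and does not vanish at [t]. *)
Lemma module_core_full s I t : AutG g s -> loop_ideal s I ->
  (exists u, I u /\ ~ u t =v= vzero) -> forall x, values (module_core s I) t x.
Proof.
  intros Hs HI Hne; apply values_full with (1 := Hs); [apply module_core_ideal; assumption|].
  destruct (proj1 simple_g) as [x [y Hxy]].
  destruct (values_full s I t Hs HI Hne y) as [u [Iu Eu]].
  destruct (loop_through g s x t Hs) as [w [Lw Ew]].
  exists (lbr g w u); split; [apply module_core_lbr; assumption|].
  unfold lbr; rewrite Eu, Ew; exact Hxy.
Qed.

(* Gauss-Jordan elimination over the ring of germs at [t0]. *)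
Lemma module_core_local_frame s I t0 : AutG g s -> loop_ideal s I ->
  (exists u, I u /\ ~ u t0 =v= vzero) ->
  forall k, (k <= N)%nat -> exists (w : nat -> loop) d, 0 < d /\
    (forall i, (i < N)%nat -> module_core s I (w i) /\ w i t0 =v= basis i) /\
    forall t, Rabs (t - t0) < d -> forall i j, (i < N)%nat -> (j < k)%nat -> w i t j = basis i j.
Proof.
  intros Hs HI Hne; assert (HPI := PI_RGT_0).
  assert (HK := module_core_ideal s I Hs HI).
  induction k as [|k IH]; intros Hk.
  - destruct (functional_choice _ (fun i => module_core_full s I t0 Hs HI Hne (basis i))) as [w Hw].
    exists w, 1; split; [lra | split; [intros; apply Hw | intros; lia]].
  - destruct IH as [w [d [Hd [Hw Hloc]]]]; [lia|].
    assert (Sw : forall i j, (i < N)%nat -> (j < N)%nat -> smooth (fun t => w i t j)).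
    { intros i j Hi Hj; apply (proj1 HK _ (proj1 (Hw i Hi))); exact Hj. }
    assert (Hkk : (fun t => w k t k) t0 = 1).
    { rewrite (proj2 (Hw k Hk)) by exact Hk; unfold basis; rewrite Nat.eqb_refl; reflexivity. }
    destruct (local_reciprocal (fun t => w k t k) t0 (Sw k k Hk Hk) Hkk) as [h [d1 [Ph [Hd1 Hh]]]].
    destruct (choice_lt (fun _ => 0) N _ (fun i Hi => local_periodic (fun t => w i t k) t0 (Sw i k Hi Hk)))
      as [f Pf].
    (* Pivoting on column [k]: [h] normalises the pivot to 1 near [t0], and [f i] is a periodic
       function with the germ of the entry to be cleared from row [i]. At [t0] the rows keep their
       values, because there the pivot is 1 and the entries to be cleared are 0. *)
    set (wk := fscal h (w k)).
    exists (fun i => if Nat.eqb i k then wk else ladd (w i) (lscal (-1) (fscal (f i) wk))).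
    exists (Rmin d (Rmin d1 (PI / 8))); split; [repeat apply Rmin_pos; lra | split].
    + assert (Kk : module_core s I wk) by (apply module_core_fscal; [assumption|assumption|apply Hw, Hk]).
      assert (Ek : wk t0 =v= basis k).
      { intros j Hj; unfold wk, fscal, vscal.
        rewrite (proj2 (Hw k Hk)) by exact Hj.
        assert (E := Hh t0 ltac:(rewrite Rminus_diag, Rabs_R0; lra)); cbv beta in Hkk.
        rewrite Hkk, Rmult_1_r in E; rewrite E; ring. }
      intros i Hi; destruct (Nat.eqb_spec i k) as [->|Hik]; [split; assumption|split].
      * apply HK; [apply Hw, Hi|]; apply HK, module_core_fscal; [assumption | apply Pf, Hi | exact Kk].
      * intros j Hj; unfold ladd, lscal, fscal, vadd, vscal.
        rewrite (proj2 (Pf i Hi)), !(proj2 (Hw i Hi)) by (try assumption; rewrite Rminus_diag, Rabs_R0; lra).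
        unfold basis at 2; rewrite (proj2 (Nat.eqb_neq k i)) by lia; ring.
    + intros t Ht i j Hi Hj.
      assert (H1 := Rmin_l d (Rmin d1 (PI / 8))); assert (H2 := Rmin_r d (Rmin d1 (PI / 8))).
      assert (H3 := Rmin_l d1 (PI / 8)); assert (H4 := Rmin_r d1 (PI / 8)).
      assert (Ek : wk t j = basis k j).
      { unfold wk, fscal, vscal; destruct (Nat.eq_dec j k) as [->|Hjk].
        - rewrite Hh by lra; unfold basis; rewrite Nat.eqb_refl; reflexivity.
        - rewrite Hloc by (try lra; lia); unfold basis; rewrite (proj2 (Nat.eqb_neq j k)) by lia; ring. }
      destruct (Nat.eqb_spec i k) as [->|Hik]; [exact Ek|].
      unfold ladd, lscal, vadd, vscal; unfold fscal at 1; unfold vscal.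
      rewrite Ek, (proj2 (Pf i Hi)) by lra.
      destruct (Nat.eq_dec j k) as [->|Hjk].
      * unfold basis; rewrite Nat.eqb_refl, (proj2 (Nat.eqb_neq k i)) by lia; ring.
      * rewrite Hloc by (try lra; lia); unfold basis.
        rewrite (proj2 (Nat.eqb_neq j k)) by lia; ring.
Qed.

Definition lsum (n : nat) (F : nat -> loop) : loop := fun t i => rsum n (fun k => F k t i).

Lemma loop_ideal_lsum s I n F : loop_ideal s I -> (forall k, (k < n)%nat -> I (F k)) -> I (lsum n F).
Proof.
  intros HI; induction n as [|n IH]; intros HF; [apply HI|].
  apply (proj1 (proj2 HI)) with (ladd (lsum n F) (F n)).
  - apply HI; [apply IH; intros; apply HF; lia | apply HF; lia].
  - intros t i _; reflexivity.
Qed.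

Lemma leqL_of_period s u v t0 : AutG g s -> in_L g s u -> in_L g s v ->
  (forall t, Rabs (t - t0) <= PI -> u t =v= v t) -> leqL g u v.
Proof.
  intros Hs Lu Lv E t; set (k := period_index (t - t0)).
  assert (H := period_index_spec (t - t0)); fold k in H.
  replace t with (t - 2 * PI * IZR k + 2 * PI * IZR k) by ring.
  rewrite (in_L_Z g s u k _ Hs Lu), (in_L_Z g s v k _ Hs Lv), E; [reflexivity|].
  apply Rabs_le; lra.
Qed.

(** Where [b] is nonzero the frame [w] is the standard basis, so b v is the combination of the [w i]
    with coefficients b v_i. These coefficients are periodic functions, which the core absorbs. *)
Lemma ideal_contains_bumps s I t0 : AutG g s -> loop_ideal s I ->
  (exists u, I u /\ ~ u t0 =v= vzero) ->
  exists b d, periodic b /\ 0 < d /\ (forall t, 0 <= b t) /\ (forall t, Rabs (t - t0) < d -> 0 < b t) /\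
    forall v, in_L g s v -> I (fscal b v).
Proof.
  intros Hs HI Hne; assert (HPI := PI_RGT_0).
  destruct (module_core_local_frame s I t0 Hs HI Hne N (le_n _)) as [w [d0 [Hd0 [Hw Hloc]]]].
  set (d := Rmin d0 (PI / 8)).
  assert (Hd : 0 < d <= PI / 8) by (split; [apply Rmin_pos; lra | apply Rmin_r]).
  assert (Hdd : d <= d0) by apply Rmin_l.
  destruct (periodic_bump t0 d ltac:(lra)) as [b [Pb [Bnn [B1 B0]]]].
  exists b, (d / 2); split; [exact Pb | split; [lra | split; [exact Bnn | split]]].
  { intros t Ht; rewrite B1 by lra; lra. }
  intros v Lv.
  assert (HK := module_core_ideal s I Hs HI).
  destruct (choice_lt (fun _ => 0) N _ (fun i Hi => local_periodic (fun t => v t i) t0 (proj1 Lv i Hi)))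
    as [f Pf].
  assert (Ksum : module_core s I (lsum N (fun i => fscal (fun t => b t * f i t) (w i)))).
  { apply loop_ideal_lsum with (1 := HK); intros i Hi.
    apply module_core_fscal; [exact HI | apply periodic_mult; [exact Pb | apply Pf, Hi] | apply Hw, Hi]. }
  assert (E : leqL g (lsum N (fun i => fscal (fun t => b t * f i t) (w i))) (fscal b v)).
  { apply (leqL_of_period s _ _ t0 Hs); [apply Ksum | apply in_L_fscal; assumption|].
    intros t Ht j Hj; unfold lsum, fscal, vscal.
    destruct (Rlt_dec (Rabs (t - t0)) d) as [L|L].
    - rewrite <- (rsum_delta N j (fun i => b t * v t i)) by exact Hj.
      apply rsum_ext; intros i Hi; rewrite (proj2 (Pf i Hi)), Hloc by (assumption || lra).
      unfold basis; rewrite (Nat.eqb_sym j i); ring.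
    - rewrite B0 by lra; rewrite rsum_zero; [ring | intros; ring]. }
  (* Membership in the core gives membership in [I] through multiplication by the constant function
     1. *)
  apply (proj1 (proj2 HI)) with (fscal (fun _ => 1) (fscal b v)).
  - apply (proj1 (proj2 HK)) with (1 := Ksum) in E; apply E, periodic_const.
  - intros t i _; unfold fscal, vscal; ring.
Qed.

(* A partition-of-unity argument: the functions [b] with [b L <= I] form an ideal without common zero. *)
Lemma ideal_without_zero_full s I : AutG g s -> loop_ideal s I ->
  (forall t, exists u, I u /\ ~ u t =v= vzero) -> forall v, in_L g s v -> I v.
Proof.
  intros Hs HI Hne; assert (HPI := PI_RGT_0).
  assert (Hb : exists b, periodic b /\ (forall t, 0 <= b t) /\ (forall t, 0 <= t <= 2 * PI -> 0 < b t) /\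
    forall v, in_L g s v -> I (fscal b v)).
  { apply (interval_induction (fun T => exists b, periodic b /\ (forall t, 0 <= b t) /\
      (forall t, 0 <= t <= T -> 0 < b t) /\ forall v, in_L g s v -> I (fscal b v)) 0 (2 * PI)); [lra| |].
    - destruct (ideal_contains_bumps s I 0 Hs HI (Hne 0)) as [b [d [Pb [Hd [Bnn [Bpos HB]]]]]].
      exists b; split; [exact Pb | split; [exact Bnn | split; [|exact HB]]].
      intros t Ht; apply Bpos; rewrite Rabs_pos_eq; lra.
    - intros t0 Ht0.
      destruct (ideal_contains_bumps s I t0 Hs HI (Hne t0)) as [b [d [Pb [Hd [Bnn [Bpos HB]]]]]].
      exists d; split; [exact Hd|].
      intros x y Hx Hy Hxd Hyd [c [Pc [Cnn [Cpos HC]]]].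
      exists (fun t => c t + b t); split; [apply periodic_plus; assumption | split; [|split]].
      + intros t; specialize (Cnn t); specialize (Bnn t); lra.
      + intros t Ht; destruct (Rle_dec t x) as [L|L].
        * apply Rplus_lt_le_0_compat; [apply Cpos; lra | apply Bnn].
        * apply Rplus_le_lt_0_compat; [apply Cnn | apply Bpos].
          apply Rabs_def2 in Hxd; apply Rabs_def2 in Hyd; apply Rabs_def1; lra.
      + intros v Lv; apply (proj1 (proj2 HI)) with (ladd (fscal c v) (fscal b v)).
        * apply HI; [apply HC | apply HB]; exact Lv.
        * intros t i _; unfold fscal, ladd, vscal, vadd; ring. }
  destruct Hb as [b [Pb [Bnn [Bpos HB]]]].
  assert (Hpos : forall t, 0 < b t).
  { intros t; set (k := period_index (t - PI)).
    assert (H := period_index_spec (t - PI)); fold k in H.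
    replace t with (t - 2 * PI * IZR k + 2 * PI * IZR k) by ring.
    rewrite periodic_Z by exact Pb; apply Bpos; lra. }
  (* An everywhere positive multiplier is invertible among the periodic functions: v = b (v/b). *)
  intros v Lv; apply (proj1 (proj2 HI)) with (fscal b (fscal (fun t => / b t) v)).
  - apply HB, in_L_fscal; [apply periodic_inv; [exact Pb | intros t; specialize (Hpos t); lra] | exact Lv].
  - intros t i _; unfold fscal, vscal; field; specialize (Hpos t); lra.
Qed.

Lemma dim_pos : (0 < N)%nat.
Proof.
  destruct (proj1 simple_g) as [x [y H]].
  destruct (Nat.eq_dec N 0) as [E|E]; [|lia].
  exfalso; apply H; intros i Hi; fold N in Hi; lia.
Qed.

Lemma nonzero_vec : ~ basis 0 =v= vzero.
Proof. intros H; specialize (H 0%nat dim_pos); unfold basis, vzero in H; simpl in H; lra. Qed.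

Lemma LIso_lsum s1 s2 psi n F : AutG g s1 -> LIso g s1 s2 psi ->
  (forall k, (k < n)%nat -> in_L g s1 (F k)) ->
  leqL g (psi (lsum n F)) (lsum n (fun k => psi (F k))).
Proof.
  intros Hs [[HL [HE [HA [HS _]]]] _] HF.
  assert (Lsum : forall m, (m <= n)%nat -> in_L g s1 (lsum m F)).
  { induction m as [|m IH]; intros Hm; [apply in_L_zero|].
    apply in_L_ext with (ladd (lsum m F) (F m)); [|intros t i _; reflexivity].
    apply in_L_ladd; [apply IH; lia | apply HF; lia]. }
  assert (H : forall m, (m <= n)%nat -> leqL g (psi (lsum m F)) (lsum m (fun k => psi (F k)))).
  { induction m as [|m IH]; intros Hm t.
    - assert (Lz := in_L_zero g s1).
      (* That [psi] kills the zero loop follows from homogeneity with the factor 0. *)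
      transitivity (psi (lscal 0 (fun _ => vzero)) t).
      + apply HE; [apply Lsum; lia | apply in_L_lscal, Lz | intros r i _; unfold lsum, lscal, vscal, vzero; simpl; ring].
      + rewrite (HS 0 _ Lz t); intros i _; unfold lsum, lscal, vscal; simpl; ring.
    - transitivity (psi (ladd (lsum m F) (F m)) t).
      + apply HE; [apply Lsum, Hm | apply in_L_ladd; [apply Lsum; lia | apply HF; lia] | intros r i _; reflexivity].
      + rewrite (HA _ _ (Lsum m ltac:(lia)) (HF m ltac:(lia)) t).
        unfold ladd; rewrite (IH ltac:(lia) t); intros i _; reflexivity. }
  apply H, le_n.
Qed.

Section Isomorphism.
Variables (s1 s2 : mat) (psi : loop -> loop).
Hypotheses (Hs1 : AutG g s1) (Hs2 : AutG g s2) (Hpsi : LIso g s1 s2 psi).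

Lemma LIso_kernel_ideal t : loop_ideal s1 (fun u => in_L g s1 u /\ psi u t =v= vzero).
Proof.
  destruct Hpsi as [[HL [HE [HA [HS [HJ HB]]]]] _].
  split; [|split; [|split; [|split; [|split; [|split]]]]].
  - intros u [Lu _]; exact Lu.
  - intros u v [Lu Eu] E; assert (Lv := in_L_ext g s1 u v Lu E); split; [exact Lv|].
    rewrite <- (HE u v Lu Lv E t); exact Eu.
  - assert (Lz := in_L_zero g s1); split; [exact Lz|].
    transitivity (psi (lscal 0 (fun _ => vzero)) t).
    + apply HE; [exact Lz | apply in_L_lscal, Lz | intros r i _; unfold lscal, vscal, vzero; ring].
    + rewrite (HS 0 _ Lz t); intros i _; unfold lscal, vscal, vzero; ring.
  - intros u v [Lu Eu] [Lv Ev]; split; [apply in_L_ladd; assumption|].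
    rewrite (HA u v Lu Lv t); unfold ladd; rewrite Eu, Ev; intros i _; unfold vadd, vzero; ring.
  - intros a u [Lu Eu]; split; [apply in_L_lscal; assumption|].
    rewrite (HS a u Lu t); unfold lscal; rewrite Eu; intros i _; unfold vscal, vzero; ring.
  - intros Hc u [Lu Eu]; split; [apply in_L_lJ; assumption|].
    rewrite (HJ Hc u Lu t); unfold lJ; rewrite Eu; apply mapply_zero.
  - intros x u Lx [Lu Eu]; split; [apply in_L_lbr; assumption|].
    rewrite (HB x u Lx Lu t); unfold lbr; rewrite Eu.
    intros k _; unfold br, vzero; apply rsum_zero; intros; apply rsum_zero; intros; ring.
Qed.

Lemma LIso_value t y : exists u, in_L g s1 u /\ psi u t =v= y.
Proof.
  destruct (loop_through g s2 y t Hs2) as [w [Lw Ew]].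
  destruct (proj2 (proj2 Hpsi) w Lw) as [u [Lu Eu]].
  exists u; split; [exact Lu | rewrite (Eu t); exact Ew].
Qed.

(** A kernel without common zero would be all of L, against surjectivity. For the converse, the
    values at [t] of images of loops vanishing at [r] form an ideal of [g]. Were it all of [g],
    every loop would differ from one vanishing at [r] by a kernel element, and so would itself
    vanish at [r]. *)
Lemma LIso_zero_set t : exists r, forall u, in_L g s1 u -> (psi u t =v= vzero <-> u r =v= vzero).
Proof.
  assert (HI := LIso_kernel_ideal t).
  set (I := fun u => in_L g s1 u /\ psi u t =v= vzero) in HI.
  assert (Hr : exists r, forall u, I u -> u r =v= vzero).
  { apply NNPP; intros Hn.
    assert (Hne : forall r, exists u, I u /\ ~ u r =v= vzero).
    { intros r; apply NNPP; intros Hr; apply Hn; exists r; intros u Iu.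
      apply NNPP; intros Hu; apply Hr; exists u; split; assumption. }
    destruct (LIso_value t (basis 0)) as [u [Lu Eu]].
    apply nonzero_vec; rewrite <- Eu; apply (ideal_without_zero_full s1 I Hs1 HI Hne u Lu). }
  destruct Hr as [r Hr]; exists r; intros u Lu; split; [intros Eu; apply Hr; split; assumption|].
  revert u Lu.
  set (W := fun y => exists u, in_L g s1 u /\ u r =v= vzero /\ psi u t =v= y).
  destruct Hpsi as [[HL [HE [HA [HS [HJ HB]]]]] _].
  assert (HW : ideal g W).
  { split; [split; [|split; [|split; [|split]]]|].
    - intros v w [u [Lu [Ru Eu]]] E; exists u; split; [|split]; [exact Lu | exact Ru | rewrite Eu; exact E].
    - exists (fun _ => vzero); split; [apply in_L_zero | split; [reflexivity | apply HI]].
    - intros v w [u [Lu [Ru Eu]]] [u' [Lu' [Ru' Eu']]]; exists (ladd u u'); split; [|split].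
      + apply in_L_ladd; assumption.
      + unfold ladd; rewrite Ru, Ru'; intros i _; unfold vadd, vzero; ring.
      + rewrite (HA u u' Lu Lu' t); unfold ladd; rewrite Eu, Eu'; reflexivity.
    - intros a v [u [Lu [Ru Eu]]]; exists (lscal a u); split; [|split].
      + apply in_L_lscal; assumption.
      + unfold lscal; rewrite Ru; intros i _; unfold vscal, vzero; ring.
      + rewrite (HS a u Lu t); unfold lscal; rewrite Eu; reflexivity.
    - intros Hc v [u [Lu [Ru Eu]]]; exists (lJ g u); split; [|split].
      + apply in_L_lJ; assumption.
      + unfold lJ; rewrite Ru; apply mapply_zero.
      + rewrite (HJ Hc u Lu t); unfold lJ; rewrite Eu; reflexivity.
    - intros x y [u [Lu [Ru Eu]]]; destruct (LIso_value t y) as [w [Lw Ew]].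
      exists (lbr g w u); split; [|split].
      + apply in_L_lbr; assumption.
      + unfold lbr; rewrite Ru; intros k _; unfold br, vzero; apply rsum_zero; intros; apply rsum_zero; intros; ring.
      + rewrite (HB w u Lw Lu t); unfold lbr; rewrite Eu, Ew; reflexivity. }
  destruct (proj2 simple_g W HW) as [H|H].
  - intros u Lu Ru; apply H; exists u; split; [exact Lu | split; [exact Ru | reflexivity]].
  - exfalso; destruct (loop_through g s1 (basis 0) r Hs1) as [u [Lu Eu]].
    destruct (H (psi u t)) as [v [Lv [Rv Ev]]].
    assert (Hd : I (ladd u (lscal (-1) v))).
    { assert (Lm := in_L_lscal g s1 (-1) v Lv).
      split; [apply in_L_ladd; assumption|].
      rewrite (HA _ _ Lu Lm t); unfold ladd; rewrite (HS (-1) v Lv t); unfold lscal; rewrite Ev.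
      intros i _; unfold vadd, vscal, vzero; ring. }
    apply Hr in Hd; apply nonzero_vec.
    rewrite <- Eu, <- Hd; unfold ladd, lscal; rewrite Rv.
    intros i _; unfold vadd, vscal, vzero; ring.
Qed.

(** A loop [u] agrees at [r] with the combination of fixed loops through the basis vectors with
    coefficients u_j(r), so both have the same image at [t]. The columns of [A] are the images of
    those loops; surjectivity of [psi] gives a right inverse, and the zero set makes it
    two-sided. *)
Lemma LIso_pointwise t : exists r A, AutG g A /\ forall u, in_L g s1 u -> psi u t =v= A $ u r.
Proof.
  destruct (LIso_zero_set t) as [r Hr]; exists r.
  destruct Hpsi as [[HL [HE [HA [HS [HJ HB]]]]] _].
  destruct (functional_choice _ (fun j => loop_through g s1 (basis j) r Hs1)) as [e He].
  set (A := fun i j => psi (e j) t i); exists A.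
  assert (Hform : forall u, in_L g s1 u -> psi u t =v= A $ u r).
  { intros u Lu.
    set (v := lsum N (fun j => lscal (u r j) (e j))).
    assert (Lk : forall j, (j < N)%nat -> in_L g s1 (lscal (u r j) (e j))) by (intros; apply in_L_lscal, He).
    assert (Ev := LIso_lsum s1 s2 psi N _ Hs1 Hpsi Lk); fold v in Ev.
    assert (Lv : in_L g s1 v).
    { apply (loop_ideal_lsum s1 (in_L g s1)); [|exact Lk].
      split; [auto | split; [intros; eapply in_L_ext; eassumption|]].
      split; [apply in_L_zero | split; [intros; apply in_L_ladd; assumption|]].
      split; [intros; apply in_L_lscal; assumption | split; [intros; apply in_L_lJ; assumption|]].
      intros; apply in_L_lbr; assumption. }
    assert (Lm := in_L_lscal g s1 (-1) v Lv).
    assert (Hz : psi (ladd u (lscal (-1) v)) t =v= vzero).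
    { apply Hr; [apply in_L_ladd; assumption|].
      intros i Hi; unfold v, ladd, lsum, lscal, vadd, vscal, vzero.
      rewrite (rsum_ext N _ (fun j => (if Nat.eqb j i then 1 else 0) * u r j)).
      - rewrite rsum_delta by exact Hi; ring.
      - intros j Hj; rewrite (proj2 (He j)) by exact Hi; unfold basis; rewrite Nat.eqb_sym; ring. }
    rewrite (HA _ _ Lu Lm t) in Hz; unfold ladd in Hz.
    assert (Hv : psi v t =v= A $ u r).
    { rewrite (Ev t); intros i Hi; unfold lsum, mapply, A; apply rsum_ext; intros j Hj.
      rewrite (HS _ _ (proj1 (He j)) t) by exact Hi; unfold lscal, vscal; ring. }
    rewrite <- Hv; intros i Hi; specialize (Hz i Hi); unfold vadd, vzero in Hz.
    rewrite (HS _ _ Lv t) in Hz by exact Hi; unfold lscal, vscal in Hz; lra. }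
  split; [|exact Hform].
  assert (Hval : forall x, exists u, in_L g s1 u /\ u r =v= x) by (intros x; apply loop_through, Hs1).
  split; [|split].
  - intros Hc; apply meq_mapply; intros x; destruct (Hval x) as [u [Lu Eu]].
    rewrite !mapply_mmul, <- Eu, <- Hform by exact Lu.
    rewrite <- (HJ Hc u Lu t), Hform by (apply in_L_lJ; assumption); reflexivity.
  - intros x y; destruct (Hval x) as [u [Lu Eu]]; destruct (Hval y) as [v [Lv Ev]].
    rewrite <- Eu, <- Ev, <- !Hform by assumption.
    rewrite <- (HB u v Lu Lv t), Hform by (apply in_L_lbr; assumption); reflexivity.
  - assert (Hsur : forall j, exists x, A $ x =v= basis j).
    { intros j; destruct (LIso_value t (basis j)) as [u [Lu Eu]].
      exists (u r); rewrite <- Hform by exact Lu; exact Eu. }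
    destruct (functional_choice _ Hsur) as [b Hb].
    set (B := fun i j => b j i).
    assert (HAB : A ** B =m= mid) by (intros i j Hi Hj; exact (Hb j i Hi)).
    assert (Hker : forall x, A $ x =v= vzero -> x =v= vzero).
    { intros x Hx; destruct (Hval x) as [u [Lu Eu]].
      rewrite <- Eu in Hx |- *; apply Hr; [exact Lu | rewrite Hform by exact Lu; exact Hx]. }
    exists B; split; [exact HAB|].
    apply meq_mapply; intros x; rewrite mapply_1, mapply_mmul.
    assert (Hz : vadd (B $ A $ x) (vscal (-1) x) =v= vzero).
    { apply Hker; rewrite mapply_vadd, mapply_vscal, <- mapply_mmul, HAB, mapply_1.
      intros i _; unfold vadd, vscal, vzero; ring. }
    intros i Hi; specialize (Hz i Hi); unfold vadd, vscal, vzero in Hz; lra.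
Qed.

End Isomorphism.
End Structure.

(** * Standard form of isomorphisms *)

Section StandardForm.
Variable g : LieData.
Let N := dim g.

Notation "A =m= B" := (meq g A B) (at level 70).
Notation "v =v= w" := (veq g v w) (at level 70).
Notation "A ** B" := (mmul g A B) (at level 40, left associativity).
Notation "A $ v" := (mapply g A v) (at level 45, right associativity).

Lemma LIso_inverse s1 s2 psi : AutG g s1 -> LIso g s1 s2 psi ->
  exists chi, LIso g s2 s1 chi /\ (forall w, in_L g s2 w -> leqL g (psi (chi w)) w) /\
    forall u, in_L g s1 u -> leqL g (chi (psi u)) u.
Proof.
  intros Hs1 [[HL [HE [HA [HS [HJ HB]]]]] [Hinj Hsur]].
  set (chi := fun w => epsilon (inhabits (fun _ => vzero)) (fun u => in_L g s1 u /\ leqL g (psi u) w)).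
  assert (Hc : forall w, in_L g s2 w -> in_L g s1 (chi w) /\ leqL g (psi (chi w)) w)
    by (intros w Lw; unfold chi; apply epsilon_spec, Hsur, Lw).
  assert (Hu : forall w u, in_L g s2 w -> in_L g s1 u -> leqL g (psi u) w -> leqL g (chi w) u).
  { intros w u Lw Lu E; apply Hinj; [apply Hc, Lw | exact Lu|].
    intros t; rewrite (proj2 (Hc w Lw) t), (E t); reflexivity. }
  exists chi; split; [split; [split; [|split; [|split; [|split; [|split]]]]|split]|split].
  - intros w Lw; apply Hc, Lw.
  - intros w w' Lw Lw' E; apply Hu; [exact Lw | apply Hc, Lw'|].
    intros t; rewrite (proj2 (Hc w' Lw') t); symmetry; apply E.
  - intros w w' Lw Lw'; destruct (Hc w Lw) as [L1 E1], (Hc w' Lw') as [L2 E2].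
    apply Hu; [apply in_L_ladd; assumption | apply in_L_ladd; assumption|].
    intros t; rewrite (HA _ _ L1 L2 t); unfold ladd; rewrite (E1 t), (E2 t); reflexivity.
  - intros a w Lw; destruct (Hc w Lw) as [L1 E1].
    apply Hu; [apply in_L_lscal; assumption | apply in_L_lscal; assumption|].
    intros t; rewrite (HS _ _ L1 t); unfold lscal; rewrite (E1 t); reflexivity.
  - intros Hcx w Lw; destruct (Hc w Lw) as [L1 E1].
    assert (LJ1 := in_L_lJ g s1 _ Hs1 Hcx L1).
    assert (LJ2 : in_L g s2 (lJ g w)).
    { apply in_L_ext with (psi (lJ g (chi w))); [apply HL, LJ1|].
      intros t; rewrite (HJ Hcx _ L1 t); unfold lJ; rewrite (E1 t); reflexivity. }
    apply Hu; [exact LJ2 | exact LJ1|].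
    intros t; rewrite (HJ Hcx _ L1 t); unfold lJ; rewrite (E1 t); reflexivity.
  - intros w w' Lw Lw'; destruct (Hc w Lw) as [L1 E1], (Hc w' Lw') as [L2 E2].
    assert (LB1 := in_L_lbr g s1 _ _ Hs1 L1 L2).
    assert (E : leqL g (psi (lbr g (chi w) (chi w'))) (lbr g w w')).
    { intros t; rewrite (HB _ _ L1 L2 t); unfold lbr; rewrite (E1 t), (E2 t); reflexivity. }
    apply Hu; [|exact LB1 | exact E].
    apply in_L_ext with (2 := E), HL, LB1.
  - intros w w' Lw Lw' E t.
    rewrite <- (proj2 (Hc w Lw) t), <- (proj2 (Hc w' Lw') t).
    apply HE; [apply Hc, Lw | apply Hc, Lw' | exact E].
  - intros u Lu; exists (psi u); split; [apply HL, Lu|].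
    apply Hu; [apply HL, Lu | exact Lu | intros t; reflexivity].
  - intros w Lw; apply Hc, Lw.
  - intros u Lu; apply Hu; [apply HL, Lu | exact Lu | intros t; reflexivity].
Qed.

Lemma LIso_compose s1 s2 s3 psi chi : AutG g s1 -> LIso g s1 s2 psi -> LIso g s2 s3 chi ->
  LIso g s1 s3 (fun u => chi (psi u)).
Proof.
  intros Hs1 [[HL [HE [HA [HS [HJ HB]]]]] [Hinj Hsur]] [[HL' [HE' [HA' [HS' [HJ' HB']]]]] [Hinj' Hsur']].
  assert (Htr : forall u w, in_L g s1 u -> leqL g (psi u) w -> leqL g (chi (psi u)) (chi w)).
  { intros u w Lu E; apply HE'; [apply HL, Lu | apply in_L_ext with (2 := E), HL, Lu | exact E]. }
  split; [split; [|split; [|split; [|split; [|split]]]]|split].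
  - intros u Lu; apply HL', HL, Lu.
  - intros u v Lu Lv E; apply Htr; [exact Lu | apply HE; assumption].
  - intros u v Lu Lv t; rewrite <- (HA' _ _ (HL u Lu) (HL v Lv) t).
    apply Htr; [apply in_L_ladd; assumption | apply HA; assumption].
  - intros a u Lu t; rewrite <- (HS' a _ (HL u Lu) t).
    apply Htr; [apply in_L_lscal; assumption | apply HS; assumption].
  - intros Hc u Lu t; rewrite <- (HJ' Hc _ (HL u Lu) t).
    apply Htr; [apply in_L_lJ; assumption | apply HJ; assumption].
  - intros u v Lu Lv t; rewrite <- (HB' _ _ (HL u Lu) (HL v Lv) t).
    apply Htr; [apply in_L_lbr; assumption | apply HB; assumption].
  - intros u v Lu Lv E; apply Hinj; try assumption; apply Hinj'; try (apply HL; assumption); exact E.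
  - intros w Lw; destruct (Hsur' w Lw) as [v [Lv Ev]], (Hsur v Lv) as [u [Lu Eu]].
    exists u; split; [exact Lu|].
    intros t; rewrite <- (Ev t); apply Htr; assumption.
Qed.

Hypothesis simple_g : simple g.

Lemma evaluation_matrix s A B r : AutG g s -> (forall u, in_L g s u -> A $ u r =v= B $ u r) -> A =m= B.
Proof.
  intros Hs H; apply meq_mapply; intros v; destruct (loop_through g s v r Hs) as [u [Lu Eu]].
  rewrite <- Eu; apply H, Lu.
Qed.

(** If [a] and [b] were incongruent modulo 2 pi, a loop separating them would violate the identity.
    This is how relations between loops become relations between parameters. *)
Lemma evaluation_point s A B a b : AutG g s -> AutG g A ->
  (forall u, in_L g s u -> A $ u a =v= B $ u b) -> exists k : Z, a = b + 2 * PI * IZR k.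
Proof.
  intros Hs HA H; apply NNPP; intros Hn.
  assert (Hsep : forall k : Z, b <> a + 2 * PI * IZR k).
  { intros k E; apply Hn; exists (- k)%Z; rewrite opp_IZR, E; ring. }
  destruct (loop_separating g s (basis 0) a b Hs Hsep) as [u [Lu [E0 E1]]].
  apply (nonzero_vec g simple_g); rewrite <- E0; apply aut_mapply_cancel with (1 := HA).
  rewrite (H u Lu), E1, !mapply_zero; reflexivity.
Qed.

Lemma bump_loop_near s x t0 (th : R -> R) : AutG g s -> smooth th ->
  exists u d, in_L g s u /\ 0 < d /\ forall t, Rabs (t - t0) < d -> u (th t) =v= x.
Proof.
  intros Hs Sth; assert (HPI := PI_RGT_0).
  destruct (bump_loop g s x (th t0) (PI / 4) Hs ltac:(lra)) as [u [Lu [E _]]].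
  destruct (smooth_close th t0 (PI / 4 / 2) Sth ltac:(lra)) as [d [Hd H]].
  exists u, d; split; [exact Lu | split; [exact Hd|]].
  intros t Ht; apply E; left; apply H, Ht.
Qed.

Section Form.
Variables (s1 s2 : mat) (psi : loop -> loop).
Hypotheses (Hs1 : AutG g s1) (Hs2 : AutG g s2) (Hpsi : LIso g s1 s2 psi).

(** The point map [m] comes from a bare choice. If psi u is the constant first basis vector near
    [t0], then the first coordinate of psi (f u) is f(m t) there, and it is smooth because psi (f u)
    is a loop. *)
Lemma LIso_pullback_smooth (m : R -> R) (P : R -> mat) f :
  (forall t u, in_L g s1 u -> psi u t =v= P t $ u (m t)) -> periodic f -> smooth (fun t => f (m t)).
Proof.
  intros HP Pf; apply smooth_local; intros t0.
  destruct (bump_loop_near s2 (basis 0) t0 (fun t => t) Hs2 smooth_id) as [w [d [Lw [Hd Ew]]]].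
  destruct (proj2 (proj2 Hpsi) w Lw) as [u [Lu Eu]].
  assert (Lfu := in_L_fscal g s1 f u Pf Lu).
  exists d, (fun t => psi (fscal f u) t 0%nat).
  split; [exact Hd | split; [apply (proj1 (proj1 Hpsi) _ Lfu), dim_pos, simple_g|]].
  intros t Ht; rewrite HP by (try apply dim_pos; assumption).
  unfold fscal; rewrite (mapply_vscal g) by (apply dim_pos; assumption).
  unfold vscal; rewrite <- (HP t u Lu) by (apply dim_pos; assumption).
  rewrite (Eu t) by (apply dim_pos; assumption).
  rewrite (Ew t Ht) by (apply dim_pos; assumption); unfold basis; simpl; ring.
Qed.

(** The chosen points are meaningful only modulo 2 pi, so only their cosine and sine are smooth at
    first. Lifting the angle gives a smooth [th], and the discrepancy 2 pi k is absorbed into the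
    matrix as a power of [s1]. Columns of [Q] are then images of locally constant loops. *)
Lemma LIso_smooth_form : exists th Q, smooth th /\ msmooth g Q /\ (forall t, AutG g (Q t)) /\
  forall u, in_L g s1 u -> forall t, psi u t =v= Q t $ u (th t).
Proof.
  destruct (functional_choice _ (LIso_pointwise g simple_g s1 s2 psi Hs1 Hs2 Hpsi)) as [m Hm].
  destruct (functional_choice _ Hm) as [P HP].
  destruct (angle_lift (fun t => cos (m t)) (fun t => sin (m t)) 0) as [th [Sth Hth]].
  - apply (LIso_pullback_smooth m P cos); [intros; apply HP; assumption | apply periodic_cos_sin].
  - apply (LIso_pullback_smooth m P sin); [intros; apply HP; assumption | apply periodic_cos_sin].
  - intros t; generalize (sin2_cos2 (m t)); unfold Rsqr; lra.
  - exists (m 0); split; reflexivity.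
  - assert (HQ : forall t, exists A, AutG g A /\ forall u, in_L g s1 u -> psi u t =v= A $ u (th t)).
    { intros t; destruct (Hth t) as [Hc Hsn].
      destruct (cos_sin_eq_2PI (m t) (th t)) as [k Hk]; [symmetry; assumption | symmetry; assumption|].
      exists (P t ** zpow g s1 k); split; [apply AutG_mul; [apply HP | apply AutG_zpow, Hs1]|].
      intros u Lu; rewrite mapply_mmul, <- (in_L_Z g s1 u k (th t) Hs1 Lu), <- Hk; apply HP, Lu. }
    destruct (functional_choice _ HQ) as [Q HQ'].
    exists th, Q; split; [exact Sth | split; [|split; [apply HQ' | intros; apply HQ'; assumption]]].
    intros i j Hi Hj; apply smooth_local; intros t0.
    destruct (bump_loop_near s1 (basis j) t0 th Hs1 Sth) as [u [d [Lu [Hd Eu]]]].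
    exists d, (fun t => psi u t i); split; [exact Hd | split; [apply (proj1 (proj1 Hpsi) _ Lu), Hi|]].
    intros t Ht; rewrite (proj2 (HQ' t) u Lu) by exact Hi.
    rewrite <- (mapply_basis g (Q t) j i Hj).
    assert (E : Q t $ u (th t) =v= Q t $ basis j) by (rewrite (Eu t Ht); reflexivity).
    symmetry; apply E, Hi.
Qed.

Lemma form_quasi_periodic th Q : smooth th -> (forall t, AutG g (Q t)) ->
  (forall u, in_L g s1 u -> forall t, psi u t =v= Q t $ u (th t)) ->
  exists n : Z, forall t, th (t + 2 * PI) = th t + 2 * PI * IZR n.
Proof.
  intros Sth HQ Hform.
  destruct (continuous_2PI_valued_const (fun t => th (t + 2 * PI) - th t)) as [n Hn].
  - apply smooth_continuity, smooth_minus; [|exact Sth].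
    apply smooth_comp; [exact Sth | apply smooth_plus; [apply smooth_id | apply smooth_const]].
  - intros t.
    destruct (evaluation_point s1 (Q (t + 2 * PI)) (s2 ** Q t) (th (t + 2 * PI)) (th t) Hs1 (HQ _)) as [k Hk].
    + intros u Lu; rewrite mapply_mmul, <- !Hform by exact Lu.
      apply (proj1 (proj1 Hpsi) u Lu).
    + exists k; lra.
  - exists n; intros t; specialize (Hn t); lra.
Qed.

End Form.

Lemma quasi_periodic_Z (th : R -> R) (n k : Z) t : (forall t, th (t + 2 * PI) = th t + 2 * PI * IZR n) ->
  th (t + 2 * PI * IZR k) = th t + 2 * PI * IZR (k * n).
Proof.
  intros H; revert k; apply Z.peano_ind.
  - simpl; rewrite Rmult_0_r, !Rplus_0_r; reflexivity.
  - intros k IH; replace (t + 2 * PI * IZR (Z.succ k)) with (t + 2 * PI * IZR k + 2 * PI) by (rewrite succ_IZR; ring).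
    rewrite H, IH, !mult_IZR, succ_IZR; ring.
  - intros k IH; assert (E := H (t + 2 * PI * IZR (Z.pred k))).
    replace (t + 2 * PI * IZR (Z.pred k) + 2 * PI) with (t + 2 * PI * IZR k) in E
      by (rewrite <- Z.sub_1_r, minus_IZR; ring).
    rewrite IH in E; rewrite Z.mul_pred_l, minus_IZR; lra.
Qed.

Theorem LIso_standard_form s1 s2 psi : AutG g s1 -> AutG g s2 -> LIso g s1 s2 psi ->
  exists th Q n, smooth th /\ msmooth g Q /\ (forall t, AutG g (Q t)) /\
    (forall u, in_L g s1 u -> forall t, psi u t =v= Q t $ u (th t)) /\
    (forall t, th (t + 2 * PI) = th t + 2 * PI * IZR n) /\ (n = 1 \/ n = -1)%Z.
Proof.
  intros Hs1 Hs2 Hpsi.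
  destruct (LIso_inverse s1 s2 psi Hs1 Hpsi) as [chi [Hchi [Epc Ecp]]].
  destruct (LIso_smooth_form s1 s2 psi Hs1 Hs2 Hpsi) as [th [Q [Sth [SQ [AQ HQ]]]]].
  destruct (LIso_smooth_form s2 s1 chi Hs2 Hs1 Hchi) as [rh [P [Srh [SP [AP HP]]]]].
  destruct (form_quasi_periodic s1 s2 psi Hs1 Hpsi th Q Sth AQ HQ) as [n Hn].
  destruct (form_quasi_periodic s2 s1 chi Hs2 Hchi rh P Srh AP HP) as [m Hm].
  exists th, Q, n; repeat (split; [assumption|]).
  destruct (continuous_2PI_valued_const (fun t => th (rh t) - t)) as [k Hk].
  - apply smooth_continuity, smooth_minus; [apply smooth_comp; assumption | apply smooth_id].
  - intros t.
    destruct (evaluation_point s1 (P t ** Q (rh t)) mid (th (rh t)) t Hs1) as [k Hk].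
    + apply AutG_mul; [apply AP | apply AQ].
    + intros u Lu; rewrite mapply_1, mapply_mmul, <- HQ by exact Lu.
      rewrite <- HP by (apply (proj1 (proj1 Hpsi)), Lu); apply Ecp, Lu.
    + exists k; lra.
  (* The composite of the parameter maps is a translation, so the degrees of [psi] and its inverse
     multiply to 1. *)
  - assert (E : (m * n = 1)%Z).
    { apply eq_IZR; assert (E1 := Hk (0 + 2 * PI)); assert (E2 := Hk 0); cbv beta in E1, E2.
      assert (E3 := Hm 0); rewrite E3, (quasi_periodic_Z th n m (rh 0) Hn) in E1.
      assert (HPI := PI_RGT_0); nra. }
    destruct (Z.mul_eq_1 n m) as [-> | ->]; [lia | left; reflexivity | right; reflexivity].
Qed.

End StandardForm.

(** * From quasiconjugacy to equivalent pairs *)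

Section Pairs.
Variable g : LieData.
Let N := dim g.

Notation "A =m= B" := (meq g A B) (at level 70).
Notation "v =v= w" := (veq g v w) (at level 70).
Notation "A ** B" := (mmul g A B) (at level 40, left associativity).
Notation "A $ v" := (mapply g A v) (at level 45, right associativity).

Lemma centralizer_id_comp_1 c : in_centralizer_id_comp g c mid.
Proof.
  exists (fun _ => mid); split; [|split; [|split]].
  - intros i j _ _; apply continuity_const; intros x y; reflexivity.
  - reflexivity.
  - reflexivity.
  - intros t _; split; [apply AutG_1 | rewrite mmul_1_l, mmul_1_r; reflexivity].
Qed.

Lemma pair_rel_conj_same a b al : AutG g al ->
  pair_rel g a b (al ** a ** minv g al) (al ** b ** minv g al).
Proof.
  intros H; eapply pr_trans; [|apply pr_eq; [apply mmul_assoc | apply mmul_assoc]].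
  apply pr_conj; try assumption; try (apply minv_r; assumption); try (apply minv_l; assumption).
  destruct (centralizer_id_comp_1 (a ** a)) as [p [H1 [H2 [H3 H4]]]].
  exists p; split; [exact H1 | split; [exact H2 | split; [rewrite minv_l by exact H; exact H3 | exact H4]]].
Qed.

Section DihedralShift.
Variables ap am s : mat.
Hypotheses (Hap : AutG g ap) (Ham : AutG g am) (Hsq : ap ** ap =m= am ** am) (Hs : am ** s =m= ap).

Lemma twist_AutG : AutG g s.
Proof.
  assert (E : s =m= minv g am ** ap) by (rewrite <- Hs, mmul_assoc, minv_l, mmul_1_l by exact Ham; reflexivity).
  rewrite E; apply AutG_mul; [apply AutG_minv|]; assumption.
Qed.

(** This is the dihedral relation ap s ap^-1 = s^-1, a consequence of the equality of the two
    squares. *)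
Lemma twist_reflection : s ** ap ** s =m= ap.
Proof.
  apply mmul_cancel_l with (1 := Ham); rewrite !mmul_assoc, Hs, Hsq, <- mmul_assoc, Hs; reflexivity.
Qed.

Lemma zpow_reflection i : zpow g s i ** ap =m= ap ** zpow g s (- i).
Proof.
  assert (As := twist_AutG).
  assert (E1 : s ** ap =m= ap ** zpow g s (-1)).
  { apply mmul_cancel_r with (1 := As).
    rewrite twist_reflection, <- mmul_assoc, <- zpow_succ, zpow_0, mmul_1_r by exact As; reflexivity. }
  revert i; apply Z.peano_ind.
  - rewrite zpow_0, mmul_1_l, mmul_1_r; reflexivity.
  - intros i IH; rewrite <- Z.add_1_r, zpow_succ, <- mmul_assoc, E1, mmul_assoc, IH by exact As.
    rewrite <- mmul_assoc, <- zpow_add by exact As.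
    replace (- i + -1)%Z with (- (i + 1))%Z by lia; reflexivity.
  - intros i IH.
    replace (- Z.pred i)%Z with (- i + 1)%Z by lia.
    rewrite zpow_succ, mmul_assoc, <- IH by exact As.
    replace (zpow g s i) with (zpow g s (Z.pred i + 1)) by (f_equal; lia).
    rewrite zpow_succ by exact As.
    rewrite <- !(mmul_assoc _ (zpow g s (Z.pred i))).
    rewrite twist_reflection; reflexivity.
Qed.

Lemma zpow_reflection_square i : ap ** zpow g s i ** (ap ** zpow g s i) =m= ap ** ap.
Proof.
  assert (As := twist_AutG).
  rewrite (mmul_assoc g (ap ** zpow g s i)), <- (mmul_assoc g ap (zpow g s i) ap), zpow_reflection.
  rewrite <- !mmul_assoc, <- zpow_add by exact As.
  replace (- i + i)%Z with 0%Z by lia; rewrite zpow_0, mmul_1_r; reflexivity.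
Qed.

(** Conjugation by s^-i adds 2i to the exponent of each reflection ap s^a, so applied to both
    members it moves the pair by an even amount. *)
Lemma pair_rel_shift_even a b k i :
  pair_rel g ap am (ap ** zpow g s a) (ap ** zpow g s b) -> (k = a + 2 * i)%Z ->
  pair_rel g ap am (ap ** zpow g s k) (ap ** zpow g s (b + 2 * i)).
Proof.
  intros H ->; assert (As := twist_AutG).
  assert (Ai := AutG_zpow g s (- i) As).
  eapply pr_trans; [exact H|].
  eapply pr_trans; [apply (pair_rel_conj_same _ _ (zpow g s (- i)) Ai)|].
  assert (Einv : minv g (zpow g s (- i)) =m= zpow g s i).
  { apply minv_eq; [exact Ai|]; rewrite <- zpow_add by exact As.
    replace (i + - i)%Z with 0%Z by lia; reflexivity. }
  apply pr_eq; rewrite mmul_assoc, zpow_reflection, Einv, <- !mmul_assoc, <- !zpow_add by exact As.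
  - replace (- - i + (a + i))%Z with (a + 2 * i)%Z by lia; reflexivity.
  - replace (- - i + (b + i))%Z with (b + 2 * i)%Z by lia; reflexivity.
Qed.

(* The [ap s^k] are the reflections of the dihedral group generated by [ap] and [s], and [am = ap s^(-1)]. *)
Lemma pair_rel_shift k :
  pair_rel g ap am (ap ** zpow g s k) (ap ** zpow g s (k - 1)).
Proof.
  assert (As := twist_AutG).
  assert (E0 : ap ** zpow g s 0 =m= ap) by (rewrite zpow_0; apply mmul_1_r).
  assert (E1 : ap ** zpow g s (-1) =m= am).
  { apply mmul_cancel_r with (1 := As); rewrite <- mmul_assoc, <- zpow_succ by exact As.
    rewrite zpow_0, mmul_1_r; symmetry; exact Hs. }
  assert (R0 : pair_rel g ap am (ap ** zpow g s 0) (ap ** zpow g s (-1)))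
    by (apply pr_eq; symmetry; assumption).
  (* An odd shift needs the swap: conjugation by [ap] turns am = ap s^-1 into ap s and fixes
     [ap]. *)
  assert (R1 : pair_rel g ap am (ap ** zpow g s 1) (ap ** zpow g s 0)).
  { eapply pr_trans; [apply pr_swap|].
    eapply pr_trans; [apply (pair_rel_conj_same _ _ ap Hap)|].
    apply pr_eq.
    - rewrite <- E1; apply mmul_cancel_r with (1 := Hap).
      rewrite mul_minv_l by exact Hap; rewrite <- !mmul_assoc, zpow_reflection; reflexivity.
    - rewrite mul_minv_r, zpow_0, mmul_1_r by exact Hap; reflexivity. }
  destruct (Z.Even_or_Odd k) as [[i Hi]|[i Hi]].
  - replace (k - 1)%Z with (-1 + 2 * i)%Z by lia; apply (pair_rel_shift_even 0); [exact R0 | lia].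
  - replace (k - 1)%Z with (0 + 2 * i)%Z by lia; apply (pair_rel_shift_even 1); [exact R1 | lia].
Qed.

Lemma Phi_pair_in_L u : in_L g s u -> in_L g s (Phi_pair g ap u).
Proof.
  intros Lu; split.
  - apply (vsmooth_mapply g (fun _ => ap) (fun t => u (- t))); [apply msmooth_const|].
    apply (vsmooth_comp g u (fun t => - t) (proj1 Lu)), smooth_opp, smooth_id.
  - intros t; unfold Phi_pair.
    assert (E := proj2 Lu (- (t + 2 * PI))).
    replace (- (t + 2 * PI) + 2 * PI) with (- t) in E by ring.
    rewrite E, <- !mapply_mmul, twist_reflection; reflexivity.
Qed.

End DihedralShift.

Hypothesis simple_g : simple g.

Lemma quasiconj_pair_rel q ap am s ap' am' s' :
  inJq g q ap am -> inJq g q ap' am' -> am ** s =m= ap -> am' ** s' =m= ap' ->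
  quasiconj g s (Phi_pair g ap) s' (Phi_pair g ap') -> pair_rel g ap am ap' am'.
Proof.
  intros [Aap [Aam [Hsq _]]] [Aap' [Aam' [Hsq' _]]] Es Es' [psi [Hpsi Hint]].
  assert (As := twist_AutG ap am s Aap Aam Es).
  assert (As' := twist_AutG ap' am' s' Aap' Aam' Es').
  destruct (LIso_standard_form g simple_g s s' psi As As' Hpsi)
    as [th [Q [n [Sth [SQ [AQ [HQ [Hth Hn]]]]]]]].
  assert (LPhi := Phi_pair_in_L ap am s Aam Hsq Es).
  assert (Hmix : forall t u, in_L g s u -> Q t $ ap $ u (- th t) =v= ap' $ Q (- t) $ u (th (- t))).
  { intros t u Lu; assert (E := Hint u Lu t); rewrite (HQ _ (LPhi u Lu) t) in E.
    unfold Phi_pair in E; rewrite (HQ u Lu (- t)) in E; exact E. }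
  destruct (continuous_2PI_valued_const (fun t => th (- t) + th t)) as [m Hm].
  { apply smooth_continuity, smooth_plus; [|exact Sth].
    apply smooth_comp; [exact Sth | apply smooth_opp, smooth_id]. }
  { intros t.
    destruct (evaluation_point g simple_g s (Q t ** ap) (ap' ** Q (- t)) (- th t) (th (- t)) As) as [k Hk].
    - apply AutG_mul; [apply AQ | exact Aap].
    - intros u Lu; rewrite !mapply_mmul; apply Hmix, Lu.
    - exists (- k)%Z; rewrite opp_IZR; lra. }
  (* The intertwining relation stripped of the loop: u(th(-t)) and u(-th t) differ by the factor
     s^m. *)
  assert (K : forall t, Q t ** ap =m= ap' ** Q (- t) ** zpow g s m).
  { intros t; apply (evaluation_matrix g s _ _ (- th t) As); intros u Lu.
    rewrite !mapply_mmul, <- (in_L_Z g s u m _ As Lu).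
    replace (- th t + 2 * PI * IZR m) with (th (- t)) by (specialize (Hm t); lra).
    apply Hmix, Lu. }
  assert (Hper : forall t, Q (t + 2 * PI) ** zpow g s n =m= s' ** Q t).
  { intros t; apply (evaluation_matrix g s _ _ (th t) As); intros u Lu.
    rewrite !mapply_mmul, <- (in_L_Z g s u n _ As Lu), <- Hth, <- !HQ by exact Lu.
    apply (proj1 (proj1 Hpsi) u Lu). }
  (* Using [K] at t and then at -t makes the powers of [s] cancel. Hence every Q_t conjugates the
     common square of the first pair to that of the second. *)
  assert (Hcomm : forall t, Q t ** (ap ** ap) =m= ap' ** ap' ** Q t).
  { intros t; rewrite mmul_assoc, (K t), <- (mmul_assoc _ _ (zpow g s m) ap).
    rewrite (zpow_reflection ap am s) by assumption.
    rewrite <- (mmul_assoc g ap' (Q (- t))), (mmul_assoc g (Q (- t)) ap), (K (- t)), Ropp_involutive.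
    rewrite <- !mmul_assoc, <- zpow_add by exact As.
    replace (m + - m)%Z with 0%Z by lia; rewrite zpow_0, mmul_1_r; reflexivity. }
  (* The exponents are read off from [K] at 0 and at pi. The sign of [n] only decides in which order
     the two neighbouring reflections appear. *)
  set (x := ap ** zpow g s (- m)); set (y := ap ** zpow g s (- m - n)).
  assert (Hxy : pair_rel g ap am x y).
  { destruct Hn as [-> | ->].
    - apply (pair_rel_shift ap am s Aap Aam Hsq Es).
    - eapply pr_trans; [|apply pr_swap].
      unfold x, y; replace (- m - -1)%Z with (- m + 1)%Z by lia.
      assert (R := pair_rel_shift ap am s Aap Aam Hsq Es (- m + 1)).
      replace (- m + 1 - 1)%Z with (- m)%Z in R by lia; exact R. }
  assert (Ax : Q 0 ** x =m= ap' ** Q 0).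
  { unfold x; rewrite mmul_assoc, (K 0), Ropp_0, <- !mmul_assoc, <- zpow_add by exact As.
    replace (m + - m)%Z with 0%Z by lia; rewrite zpow_0, mmul_1_r; reflexivity. }
  (* At pi the relation [K] involves Q(-pi), which is tied to Q(pi) by equivariance; this is where
     [s'] enters and turns [ap'] into [am']. *)
  assert (Ay : Q PI ** y =m= am' ** Q PI).
  { unfold y; rewrite mmul_assoc, (K PI), <- !mmul_assoc, <- zpow_add by exact As.
    apply mmul_cancel_r with (1 := AutG_zpow g s n As).
    rewrite <- !mmul_assoc, <- zpow_add by exact As.
    replace (m + (- m - n) + n)%Z with 0%Z by lia; rewrite zpow_0, mmul_1_r.
    assert (E := Hper (- PI)); replace (- PI + 2 * PI) with PI in E by ring.
    rewrite E, mmul_assoc, Es'; reflexivity. }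
  eapply pr_trans; [exact Hxy|].
  eapply pr_trans.
  - apply (pr_conj g x y (Q 0) (minv g (Q 0)) (Q PI) (minv g (Q PI)));
      try apply AQ; try (apply minv_r, AQ); try (apply minv_l, AQ).
    exists (fun t => minv g (Q 0) ** Q (PI * t)); split; [|split; [|split]].
    + intros i j Hi Hj; apply smooth_continuity.
      apply (msmooth_mul g (fun _ => minv g (Q 0)) (fun t => Q (PI * t))); try assumption; [apply msmooth_const|].
      apply (msmooth_comp g Q (fun t => PI * t) SQ), smooth_scal, smooth_id.
    + rewrite Rmult_0_r; apply minv_l, AQ.
    + rewrite Rmult_1_r; reflexivity.
    + intros t _; split; [apply AutG_mul; [apply AutG_minv, AQ | apply AQ]|].
      assert (Exx : x ** x =m= ap ** ap) by (apply (zpow_reflection_square ap am s); assumption).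
      rewrite Exx; apply mmul_cancel_l with (1 := AQ 0).
      rewrite <- mmul_assoc, Hcomm, !mmul_assoc, minv_r, mmul_1_l, <- (mmul_assoc g (Q 0)), Hcomm by apply AQ.
      rewrite (mul_minv_r g (Q 0)) by apply AQ; reflexivity.
  - apply pr_eq; rewrite mmul_assoc.
    + rewrite Ax, mul_minv_r by apply AQ; reflexivity.
    + rewrite Ay, mul_minv_r by apply AQ; reflexivity.
Qed.

End Pairs.

(** * Powers of a matrix near the identity *)

Lemma ex_series_le_geom (a : nat -> R) c : (forall k, Rabs (a k) <= c * (/ 4) ^ k) ->
  ex_series (fun k => Rabs (a k)) /\ ex_series a.
Proof.
  intros H.
  assert (E : ex_series (fun k => Rabs (a k))).
  { apply @ex_series_le with (b := fun k => c * (/ 4) ^ k).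
    - intros k; unfold norm; simpl; unfold abs; simpl; rewrite Rabs_Rabsolu; apply H.
    - apply (ex_series_scal_l c (fun k => (/ 4) ^ k)), ex_series_geom; rewrite Rabs_pos_eq; lra. }
  split; [exact E | apply ex_series_Rabs, E].
Qed.

Lemma Series_le_geom (a : nat -> R) c : 0 <= c -> (forall k, Rabs (a k) <= c * (/ 4) ^ k) ->
  Rabs (Series a) <= 2 * c.
Proof.
  intros Hc H; destruct (ex_series_le_geom a c H) as [E1 E2].
  apply Rle_trans with (1 := Series_Rabs a E1).
  apply Rle_trans with (Series (fun k => c * (/ 4) ^ k)).
  - apply Series_le; [intros k; split; [apply Rabs_pos | apply H]|].
    apply (ex_series_scal_l c (fun k => (/ 4) ^ k)), ex_series_geom; rewrite Rabs_pos_eq; lra.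
  - rewrite Series_scal_l, Series_geom by (rewrite Rabs_pos_eq; lra); lra.
Qed.

Lemma is_series_rsum n (F : nat -> nat -> R) (l : nat -> R) :
  (forall i, (i < n)%nat -> is_series (F i) (l i)) ->
  is_series (fun k => rsum n (fun i => F i k)) (rsum n l).
Proof.
  induction n as [|n IH]; intros H; simpl.
  - assert (E : ex_series (fun k => 0 * (/ 4) ^ k)).
    { apply (ex_series_scal_l 0 (fun k => (/ 4) ^ k)), ex_series_geom; rewrite Rabs_pos_eq; lra. }
    apply Series_correct in E; rewrite Series_scal_l, Rmult_0_l in E.
    apply is_series_ext with (2 := E); intros k; apply Rmult_0_l.
  - apply (is_series_plus (fun k => rsum n (fun i => F i k)) (F n)); [apply IH|]; intros; apply H; lia.
Qed.

Lemma rsum_sum_f_R0_swap n m (F : nat -> nat -> R) :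
  rsum n (fun i => sum_f_R0 (F i) m) = sum_f_R0 (fun k => rsum n (fun i => F i k)) m.
Proof.
  induction m as [|m IH]; simpl; [reflexivity|].
  rewrite <- IH, <- rsum_plus; reflexivity.
Qed.

(** The generalised binomial coefficient t (t - 1) ... (t - k + 1) / k!. *)
Fixpoint gbinom (t : R) (k : nat) : R :=
  match k with O => 1 | S k' => gbinom t k' * (t - INR k') / INR (S k') end.

Lemma gbinom_S t k : INR (S k) * gbinom t (S k) = (t - INR k) * gbinom t k.
Proof.
  change (gbinom t (S k)) with (gbinom t k * (t - INR k) / INR (S k)).
  field; apply not_0_INR; lia.
Qed.

Lemma gbinom_bound t k : Rabs t <= 2 -> Rabs (gbinom t k) <= 2 ^ k.
Proof.
  intros Ht; induction k as [|k IH]; [simpl; rewrite Rabs_R1; lra|].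
  change (gbinom t (S k)) with (gbinom t k * (t - INR k) / INR (S k)).
  assert (Hk := pos_INR k).
  assert (HS : 0 < INR (S k)) by (rewrite S_INR; lra).
  unfold Rdiv; rewrite !Rabs_mult, (Rabs_inv (INR (S k))), (Rabs_pos_eq (INR (S k))) by lra.
  apply Rmult_le_reg_r with (INR (S k)); [exact HS|].
  rewrite Rmult_assoc, Rinv_l, Rmult_1_r by lra; simpl pow.
  assert (Rabs (t - INR k) <= 2 * INR (S k)).
  { rewrite S_INR; apply Rle_trans with (1 := Rabs_triang _ _).
    rewrite Rabs_Ropp, (Rabs_pos_eq (INR k)); lra. }
  assert (0 <= Rabs (gbinom t k)) by apply Rabs_pos.
  assert (0 <= Rabs (t - INR k)) by apply Rabs_pos.
  nra.
Qed.

Lemma gbinom_0 k : gbinom 0 (S k) = 0.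
Proof.
  induction k as [|k IH]; [simpl; field|].
  change (gbinom 0 (S (S k))) with (gbinom 0 (S k) * (0 - INR (S k)) / INR (S (S k))).
  rewrite IH; unfold Rdiv; ring.
Qed.

Lemma gbinom_1 k : gbinom 1 (S (S k)) = 0.
Proof.
  induction k as [|k IH]; [simpl; field|].
  change (gbinom 1 (S (S (S k)))) with (gbinom 1 (S (S k)) * (1 - INR (S (S k))) / INR (S (S (S k)))).
  rewrite IH; unfold Rdiv; ring.
Qed.

(** Multiply by k + 1, split it as j + (k + 1 - j), and apply [gbinom_S] to the matching factor. The
    two sums combine with the weight (s - j) + (t - (k - j)) = s + t - k. *)
Lemma gbinom_vandermonde s t k :
  sum_f_R0 (fun j => gbinom s j * gbinom t (k - j)) k = gbinom (s + t) k.
Proof.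
  induction k as [|k IH]; [simpl; ring|].
  assert (HS : INR (S k) <> 0) by (apply not_0_INR; lia).
  apply Rmult_eq_reg_l with (2 := HS); rewrite gbinom_S, <- IH.
  transitivity (sum_f_R0 (fun j => INR j * gbinom s j * gbinom t (S k - j)) (S k)
    + sum_f_R0 (fun j => gbinom s j * (INR (S k - j) * gbinom t (S k - j))) (S k)).
  - rewrite scal_sum, <- sum_plus; apply sum_eq; intros j Hj.
    rewrite minus_INR by exact Hj; ring.
  - rewrite (decomp_sum (fun j => INR j * gbinom s j * gbinom t (S k - j))) by lia.
    rewrite (tech5 (fun j => gbinom s j * (INR (S k - j) * gbinom t (S k - j)))).
    rewrite Nat.sub_diag; simpl (INR 0); simpl Init.Nat.pred.
    rewrite Rmult_0_l, Rmult_0_l, Rmult_0_l, Rmult_0_r, Rplus_0_l, Rplus_0_r.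
    rewrite <- sum_plus, scal_sum; apply sum_eq; intros j Hj.
    rewrite gbinom_S; replace (S k - j)%nat with (S (k - j)) by lia.
    rewrite gbinom_S, minus_INR by exact Hj; simpl (S k - S j)%nat; ring.
Qed.

(* The Taylor coefficients of [ln (1 + z)], i.e. the derivatives at [t = 0] of [gbinom t k]. *)
Fixpoint logcoef (k : nat) : R :=
  match k with O => 0 | S O => 1 | S k' => - INR k' / INR (S k') * logcoef k' end.

Lemma logcoef_SS k : logcoef (S (S k)) = - INR (S k) / INR (S (S k)) * logcoef (S k).
Proof. reflexivity. Qed.

Lemma logcoef_bound1 k : Rabs (logcoef (S k)) <= 1.
Proof.
  induction k as [|k IH]; [simpl; rewrite Rabs_R1; lra|].
  rewrite logcoef_SS, Rabs_mult.
  assert (Hk := pos_INR (S k)).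
  assert (H : Rabs (- INR (S k) / INR (S (S k))) <= 1).
  { unfold Rdiv; rewrite Rabs_mult, Rabs_Ropp, Rabs_inv, !Rabs_pos_eq by apply pos_INR.
    rewrite (S_INR (S k)); apply Rmult_le_reg_r with (INR (S k) + 1); [lra|].
    rewrite Rmult_assoc, Rinv_l by lra; lra. }
  rewrite <- (Rmult_1_r 1); apply Rmult_le_compat; try apply Rabs_pos; assumption.
Qed.

Lemma logcoef_bound k : Rabs (logcoef k) <= 2 ^ k.
Proof.
  destruct k as [|k]; [simpl; rewrite Rabs_R0; lra|].
  apply Rle_trans with (1 := logcoef_bound1 k), pow_R1_Rle; lra.
Qed.

(** A second-order Taylor remainder at t = 0 whose growth in [k] is still summable against powers of
    a small matrix. The derivative of the power at 0 then follows by comparing series term by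
    term. *)
Lemma gbinom_logcoef t k : Rabs t <= 1 ->
  Rabs (gbinom t k - gbinom 0 k - t * logcoef k) <= t * t * 2 ^ k.
Proof.
  intros Ht; assert (Hsq : 0 <= t * t) by nra.
  destruct k as [|k]; [simpl; replace (1 - 1 - t * 0) with 0 by ring; rewrite Rabs_R0; lra|].
  rewrite gbinom_0, Rminus_0_r.
  induction k as [|k IH].
  - simpl; replace (1 * (t - 0) / 1 - t * 1) with 0 by field; rewrite Rabs_R0; lra.
  - rewrite logcoef_SS; change (gbinom t (S (S k))) with (gbinom t (S k) * (t - INR (S k)) / INR (S (S k))).
    set (b := gbinom t (S k)) in *; set (l := logcoef (S k)) in *.
    assert (Hl : Rabs l <= 1) by apply logcoef_bound1.
    assert (Hk : 1 <= INR (S k)) by (apply (le_INR 1); lia).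
    set (m := INR (S k)) in *; assert (HS : INR (S (S k)) = m + 1) by apply S_INR; rewrite HS.
    (* The remainder for k + 1 is the old one times (t - m)/(m + 1), a factor of size at most 1,
       plus a term of size at most t^2. *)
    replace (b * (t - m) / (m + 1) - t * (- m / (m + 1) * l))
      with (((b - t * l) * (t - m) + t * t * l) / (m + 1)) by (field; lra).
    unfold Rdiv; rewrite Rabs_mult, Rabs_inv, (Rabs_pos_eq (m + 1)) by lra.
    apply Rmult_le_reg_r with (m + 1); [lra|]; rewrite Rmult_assoc, Rinv_l, Rmult_1_r by lra.
    apply Rle_trans with (1 := Rabs_triang _ _); rewrite !Rabs_mult.
    assert (H1 : Rabs (t - m) <= m + 1).
    { apply Rle_trans with (1 := Rabs_triang _ _); rewrite Rabs_Ropp, (Rabs_pos_eq m) by lra; lra. }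
    assert (H2 : 1 <= 2 ^ S k) by (apply pow_R1_Rle; lra).
    change (2 ^ S (S k)) with (2 * 2 ^ S k); set (p := 2 ^ S k) in *.
    assert (H3 : Rabs (b - t * l) * Rabs (t - m) <= t * t * p * (m + 1)).
    { apply Rmult_le_compat; try apply Rabs_pos; assumption. }
    assert (H4 : Rabs t * Rabs t * Rabs l <= t * t * 1).
    { rewrite <- Rabs_mult, (Rabs_pos_eq (t * t)) by exact Hsq; apply Rmult_le_compat_l; assumption. }
    assert (H5 : t * t * 1 <= t * t * (p * (m + 1))) by (apply Rmult_le_compat_l; [exact Hsq | nra]).
    lra.
Qed.

Section MatrixPower.
Variable g : LieData.
Let N := dim g.

Notation "A =m= B" := (meq g A B) (at level 70).
Notation "v =v= w" := (veq g v w) (at level 70).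
Notation "A ** B" := (mmul g A B) (at level 40, left associativity).
Notation "A $ v" := (mapply g A v) (at level 45, right associativity).

Variables (D : mat) (dl : R).
Hypothesis HD : forall i j, (i < N)%nat -> (j < N)%nat -> Rabs (D i j) <= dl.
Hypothesis Hdl : 0 <= dl.
(** [INR N * dl] bounds the entries of D^k by its k-th power. Against coefficients growing like 2^k,
    the bound 1/8 leaves a geometric series of ratio 1/4. *)
Hypothesis Hsmall : INR N * dl <= / 8.

Lemma mpow_bound k i j : (i < N)%nat -> (j < N)%nat -> Rabs (mpow g D k i j) <= (INR N * dl) ^ k.
Proof.
  revert i j; induction k as [|k IH]; intros i j Hi Hj.
  - simpl; unfold mid; destruct (Nat.eqb i j); rewrite ?Rabs_R1, ?Rabs_R0; lra.
  - simpl mpow; unfold mmul; simpl pow; rewrite Rmult_assoc.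
    apply rsum_Rabs_le; intros l Hl; rewrite Rabs_mult.
    apply Rmult_le_compat; try apply Rabs_pos; [apply HD | apply IH]; assumption.
Qed.

Definition mseries (a : nat -> R) : mat := fun i j => Series (fun k => a k * mpow g D k i j).

Lemma mseries_term a c k i j : (i < N)%nat -> (j < N)%nat -> (forall k, Rabs (a k) <= c * 2 ^ k) ->
  Rabs (a k * mpow g D k i j) <= c * (/ 4) ^ k.
Proof.
  intros Hi Hj Ha; rewrite Rabs_mult.
  replace (/ 4) with (2 * / 8) by field; rewrite Rpow_mult_distr, <- Rmult_assoc.
  apply Rmult_le_compat; try apply Rabs_pos; [apply Ha|].
  apply Rle_trans with (1 := mpow_bound k i j Hi Hj).
  apply pow_incr; split; [apply Rmult_le_pos; [apply pos_INR | exact Hdl] | exact Hsmall].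
Qed.

Lemma mseries_ex a c i j : (i < N)%nat -> (j < N)%nat -> (forall k, Rabs (a k) <= c * 2 ^ k) ->
  ex_series (fun k => Rabs (a k * mpow g D k i j)) /\ ex_series (fun k => a k * mpow g D k i j).
Proof.
  intros Hi Hj Ha; apply ex_series_le_geom with c; intros k; apply mseries_term; assumption.
Qed.

Lemma mseries_is a c i j : (i < N)%nat -> (j < N)%nat -> (forall k, Rabs (a k) <= c * 2 ^ k) ->
  is_series (fun k => a k * mpow g D k i j) (mseries a i j).
Proof. intros; apply Series_correct, (mseries_ex a c i j); assumption. Qed.

Lemma mseries_commute a c C : (forall k, Rabs (a k) <= c * 2 ^ k) -> C ** D =m= D ** C ->
  C ** mseries a =m= mseries a ** C.
Proof.
  intros Ha HC.
  assert (Hk : forall k, C ** mpow g D k =m= mpow g D k ** C).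
  { induction k as [|k IH]; simpl; [rewrite mmul_1_l, mmul_1_r; reflexivity|].
    rewrite mmul_assoc, HC, <- mmul_assoc, IH, mmul_assoc; reflexivity. }
  intros i j Hi Hj.
  assert (H1 : is_series (fun k => a k * (C ** mpow g D k) i j) ((C ** mseries a) i j)).
  { unfold mmul at 2; eapply is_series_ext; [|apply is_series_rsum with
      (F := fun l k => C i l * (a k * mpow g D k l j))].
    - intros k; cbv beta; unfold mmul; rewrite <- rsum_scal; apply rsum_ext; intros; ring.
    - intros l Hl; apply (is_series_scal_l (C i l) (fun k => a k * mpow g D k l j)).
      apply mseries_is with c; assumption. }
  assert (H2 : is_series (fun k => a k * (C ** mpow g D k) i j) ((mseries a ** C) i j)).
  { unfold mmul at 2; eapply is_series_ext; [|apply is_series_rsum with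
      (F := fun l k => C l j * (a k * mpow g D k i l))].
    - intros k; cbv beta; rewrite (Hk k i j Hi Hj); unfold mmul; rewrite <- rsum_scal; apply rsum_ext; intros; ring.
    - intros l Hl; rewrite (Rmult_comm (mseries a i l)).
      apply (is_series_scal_l (C l j) (fun k => a k * mpow g D k i l)).
      apply mseries_is with c; assumption. }
  rewrite <- (is_series_unique _ _ H1); apply is_series_unique, H2.
Qed.

(* [mpower t] is the power [(1 + D)^t] and [mlog] the logarithm of [1 + D]. *)
Definition mpower (t : R) : mat := mseries (gbinom t).
Definition mlog : mat := mseries logcoef.

Lemma gbinom_bound1 t : Rabs t <= 2 -> forall k, Rabs (gbinom t k) <= 1 * 2 ^ k.
Proof. intros Ht k; rewrite Rmult_1_l; apply gbinom_bound, Ht. Qed.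

Lemma logcoef_bound2 : forall k, Rabs (logcoef k) <= 1 * 2 ^ k.
Proof. intros k; rewrite Rmult_1_l; apply logcoef_bound. Qed.

Lemma mpower_0 : mpower 0 =m= mid.
Proof.
  intros i j Hi Hj; unfold mpower, mseries.
  rewrite Series_incr_1.
  - simpl (gbinom 0 0); simpl (mpow g D 0).
    rewrite (Series_ext _ (fun k => 0 * (/ 4) ^ k)) by (intros k; rewrite gbinom_0; ring).
    rewrite Series_scal_l; ring.
  - apply (mseries_ex _ 1); try assumption; apply gbinom_bound1; rewrite Rabs_R0; lra.
Qed.

Lemma mpower_1 i j : (i < N)%nat -> (j < N)%nat -> mpower 1 i j = mid i j + D i j.
Proof.
  intros Hi Hj; unfold mpower, mseries.
  assert (E : ex_series (fun k => gbinom 1 k * mpow g D k i j)).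
  { apply (mseries_ex _ 1); try assumption; apply gbinom_bound1; rewrite Rabs_R1; lra. }
  rewrite Series_incr_1 by exact E.
  rewrite Series_incr_1 by (apply (proj1 (ex_series_incr_1 (fun k => gbinom 1 k * mpow g D k i j)) E)).
  rewrite (Series_ext _ (fun k => 0 * (/ 4) ^ k)) by (intros k; rewrite gbinom_1; ring).
  rewrite Series_scal_l; simpl mpow; rewrite (mmul_1_r g D i j Hi Hj); simpl; field.
Qed.

(** Cauchy product of two absolutely convergent series, with the coefficients collected by the
    Vandermonde identity. *)
Lemma mpower_add s t : Rabs s <= 2 -> Rabs t <= 2 -> mpower s ** mpower t =m= mpower (s + t).
Proof.
  intros Hs Ht i j Hi Hj; symmetry; apply is_series_unique.
  unfold mmul; eapply is_series_ext; [|apply is_series_rsum with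
    (F := fun l n => sum_f_R0 (fun k => (gbinom s k * mpow g D k i l) *
                                        (gbinom t (n - k) * mpow g D (n - k) l j)) n)].
  - intros n; cbv beta; rewrite rsum_sum_f_R0_swap, <- gbinom_vandermonde, Rmult_comm, scal_sum.
    apply sum_eq; intros k Hk.
    transitivity (gbinom s k * gbinom t (n - k) * (mpow g D k ** mpow g D (n - k)) i j).
    + unfold mmul; rewrite <- rsum_scal; apply rsum_ext; intros; ring.
    + rewrite <- (mpow_add g D k (n - k) i j Hi Hj); do 3 f_equal; lia.
  - intros l Hl; apply (is_series_mult (fun k => gbinom s k * mpow g D k i l) (fun k => gbinom t k * mpow g D k l j)).
    + apply mseries_is with 1; try assumption; apply gbinom_bound1, Hs.
    + apply mseries_is with 1; try assumption; apply gbinom_bound1, Ht.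
    + apply (mseries_ex _ 1); try assumption; apply gbinom_bound1, Hs.
    + apply (mseries_ex _ 1); try assumption; apply gbinom_bound1, Ht.
Qed.

Lemma mpower_inverse t : Rabs t <= 2 -> inverse_of g (mpower t) (mpower (- t)).
Proof.
  intros Ht; split; rewrite mpower_add by (rewrite ?Rabs_Ropp; assumption).
  - rewrite Rplus_opp_r; apply mpower_0.
  - rewrite Rplus_opp_l; apply mpower_0.
Qed.

Lemma mpower_first_order t i j : (i < N)%nat -> (j < N)%nat -> Rabs t <= 1 ->
  Rabs (mpower t i j - mid i j - t * mlog i j) <= 2 * (t * t).
Proof.
  intros Hi Hj Ht; rewrite <- (mpower_0 i j Hi Hj).
  assert (E0 : ex_series (fun k => gbinom 0 k * mpow g D k i j))
    by (apply (mseries_ex _ 1); try assumption; apply gbinom_bound1; rewrite Rabs_R0; lra).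
  assert (Et : ex_series (fun k => gbinom t k * mpow g D k i j))
    by (apply (mseries_ex _ 1); try assumption; apply gbinom_bound1; lra).
  assert (El : ex_series (fun k => logcoef k * mpow g D k i j))
    by (apply (mseries_ex _ 1); try assumption; apply logcoef_bound2).
  unfold mpower, mlog, mseries; rewrite <- Series_scal_l, <- !Series_minus.
  - rewrite (Series_ext _ (fun k => (gbinom t k - gbinom 0 k - t * logcoef k) * mpow g D k i j))
      by (intros; ring).
    apply Series_le_geom; [nra|]; intros k; apply (mseries_term (fun k => gbinom t k - gbinom 0 k - t * logcoef k)); try assumption.
    intros m; apply gbinom_logcoef, Ht.
  - apply (ex_series_minus _ _ Et E0).
  - apply (ex_series_scal_l t _ El).
  - exact Et.
  - exact E0.
Qed.

Lemma mpower_near_1 t i j : (i < N)%nat -> (j < N)%nat -> Rabs t <= 2 ->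
  Rabs (mpower t i j - mid i j) <= 4 * (INR N * dl).
Proof.
  intros Hi Hj Ht; unfold mpower, mseries.
  assert (E : ex_series (fun k => gbinom t k * mpow g D k i j))
    by (apply (mseries_ex _ 1); try assumption; apply gbinom_bound1, Ht).
  rewrite Series_incr_1 by exact E.
  simpl (gbinom t 0); simpl (mpow g D 0); rewrite Rmult_1_l.
  replace (mid i j + Series (fun k => gbinom t (S k) * mpow g D (S k) i j) - mid i j)
    with (Series (fun k => gbinom t (S k) * mpow g D (S k) i j)) by ring.
  assert (Hr : 0 <= INR N * dl) by (apply Rmult_le_pos; [apply pos_INR | exact Hdl]).
  replace (4 * (INR N * dl)) with (2 * (2 * (INR N * dl))) by ring.
  apply Series_le_geom; [lra|]; intros k; rewrite Rabs_mult.
  apply Rle_trans with (2 ^ S k * (INR N * dl) ^ S k).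
  - apply Rmult_le_compat; try apply Rabs_pos; [apply gbinom_bound, Ht | apply mpow_bound; assumption].
  - rewrite <- Rpow_mult_distr; simpl pow; apply Rmult_le_compat_l; [lra|].
    apply pow_incr; lra.
Qed.

Lemma mpower_mlog_commute t : Rabs t <= 2 -> mpower t ** mlog =m= mlog ** mpower t.
Proof.
  intros Ht; apply mseries_commute with 1; [apply logcoef_bound2|].
  symmetry; apply mseries_commute with 1; [apply gbinom_bound1, Ht | reflexivity].
Qed.

(** The group law writes the power at [r] as the power at [t] times the power at r - t, so only the
    derivative at 0 is needed. Commutation then moves the logarithm to the left. *)
Lemma mpower_derivative t i j : (i < N)%nat -> (j < N)%nat -> Rabs t <= 1 ->
  derivable_pt_lim (fun t => mpower t i j) t ((mlog ** mpower t) i j).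
Proof.
  intros Hi Hj Ht.
  assert (D0 : forall l, (l < N)%nat -> derivable_pt_lim (fun h => mpower h l j) 0 (mlog l j)).
  { intros l Hl eps Heps.
    assert (Hm : 0 < Rmin 1 (eps / 2)) by (apply Rmin_pos; lra).
    exists (mkposreal _ Hm); simpl; intros h Hh0 Hh.
    assert (H1 := Rmin_l 1 (eps / 2)); assert (H2 := Rmin_r 1 (eps / 2)).
    rewrite Rplus_0_l, (mpower_0 l j Hl Hj).
    replace ((mpower h l j - mid l j) / h - mlog l j) with ((mpower h l j - mid l j - h * mlog l j) / h)
      by (field; exact Hh0).
    unfold Rdiv; rewrite Rabs_mult, Rabs_inv.
    assert (Hp : 0 < Rabs h) by (apply Rabs_pos_lt, Hh0).
    apply Rmult_lt_reg_r with (1 := Hp); rewrite Rmult_assoc, Rinv_l, Rmult_1_r by lra.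
    apply Rle_lt_trans with (1 := mpower_first_order h l j Hl Hj ltac:(lra)).
    replace (h * h) with (Rabs h * Rabs h) by (rewrite <- Rabs_mult; apply Rabs_pos_eq; nra).
    nra. }
  rewrite <- (mpower_mlog_commute t ltac:(lra) i j Hi Hj).
  apply derivable_pt_lim_ext_loc with (f := fun r => (mpower t ** mpower (r - t)) i j) (d := 1); [lra| |].
  - intros r Hr; rewrite (mpower_add t (r - t) ltac:(lra) ltac:(lra) i j Hi Hj).
    f_equal; ring.
  - unfold mmul; apply (rsum_derivable N (fun l r => mpower t i l * mpower (r - t) l j)
      (fun l r => mpower t i l * mlog l j)).
    intros l Hl; apply (derivable_pt_lim_scal (fun r => mpower (r - t) l j)).
    rewrite <- (Rmult_1_r (mlog l j)).
    apply (derivable_pt_lim_comp (fun r => r - t) (fun h => mpower h l j)).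
    + apply derivable_pt_lim_eq with (1 - 0); [|ring].
      apply (derivable_pt_lim_minus (fun r => r) (fun _ => t)); [apply derivable_pt_lim_id | apply derivable_pt_lim_const].
    + rewrite Rminus_diag; apply D0, Hl.
Qed.

End MatrixPower.

(** * Automorphisms near the identity *)

Section Derivatives.
Variable g : LieData.
Let N := dim g.

Notation "A =m= B" := (meq g A B) (at level 70).
Notation "v =v= w" := (veq g v w) (at level 70).
Notation "A ** B" := (mmul g A B) (at level 40, left associativity).
Notation "A $ v" := (mapply g A v) (at level 45, right associativity).

Definition vderiv (v : R -> vec) (t : R) (dv : vec) : Prop :=
  forall i, (i < N)%nat -> derivable_pt_lim (fun t => v t i) t (dv i).

Definition mderiv (P : R -> mat) (t : R) (dP : mat) : Prop :=
  forall i j, (i < N)%nat -> (j < N)%nat -> derivable_pt_lim (fun t => P t i j) t (dP i j).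

Lemma vderiv_eq v t dv dv' : vderiv v t dv -> dv =v= dv' -> vderiv v t dv'.
Proof. intros H E i Hi; apply derivable_pt_lim_eq with (1 := H i Hi), E, Hi. Qed.

Lemma vderiv_const v t : vderiv (fun _ => v) t vzero.
Proof. intros i _; apply derivable_pt_lim_const. Qed.

Lemma vderiv_mapply P v t dP dv : mderiv P t dP -> vderiv v t dv ->
  vderiv (fun t => P t $ v t) t (vadd (dP $ v t) (P t $ dv)).
Proof.
  intros HP Hv i Hi; unfold mapply, vadd; rewrite <- rsum_plus.
  apply (rsum_derivable _ (fun j t => P t i j * v t j) (fun j _ => dP i j * v t j + P t i j * dv j)).
  intros j Hj; apply (derivable_pt_lim_mult (fun t => P t i j) (fun t => v t j)); [apply HP | apply Hv]; assumption.
Qed.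

Lemma vderiv_br v w t dv dw : vderiv v t dv -> vderiv w t dw ->
  vderiv (fun t => br g (v t) (w t)) t (vadd (br g dv (w t)) (br g (v t) dw)).
Proof.
  intros Hv Hw k Hk; unfold br, vadd; rewrite <- rsum_plus.
  apply (rsum_derivable _ (fun i t => rsum N (fun j => sc g i j k * v t i * w t j))
    (fun i _ => rsum N (fun j => sc g i j k * dv i * w t j) + rsum N (fun j => sc g i j k * v t i * dw j))).
  intros i Hi; rewrite <- rsum_plus.
  apply (rsum_derivable _ (fun j t => sc g i j k * v t i * w t j)
    (fun j _ => sc g i j k * dv i * w t j + sc g i j k * v t i * dw j)).
  intros j Hj; apply (derivable_pt_lim_mult (fun t => sc g i j k * v t i) (fun t => w t j)).
  - apply (derivable_pt_lim_scal (fun t => v t i)), Hv, Hi.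
  - apply Hw, Hj.
Qed.

End Derivatives.

Lemma prod3_close x y z x0 y0 z0 e : 0 <= e <= 1 -> Rabs x0 <= 1 -> Rabs y0 <= 1 -> Rabs z0 <= 1 ->
  Rabs (x - x0) <= e -> Rabs (y - y0) <= e -> Rabs (z - z0) <= e ->
  Rabs (x * y * z - x0 * y0 * z0) <= 7 * e.
Proof.
  intros He Hx0 Hy0 Hz0 Hx Hy Hz.
  assert (Bd : forall a a0, Rabs a0 <= 1 -> Rabs (a - a0) <= e -> Rabs a <= 2).
  { intros a a0 H0 Ha; replace a with ((a - a0) + a0) by ring.
    apply Rle_trans with (1 := Rabs_triang _ _); lra. }
  assert (By := Bd y y0 Hy0 Hy); assert (Bz := Bd z z0 Hz0 Hz).
  (* The perturbed factors are bounded by 2, so the three terms contribute 4e, 2e and e. *)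
  replace (x * y * z - x0 * y0 * z0)
    with ((x - x0) * (y * z) + (x0 * (y - y0) * z + x0 * y0 * (z - z0))) by ring.
  assert (P := Rabs_pos).
  apply Rle_trans with (e * (2 * 2) + (1 * e * 2 + 1 * 1 * e)); [|lra].
  apply Rle_trans with (1 := Rabs_triang _ _); apply Rplus_le_compat.
  - rewrite !Rabs_mult; repeat (apply Rmult_le_compat; auto); apply Rmult_le_pos; apply P.
  - apply Rle_trans with (1 := Rabs_triang _ _); apply Rplus_le_compat; rewrite !Rabs_mult.
    + apply Rmult_le_compat; auto; [apply Rmult_le_pos; apply P|]; apply Rmult_le_compat; auto.
    + apply Rmult_le_compat; auto; [apply Rmult_le_pos; apply P|]; apply Rmult_le_compat; auto.
Qed.

Section NearIdentity.
Variable g : LieData.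
Let N := dim g.

Notation "A =m= B" := (meq g A B) (at level 70).
Notation "v =v= w" := (veq g v w) (at level 70).
Notation "A ** B" := (mmul g A B) (at level 40, left associativity).
Notation "A $ v" := (mapply g A v) (at level 45, right associativity).

Definition derivation_defect (X : mat) (x y : vec) : vec :=
  fun k => (X $ br g x y) k - br g (X $ x) y k - br g x (X $ y) k.

(** The structure tensor of the bilinear defect; it vanishes when [X] is a derivation, and being
    finite it can be estimated entry by entry. *)
Definition defect_coef (X : mat) (a b k : nat) : R :=
  rsum N (fun l => X k l * sc g a b l) - rsum N (fun i => sc g i b k * X i a) - rsum N (fun j => sc g a j k * X j b).

Lemma derivation_defect_expand X x y k :
  derivation_defect X x y k = rsum N (fun a => rsum N (fun b => defect_coef X a b k * x a * y b)).
Proof.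
  assert (E1 : (X $ br g x y) k
    = rsum N (fun a => rsum N (fun b => rsum N (fun l => X k l * sc g a b l) * x a * y b))).
  { unfold mapply, br.
    transitivity (rsum N (fun l => rsum N (fun a => rsum N (fun b => X k l * sc g a b l * x a * y b)))).
    - apply rsum_ext; intros l Hl; rewrite <- rsum_scal; apply rsum_ext; intros a Ha.
      rewrite <- rsum_scal; apply rsum_ext; intros b Hb; ring.
    - rewrite rsum_swap; apply rsum_ext; intros a Ha; rewrite rsum_swap; apply rsum_ext; intros b Hb.
      rewrite <- !rsum_scal_r; reflexivity. }
  assert (E2 : br g (X $ x) y k
    = rsum N (fun a => rsum N (fun b => rsum N (fun i => sc g i b k * X i a) * x a * y b))).
  { unfold mapply, br.
    transitivity (rsum N (fun i => rsum N (fun a => rsum N (fun b => sc g i b k * X i a * x a * y b)))).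
    - apply rsum_ext; intros i Hi; rewrite rsum_swap; apply rsum_ext; intros b Hb.
      rewrite <- rsum_scal, <- rsum_scal_r; apply rsum_ext; intros a Ha; ring.
    - rewrite rsum_swap; apply rsum_ext; intros a Ha; rewrite rsum_swap; apply rsum_ext; intros b Hb.
      rewrite <- !rsum_scal_r; reflexivity. }
  assert (E3 : br g x (X $ y) k
    = rsum N (fun a => rsum N (fun b => rsum N (fun j => sc g a j k * X j b) * x a * y b))).
  { unfold mapply, br; apply rsum_ext; intros a Ha.
    transitivity (rsum N (fun j => rsum N (fun b => sc g a j k * X j b * x a * y b))).
    - apply rsum_ext; intros j Hj; rewrite <- rsum_scal; apply rsum_ext; intros b Hb; ring.
    - rewrite rsum_swap; apply rsum_ext; intros b Hb; rewrite <- !rsum_scal_r; reflexivity. }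
  unfold derivation_defect; rewrite E1, E2, E3.
  rewrite <- !rsum_minus; apply rsum_ext; intros a Ha.
  rewrite <- !rsum_minus; apply rsum_ext; intros b Hb.
  unfold defect_coef; ring.
Qed.

Lemma mid_bound i j : Rabs (mid i j) <= 1.
Proof. unfold mid; destruct (Nat.eqb i j); rewrite ?Rabs_R1, ?Rabs_R0; lra. Qed.

Section Small.
Variables (A : mat) (dl : R).
Hypothesis HA : AutG g A.
Hypothesis Hdl : 0 <= dl.
Hypothesis Hclose : forall i j, (i < N)%nat -> (j < N)%nat -> Rabs (A i j - mid i j) <= dl.
Hypothesis Hsmall : INR N * dl <= / 8.
(** [INR N] cubed counts the terms of a triple sum, 7 comes from [prod3_close], and 4 N dl is the
    distance of the powers from the identity in [mpower_near_1]. *)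
Hypothesis Hsmall3 : INR N * (INR N * (INR N * (7 * (4 * (INR N * dl))))) < 1.

Let D : mat := fun i j => A i j - mid i j.
Let P := mpower g D.
Let X := mlog g D.

Lemma mpower_at_1 : P 1 =m= A.
Proof. intros i j Hi Hj; unfold P; rewrite (mpower_1 g D dl Hclose Hdl Hsmall i j Hi Hj); unfold D; ring. Qed.

Lemma mpower_small_inverse t : Rabs t <= 2 -> inverse_of g (P t) (P (- t)).
Proof. apply mpower_inverse with dl; assumption. Qed.

Lemma mpower_mderiv t : Rabs t <= 1 -> mderiv g P t (X ** P t).
Proof. intros Ht i j Hi Hj; apply (mpower_derivative g D dl); assumption. Qed.

Lemma mpower_opp_mderiv t : Rabs t <= 1 -> mderiv g (fun t => P (- t)) t (fun i j => - (X ** P (- t)) i j).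
Proof.
  intros Ht i j Hi Hj.
  apply derivable_pt_lim_eq with ((X ** P (- t)) i j * (- 1)); [|ring].
  apply (derivable_pt_lim_comp (fun t => - t) (fun t => P t i j)).
  - apply (derivable_pt_lim_opp (fun t => t)), derivable_pt_lim_id.
  - apply mpower_mderiv; try assumption; rewrite Rabs_Ropp; exact Ht.
Qed.

(** The logarithm commutes with its powers, so P(-t) factors out of all three terms of the product
    rule and leaves the derivation defect of [X]. *)
Lemma pulled_back_bracket_deriv x y t : Rabs t <= 1 ->
  vderiv g (fun t => P (- t) $ br g (P t $ x) (P t $ y)) t
    (vscal (-1) (P (- t) $ derivation_defect X (P t $ x) (P t $ y))).
Proof.
  intros Ht.
  assert (Dv : forall z, vderiv g (fun t => P t $ z) t (X $ P t $ z)).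
  { intros z; eapply vderiv_eq; [apply (vderiv_mapply g P (fun _ => z)); [apply mpower_mderiv, Ht | apply vderiv_const]|].
    rewrite mapply_mmul, mapply_zero; intros i _; unfold vadd, vzero; ring. }
  eapply vderiv_eq.
  - apply (vderiv_mapply g (fun t => P (- t)) (fun t => br g (P t $ x) (P t $ y))).
    + apply mpower_opp_mderiv, Ht.
    + apply (vderiv_br g (fun t => P t $ x) (fun t => P t $ y)); apply Dv.
  - cbv beta; set (u := P t $ x); set (v := P t $ y).
    assert (Hc : P (- t) ** X =m= X ** P (- t))
      by (apply (mpower_mlog_commute g D dl); try assumption; rewrite Rabs_Ropp; lra).
    assert (E1 : (fun i j => - (X ** P (- t)) i j) $ br g u v =v= vscal (-1) (P (- t) $ X $ br g u v)).
    { rewrite <- mapply_mmul, Hc; intros i _; unfold mapply, vscal; rewrite <- rsum_scal.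
      apply rsum_ext; intros; ring. }
    assert (E2 : vadd (vscal (-1) (X $ br g u v)) (vadd (br g (X $ u) v) (br g u (X $ v)))
      =v= vscal (-1) (derivation_defect X u v))
      by (intros i Hi; unfold vadd, vscal, derivation_defect; ring).
    rewrite E1, <- (mapply_vscal g (P (- t)) (-1) (derivation_defect X u v)), <- E2.
    rewrite (mapply_vadd g (P (- t)) (vscal (-1) (X $ br g u v))), mapply_vscal; reflexivity.
Qed.

(* [t |-> P(-t) [P(t) x, P(t) y]] takes the same value at 0 and 1, so by Rolle its
   derivative vanishes somewhere; since [P] is close to 1 this bounds every
   coefficient of the defect by a small multiple of the sum of all of them. *)
Lemma mlog_defect_zero a b k : (a < N)%nat -> (b < N)%nat -> (k < N)%nat -> defect_coef X a b k = 0.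
Proof.
  set (S := rsum N (fun l => rsum N (fun a => rsum N (fun b => Rabs (defect_coef X a b l))))).
  set (e := 4 * (INR N * dl)).
  assert (He : 0 <= e <= 1).
  { assert (0 <= INR N * dl) by (apply Rmult_le_pos; [apply pos_INR | exact Hdl]); unfold e; lra. }
  assert (HP : forall t i j, (i < N)%nat -> (j < N)%nat -> Rabs t <= 2 -> Rabs (P t i j - mid i j) <= e)
    by (intros; apply mpower_near_1; assumption).
  assert (HS : 0 <= S).
  { unfold S; apply rsum_nonneg; intros; apply rsum_nonneg; intros; apply rsum_nonneg; intros; apply Rabs_pos. }
  assert (Hone : forall i j k, (i < N)%nat -> (j < N)%nat -> (k < N)%nat ->
    Rabs (defect_coef X i j k) <= 7 * e * S).
  { clear a b k; intros i j k Hi Hj Hk.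
    set (f := fun t => (P (- t) $ br g (P t $ basis i) (P t $ basis j)) k).
    destruct (MVT_cor2 f (fun t => vscal (-1) (P (- t) $ derivation_defect X (P t $ basis i) (P t $ basis j)) k) 0 1)
      as [c [Hc Hc01]]; [lra| |].
    { intros c Hc; apply pulled_back_bracket_deriv; [rewrite Rabs_pos_eq; lra | exact Hk]. }
    assert (E0 : P 0 =m= mid) by (apply (mpower_0 g D dl); assumption).
    assert (E1 : P (- (1)) ** A =m= mid).
    { rewrite <- mpower_at_1; apply (mpower_small_inverse 1); rewrite Rabs_R1; lra. }
    assert (Ef0 : f 0 = br g (basis i) (basis j) k).
    { assert (E : P (- 0) $ br g (P 0 $ basis i) (P 0 $ basis j) =v= br g (basis i) (basis j))
        by (rewrite Ropp_0, !E0, !mapply_1; reflexivity).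
      apply E, Hk. }
    assert (Ef1 : f 1 = br g (basis i) (basis j) k).
    { assert (E : P (- (1)) $ br g (P 1 $ basis i) (P 1 $ basis j) =v= br g (basis i) (basis j))
        by (rewrite !mpower_at_1, <- (proj1 (proj2 HA)), <- mapply_mmul, E1, mapply_1; reflexivity).
      apply E, Hk. }
    rewrite Ef0, Ef1 in Hc.
    assert (Hz : (P (- c) $ derivation_defect X (P c $ basis i) (P c $ basis j)) k = 0)
      by (unfold vscal in Hc; lra).
    unfold mapply at 1 in Hz.
    assert (Hz' : rsum N (fun l => rsum N (fun a => rsum N (fun b =>
      (* Rolle's conclusion expanded in coordinates: this weighted sum of all defect coefficients is
         0. *)
      defect_coef X a b l * (P (- c) k l * P c a i * P c b j)))) = 0).
    { rewrite <- Hz; apply rsum_ext; intros l Hl; rewrite derivation_defect_expand, <- rsum_scal.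
      apply rsum_ext; intros a Ha; rewrite <- rsum_scal; apply rsum_ext; intros b Hb.
      rewrite !mapply_basis by assumption; ring. }
    assert (Hmid : defect_coef X i j k = rsum N (fun l => rsum N (fun a => rsum N (fun b =>
      defect_coef X a b l * (mid k l * mid a i * mid b j))))).
    { rewrite <- (rsum_delta N k (fun l => defect_coef X i j l)) by exact Hk.
      apply rsum_ext; intros l Hl.
      rewrite <- (rsum_delta N i (fun a => defect_coef X a j l)), <- rsum_scal by exact Hi.
      apply rsum_ext; intros a Ha.
      rewrite <- (rsum_delta N j (fun b => defect_coef X a b l)), <- !rsum_scal by exact Hj.
      apply rsum_ext; intros b Hb; unfold mid; rewrite (Nat.eqb_sym k l); ring. }
    (* With identity matrices in place of the powers the weighted sum is the single coefficient in
       question. Subtracting the vanishing sum leaves only the small differences of the weights. *)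
    replace (defect_coef X i j k) with (rsum N (fun l => rsum N (fun a => rsum N (fun b =>
      - defect_coef X a b l * (P (- c) k l * P c a i * P c b j - mid k l * mid a i * mid b j))))).
    - unfold S; rewrite <- rsum_scal.
      apply Rle_trans with (1 := rsum_Rabs _ _); apply rsum_le; intros l Hl; rewrite <- rsum_scal.
      apply Rle_trans with (1 := rsum_Rabs _ _); apply rsum_le; intros a Ha; rewrite <- rsum_scal.
      apply Rle_trans with (1 := rsum_Rabs _ _); apply rsum_le; intros b Hb.
      rewrite Rabs_mult, Rabs_Ropp, Rmult_comm; apply Rmult_le_compat_r; [apply Rabs_pos|].
      apply prod3_close; try apply mid_bound; try assumption; apply HP; try assumption;
        rewrite ?Rabs_Ropp, Rabs_pos_eq; lra.
    - set (Z := rsum N (fun l => rsum N (fun a => rsum N (fun b =>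
        defect_coef X a b l * (P (- c) k l * P c a i * P c b j))))) in Hz'.
      transitivity ((-1) * Z + defect_coef X i j k); [|rewrite Hz'; ring].
      rewrite Hmid; unfold Z; rewrite <- rsum_scal, <- rsum_plus; apply rsum_ext; intros l Hl.
      rewrite <- rsum_scal, <- rsum_plus; apply rsum_ext; intros a Ha.
      rewrite <- rsum_scal, <- rsum_plus; apply rsum_ext; intros b Hb; ring. }
  (* Summing the individual bounds gives S <= theta S with theta < 1, hence S = 0. *)
  assert (HS0 : S = 0).
  { assert (S <= INR N * (INR N * (INR N * (7 * e * S)))).
    { unfold S at 1; rewrite <- rsum_const; apply rsum_le; intros l Hl.
      rewrite <- rsum_const; apply rsum_le; intros i Hi.
      rewrite <- rsum_const; apply rsum_le; intros j Hj; apply Hone; assumption. }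
    fold e in Hsmall3.
    replace (INR N * (INR N * (INR N * (7 * e * S)))) with (INR N * (INR N * (INR N * (7 * e))) * S) in H by ring.
    nra. }
  intros Ha Hb Hk; assert (H := Hone a b k Ha Hb Hk); rewrite HS0, Rmult_0_r in H.
  assert (H2 := Rabs_pos (defect_coef X a b k)).
  destruct (Req_dec (defect_coef X a b k) 0) as [E|E]; [exact E|].
  apply Rabs_pos_lt in E; lra.
Qed.

Lemma commute_D C : C ** A =m= A ** C -> C ** D =m= D ** C.
Proof.
  intros HC i j Hi Hj; specialize (HC i j Hi Hj).
  assert (H1 : (C ** D) i j = (C ** A) i j - (C ** mid) i j).
  { unfold mmul, D; rewrite <- rsum_minus; apply rsum_ext; intros; ring. }
  assert (H2 : (D ** C) i j = (A ** C) i j - (mid ** C) i j).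
  { unfold mmul, D; rewrite <- rsum_minus; apply rsum_ext; intros; ring. }
  rewrite H1, H2, HC, (mmul_1_r g C i j Hi Hj), (mmul_1_l g C i j Hi Hj); reflexivity.
Qed.

Lemma mpower_commute t C : Rabs t <= 2 -> C ** A =m= A ** C -> C ** P t =m= P t ** C.
Proof.
  intros Ht HC; apply (mseries_commute g D dl Hclose Hdl Hsmall _ 1); [apply gbinom_bound1, Ht | apply commute_D, HC].
Qed.

(** With the defect gone, the pulled-back bracket is constant in t and equals its value at 0.
    Complex linearity holds because the power commutes with everything that commutes with [A]. *)
Lemma mpower_AutG t : 0 <= t <= 1 -> AutG g (P t).
Proof.
  intros Ht.
  assert (Hinv : inverse_of g (P t) (P (- t))) by (apply mpower_small_inverse; rewrite Rabs_pos_eq; lra).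
  split; [|split].
  - intros Hc; symmetry; apply mpower_commute; [rewrite Rabs_pos_eq; lra | symmetry; apply (proj1 HA Hc)].
  - intros x y.
    assert (E : P (- t) $ br g (P t $ x) (P t $ y) =v= br g x y).
    { assert (E0 : P 0 =m= mid) by (apply (mpower_0 g D dl); assumption).
      assert (E : P (- 0) $ br g (P 0 $ x) (P 0 $ y) =v= br g x y)
        by (rewrite Ropp_0, !E0, !mapply_1; reflexivity).
      rewrite <- E; intros k Hk.
      apply (deriv_zero_const_on (fun t => (P (- t) $ br g (P t $ x) (P t $ y)) k) 0 t); [lra|].
      intros r Hr; eapply derivable_pt_lim_eq; [apply pulled_back_bracket_deriv; [rewrite Rabs_pos_eq; lra | exact Hk]|].
      unfold vscal, mapply at 1; rewrite rsum_zero; [ring|]; intros l Hl.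
      rewrite derivation_defect_expand, rsum_zero; [ring|]; intros a Ha; apply rsum_zero; intros b Hb.
      rewrite mlog_defect_zero by assumption; ring. }
    rewrite <- E, <- mapply_mmul, (proj1 Hinv), mapply_1; reflexivity.
  - exists (P (- t)); exact Hinv.
Qed.

Lemma msmooth_mpower h : smooth h -> (forall z, Rabs (h z) <= 1) -> msmooth g (fun z => P (h z)).
Proof.
  intros Sh Hh i j Hi Hj.
  destruct (smooth_derivative h Sh) as [h' [Sh' Dh]].
  apply (smooth_upto (fun f => exists i j, (i < N)%nat /\ (j < N)%nat /\ f = fun z => P (h z) i j));
    [|apply gen_base; exists i, j; auto].
  intros f [a [b [Ha [Hb ->]]]].
  exists (fun z => (X ** P (h z)) a b * h' z); split.
  - apply gen_mult; [|apply gen_smooth, Sh'].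
    apply gen_rsum; intros l Hl; apply gen_mult; [apply gen_const | apply gen_base; exists l, b; auto].
  - intros z; apply (derivable_pt_lim_comp h (fun t => P t a b)); [apply Dh | apply mpower_mderiv; auto].
Qed.

End Small.
End NearIdentity.

(** * From equivalent pairs to quasiconjugacy *)

Lemma uniform_closeness n (f : nat -> nat -> R -> R) s e : 0 < e ->
  (forall i j, (i < n)%nat -> (j < n)%nat -> continuity_pt (f i j) s) ->
  exists d, 0 < d /\ forall i j t, (i < n)%nat -> (j < n)%nat -> Rabs (t - s) < d -> Rabs (f i j t - f i j s) < e.
Proof.
  intros He Hf.
  assert (H1 : forall m, (m <= n)%nat -> forall i, (i < n)%nat -> exists d, 0 < d /\
    forall j t, (j < m)%nat -> Rabs (t - s) < d -> Rabs (f i j t - f i j s) < e).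
  { induction m as [|m IH]; intros Hm i Hi; [exists 1; split; [lra | intros; lia]|].
    destruct (IH ltac:(lia) i Hi) as [d [Hd H]].
    destruct (Hf i m Hi ltac:(lia) e He) as [d' [Hd' H']].
    exists (Rmin d d'); split; [apply Rmin_pos; assumption|]; intros j t Hj Ht.
    assert (A1 := Rmin_l d d'); assert (A2 := Rmin_r d d').
    destruct (Nat.eq_dec j m) as [->|Hne]; [|apply H; [lia | lra]].
    destruct (Req_dec s t) as [<-|Hst]; [rewrite Rminus_diag, Rabs_R0; exact He|].
    apply H'; split; [split; [exact I | exact Hst] | simpl; unfold Rdist; lra]. }
  assert (H2 : forall m, (m <= n)%nat -> exists d, 0 < d /\
    forall i j t, (i < m)%nat -> (j < n)%nat -> Rabs (t - s) < d -> Rabs (f i j t - f i j s) < e).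
  { induction m as [|m IH]; intros Hm; [exists 1; split; [lra | intros; lia]|].
    destruct (IH ltac:(lia)) as [d [Hd H]].
    destruct (H1 n (le_n n) m ltac:(lia)) as [d' [Hd' H']].
    exists (Rmin d d'); split; [apply Rmin_pos; assumption|]; intros i j t Hi Hj Ht.
    assert (A1 := Rmin_l d d'); assert (A2 := Rmin_r d d').
    destruct (Nat.eq_dec i m) as [->|Hne]; [apply H'; [exact Hj | lra] | apply H; [lia | exact Hj | lra]]. }
  apply (H2 n (le_n n)).
Qed.

Section SmoothPaths.
Variable g : LieData.
Let N := dim g.

Notation "A =m= B" := (meq g A B) (at level 70).
Notation "v =v= w" := (veq g v w) (at level 70).
Notation "A ** B" := (mmul g A B) (at level 40, left associativity).
Notation "A $ v" := (mapply g A v) (at level 45, right associativity).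

(** The inverse path [P'] is carried as data so that its smoothness is part of the notion. Being
    constant outside (0, 1) lets paths be multiplied pointwise and glued into gauge transformations
    without corners. *)
Definition smooth_path (gamma c : mat) : Prop :=
  exists P P', msmooth g P /\ msmooth g P' /\ forall t, AutG g (P t) /\ inverse_of g (P t) (P' t) /\
    P t ** gamma =m= gamma ** P t /\ (t <= 0 -> P t =m= mid) /\ (1 <= t -> P t =m= c).

Lemma smooth_path_proper gamma c c' : c =m= c' -> smooth_path gamma c -> smooth_path gamma c'.
Proof.
  intros E [P [P' [SP [SP' H]]]]; exists P, P'; repeat (split; [assumption|]).
  intros t; destruct (H t) as [H1 [H2 [H3 [H4 H5]]]]; repeat (split; [assumption|]).
  intros Ht; rewrite <- E; apply H5, Ht.
Qed.

Lemma smooth_path_mul gamma c c' : smooth_path gamma c -> smooth_path gamma c' -> smooth_path gamma (c ** c').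
Proof.
  intros [P [P' [SP [SP' H]]]] [Q [Q' [SQ [SQ' K]]]].
  exists (fun t => P t ** Q t), (fun t => Q' t ** P' t).
  split; [apply (msmooth_mul g P Q SP SQ) | split; [apply (msmooth_mul g Q' P' SQ' SP')|]].
  intros t; destruct (H t) as [H1 [[H2 H2'] [H3 [H4 H5]]]], (K t) as [K1 [[K2 K2'] [K3 [K4 K5]]]].
  split; [apply AutG_mul; assumption | split; [split | split; [|split]]].
  - rewrite mmul_assoc, <- (mmul_assoc g (P t)), K2, mmul_1_r; exact H2.
  - rewrite mmul_assoc, <- (mmul_assoc g (Q' t)), H2', mmul_1_r; exact K2'.
  - rewrite <- mmul_assoc, K3, mmul_assoc, H3, mmul_assoc; reflexivity.
  - intros Ht; rewrite H4, K4, mmul_1_l by exact Ht; reflexivity.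
  - intros Ht; rewrite H5, K5 by exact Ht; reflexivity.
Qed.

Lemma smooth_path_inv gamma c : smooth_path gamma c -> smooth_path gamma (minv g c).
Proof.
  intros [P [P' [SP [SP' H]]]]; exists P', P; split; [exact SP' | split; [exact SP|]].
  intros t; destruct (H t) as [H1 [[H2 H2'] [H3 [H4 H5]]]].
  assert (A' : AutG g (P' t)) by (apply AutG_inverse with (P t); [exact H1 | split; assumption]).
  assert (E : minv g (P t) =m= P' t) by (apply minv_eq; assumption).
  split; [exact A' | split; [split; assumption | split; [|split]]].
  - apply mmul_cancel_l with (1 := H1).
    rewrite !mmul_assoc, H2, H3, <- mmul_assoc, H2, mmul_1_l, mmul_1_r; reflexivity.
  - intros Ht; rewrite <- E; apply minv_eq; [exact H1|]; rewrite H4, mmul_1_l by exact Ht; reflexivity.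
  - intros Ht; rewrite <- E; apply minv_meq; [exact H1 | apply H5, Ht].
Qed.

Lemma smooth_path_near_1 gamma : exists dl, 0 < dl /\ forall A, AutG g A -> A ** gamma =m= gamma ** A ->
  (forall i j, (i < N)%nat -> (j < N)%nat -> Rabs (A i j - mid i j) <= dl) -> smooth_path gamma A.
Proof.
  assert (Hn := pos_INR N); set (n := INR N) in *; set (m := n + 1).
  assert (Hm : 1 <= m) by (unfold m; lra).
  assert (Hm2 : 1 <= m * m) by nra.
  assert (Hm4 : m <= m * m * (m * m)) by nra.
  assert (Hp : 0 < 64 * (m * m * (m * m))) by nra.
  (* With m = N + 1 this radius makes N dl at most 1/64 and 28 N^4 dl less than 1, the two smallness
     conditions on powers near the identity. *)
  exists (/ (64 * (m * m * (m * m)))); split; [apply Rinv_0_lt_compat, Hp|].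
  set (dl := / (64 * (m * m * (m * m)))); intros A HA Hc Hclose.
  assert (Hd : 0 < dl) by (apply Rinv_0_lt_compat, Hp).
  assert (Hdd : 64 * (m * m * (m * m)) * dl = 1) by (apply Rinv_r; lra).
  assert (Hs : n * dl <= / 8).
  { assert (n * dl <= m * m * (m * m) * dl) by (apply Rmult_le_compat_r; unfold m in *; lra); lra. }
  assert (Hs3 : n * (n * (n * (7 * (4 * (n * dl))))) < 1).
  { replace (n * (n * (n * (7 * (4 * (n * dl)))))) with (28 * (n * n * (n * n)) * dl) by ring.
    assert (n * n <= m * m) by (unfold m; nra).
    assert (0 <= n * n) by nra.
    assert (n * n * (n * n) <= m * m * (m * m)) by (apply Rmult_le_compat; assumption).
    assert (n * n * (n * n) * dl <= m * m * (m * m) * dl) by (apply Rmult_le_compat_r; lra).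
    lra. }
  destruct smooth_step as [h [Sh [H0 [H1 Hb]]]].
  set (D := fun i j => A i j - mid i j).
  assert (Habs : forall t, Rabs (h t) <= 1) by (intros t; specialize (Hb t); rewrite Rabs_pos_eq; lra).
  exists (fun t => mpower g D (h t)), (fun t => mpower g D (- h t)).
  split; [apply (msmooth_mpower g A dl); (assumption || lra)|].
  split.
  { apply (msmooth_mpower g A dl ltac:(lra) Hclose Hs (fun t => - h t)); [apply smooth_opp, Sh|].
    intros t; rewrite Rabs_Ropp; apply Habs. }
  intros t; specialize (Habs t); split; [|split; [|split; [|split]]].
  - apply (mpower_AutG g A dl); (assumption || apply Hb || lra).
  - apply (mpower_inverse g D dl); (assumption || lra).
  - symmetry; apply (mpower_commute g A dl); try (assumption || lra); symmetry; exact Hc.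
  - intros Ht; rewrite H0 by exact Ht; apply (mpower_0 g D dl); (assumption || lra).
  - intros Ht; rewrite H1 by exact Ht; apply (mpower_at_1 g A dl); (assumption || lra).
Qed.

Lemma smooth_path_1 gamma : smooth_path gamma mid.
Proof.
  exists (fun _ => mid), (fun _ => mid); split; [apply msmooth_const | split; [apply msmooth_const|]].
  intros t; split; [apply AutG_1 | split; [split; apply mmul_1_l | split; [|split; reflexivity]]].
  rewrite mmul_1_l, mmul_1_r; reflexivity.
Qed.

(** The induction along the path concerns only its points. Near [s] each p(x) is p(s) times an
    automorphism close to 1, so a smooth path to p(x) yields one to p(s), and from there one to
    p(y). *)
Lemma centralizer_smooth_path gamma c : in_centralizer_id_comp g gamma c -> smooth_path gamma c.
Proof.
  intros [p [Cp [Hp0 [Hp1 Hp]]]].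
  destruct (smooth_path_near_1 gamma) as [dl [Hdl Hnear]].
  apply smooth_path_proper with (1 := Hp1).
  apply (interval_induction (fun t => smooth_path gamma (p t)) 0 1); [lra| |].
  - apply smooth_path_proper with mid; [symmetry; exact Hp0 | apply smooth_path_1].
  - intros s Hs; destruct (Hp s Hs) as [As Es].
    destruct (uniform_closeness N (fun i j t => (minv g (p s) ** p t) i j) s dl Hdl) as [d [Hd Hcl]].
    { intros i j Hi Hj; unfold mmul.
      assert (Hsum : forall m, (m <= N)%nat -> continuity_pt (fun t => rsum m (fun l => minv g (p s) i l * p t l j)) s).
      { induction m as [|m IH]; intros Hm; simpl.
        - apply continuity_pt_const; intros x y; reflexivity.
        - apply (continuity_pt_plus (fun t => rsum m (fun l => minv g (p s) i l * p t l j))); [apply IH; lia|].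
          apply (continuity_pt_mult (fun _ => minv g (p s) i m) (fun t => p t m j)).
          + apply continuity_pt_const; intros x y; reflexivity.
          + apply Cp; [lia | exact Hj]. }
      apply Hsum, le_n. }
    assert (Hpath : forall x, 0 <= x <= 1 -> Rabs (x - s) < d -> smooth_path gamma (minv g (p s) ** p x)).
    { intros x Hx Hxs; destruct (Hp x Hx) as [Ax Ex]; apply Hnear.
      - apply AutG_mul; [apply AutG_minv|]; assumption.
      - apply mmul_cancel_l with (1 := As).
        rewrite <- mmul_assoc, Ex, !mmul_assoc, Es, (mul_minv_r g _ _ As), minv_r, mmul_1_l by exact As.
        reflexivity.
      - intros i j Hi Hj; rewrite <- (minv_l g (p s) As i j Hi Hj); left; apply Hcl; assumption. }
    exists d; split; [exact Hd|]; intros x y Hx Hy Hxs Hys Px.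
    destruct (Hp x Hx) as [Ax Ex].
    assert (Ps : smooth_path gamma (p s)).
    { apply smooth_path_proper with (p x ** minv g (minv g (p s) ** p x)).
      - rewrite minv_mul, minv_minv, mmul_assoc, minv_r, mmul_1_l by (try apply AutG_minv; assumption).
        reflexivity.
      - apply smooth_path_mul; [exact Px | apply smooth_path_inv, Hpath; assumption]. }
    apply smooth_path_proper with (p s ** (minv g (p s) ** p y)).
    + rewrite mmul_assoc, minv_r, mmul_1_l by exact As; reflexivity.
    + apply smooth_path_mul; [exact Ps | apply Hpath; assumption].
Qed.

Lemma msmooth_local P : (forall t0, exists d Q, 0 < d /\ msmooth g Q /\
  forall t, Rabs (t - t0) < d -> P t =m= Q t) -> msmooth g P.
Proof.
  intros H i j Hi Hj; apply smooth_local; intros t0; destruct (H t0) as [d [Q [Hd [SQ E]]]].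
  exists d, (fun t => Q t i j); split; [exact Hd | split; [apply SQ; assumption|]].
  intros t Ht; apply E; assumption.
Qed.

Lemma gauge_LIso s s' (psi chi : R -> mat) (mu nu : R -> R) :
  AutG g s -> AutG g s' ->
  msmooth g psi -> msmooth g chi -> (forall t, AutG g (psi t)) ->
  (forall t, inverse_of g (psi t) (chi t)) ->
  smooth mu -> smooth nu -> (forall x, mu (nu x) = x) -> (forall x, nu (mu x) = x) ->
  (forall t, mu (t + 2 * PI) = mu t + 2 * PI) ->
  (forall t, psi (t + 2 * PI) ** s =m= s' ** psi t) ->
  LIso g s s' (fun u t => psi t $ u (mu t)).
Proof.
  intros As As' Spsi Schi Apsi Hinv Smu Snu Hmn Hnm Hmu Hper.
  assert (Hnu : forall t, nu (t + 2 * PI) = nu t + 2 * PI)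
    by (intros t; rewrite <- (Hmn t) at 1; rewrite <- Hmu, Hnm; reflexivity).
  apply (LIso_standard g s s' psi chi mu nu); try assumption.
  - intros u Lu t; rewrite Hmu, (proj2 Lu), <- !mapply_mmul, Hper; reflexivity.
  - intros w Lw t; rewrite Hnu, (proj2 Lw), <- !mapply_mmul.
    assert (E : chi (nu t + 2 * PI) ** s' =m= s ** chi (nu t)).
    { apply mmul_cancel_l with (1 := Apsi (nu t + 2 * PI)).
      rewrite !mmul_assoc, (proj1 (Hinv _)), mmul_1_l, Hper, <- mmul_assoc, (proj1 (Hinv _)), mmul_1_r.
      reflexivity. }
    rewrite E; reflexivity.
Qed.

Definition compatible_pair (a b : mat) : Prop := AutG g a /\ AutG g b /\ a ** a =m= b ** b.

Lemma quasiconj_gauge a s a' s' (psi chi : R -> mat) :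
  AutG g s -> AutG g s' -> msmooth g psi -> msmooth g chi -> (forall t, AutG g (psi t)) ->
  (forall t, inverse_of g (psi t) (chi t)) ->
  (forall t, psi (t + 2 * PI) ** s =m= s' ** psi t) ->
  (forall t, psi t ** a =m= a' ** psi (- t)) ->
  quasiconj g s (Phi_pair g a) s' (Phi_pair g a').
Proof.
  intros As As' Spsi Schi Apsi Hinv Hper Hint.
  exists (fun u t => psi t $ u t); split.
  - apply (gauge_LIso s s' psi chi (fun t => t) (fun t => t)); try assumption; try reflexivity; apply smooth_id.
  - intros u Lu t; unfold Phi_pair; rewrite <- !mapply_mmul, Hint; reflexivity.
Qed.

Lemma quasiconj_conj a b s s' al be :
  compatible_pair a b -> AutG g al -> AutG g be -> smooth_path (a ** a) (minv g al ** be) ->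
  b ** s =m= a -> be ** b ** minv g be ** s' =m= al ** a ** minv g al ->
  quasiconj g s (Phi_pair g a) s' (Phi_pair g (al ** a ** minv g al)).
Proof.
  intros [Aa [Ab Hsq]] Aal Abe [P [P' [SP [SP' HP]]]] Es Es'.
  assert (HPI := PI_RGT_0).
  assert (As := twist_AutG g a b s Aa Ab Es).
  assert (Aa' : AutG g (al ** a ** minv g al)) by (repeat apply AutG_mul; try apply AutG_minv; assumption).
  assert (Ab' : AutG g (be ** b ** minv g be)) by (repeat apply AutG_mul; try apply AutG_minv; assumption).
  assert (As' := twist_AutG g _ _ s' Aa' Ab' Es').
  set (a' := al ** a ** minv g al) in *; set (b' := be ** b ** minv g be) in *.
  (* Rescaled so that the path is already constant from pi/2 on, which is the whole overlap used for
     gluing at the seam. *)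
  set (p := fun t => P (2 / PI * t)).
  (* For t >= 0 this is al p(t); for t <= 0 it is al a^-1 p(-t) a, the value forced by the
     intertwining relation. Since [p] is 1 on the negative axis, one product covers both halves and
     is smooth at 0. *)
  set (psi0 := fun t => al ** p t ** minv g a ** p (- t) ** a).
  set (chi0 := fun t => minv g a ** P' (2 / PI * - t) ** a ** P' (2 / PI * t) ** minv g al).
  assert (Slin : forall f, smooth f -> smooth (fun t => 2 / PI * f t)) by (intros; apply smooth_scal; assumption).
  assert (Sneg : smooth (fun t => - t)) by apply smooth_opp, smooth_id.
  assert (Sp : msmooth g p) by (apply (msmooth_comp g P (fun t => 2 / PI * t) SP), (Slin (fun t => t)), smooth_id).
  assert (Spsi0 : msmooth g psi0).
  { unfold psi0; apply (msmooth_mul g (fun t => al ** p t ** minv g a ** p (- t))); [|apply msmooth_const].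
    apply (msmooth_mul g (fun t => al ** p t ** minv g a)); [|apply (msmooth_comp g p _ Sp Sneg)].
    apply (msmooth_mul g (fun t => al ** p t)); [|apply msmooth_const].
    apply (msmooth_mul g (fun _ => al)); [apply msmooth_const | exact Sp]. }
  assert (Schi0 : msmooth g chi0).
  { unfold chi0; apply (msmooth_mul g (fun t => minv g a ** P' (2 / PI * - t) ** a ** P' (2 / PI * t))); [|apply msmooth_const].
    apply (msmooth_mul g (fun t => minv g a ** P' (2 / PI * - t) ** a));
      [|apply (msmooth_comp g P' _ SP'), (Slin (fun t => t)), smooth_id].
    apply (msmooth_mul g (fun t => minv g a ** P' (2 / PI * - t))); [|apply msmooth_const].
    apply (msmooth_mul g (fun _ => minv g a)); [apply msmooth_const|].
    apply (msmooth_comp g P' _ SP'), Slin, Sneg. }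
  assert (Ap : forall t, AutG g (p t)) by (intros; apply HP).
  assert (Apsi0 : forall t, AutG g (psi0 t)).
  { intros t; unfold psi0; repeat apply AutG_mul; try apply AutG_minv; try assumption; apply Ap. }
  assert (Hinv0 : forall t, chi0 t ** psi0 t =m= mid).
  { intros t; unfold chi0, psi0.
    destruct (HP (2 / PI * t)) as [_ [[_ E1] _]], (HP (2 / PI * - t)) as [_ [[_ E2] _]].
    fold (p t) in E1; fold (p (- t)) in E2.
    rewrite !mmul_assoc, (mul_minv_l g al _ Aal).
    rewrite <- (mmul_assoc g _ _ (p t)), E1, mmul_1_r, (mul_minv_r g a _ Aa).
    rewrite <- (mmul_assoc g _ _ (p (- t))), E2, mmul_1_r, minv_l by exact Aa; reflexivity. }
  assert (Hp0 : forall t, t <= 0 -> p t =m= mid).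
  { intros t Ht; apply HP; assert (0 < 2 / PI) by (apply Rdiv_lt_0_compat; lra); nra. }
  assert (Hp1 : forall t, PI / 2 <= t -> p t =m= minv g al ** be).
  { intros t Ht; apply HP; replace 1 with (2 / PI * (PI / 2)) by (field; lra).
    apply Rmult_le_compat_l; [|exact Ht]; left; apply Rdiv_lt_0_compat; lra. }
  assert (Hpos : forall t, 0 <= t -> psi0 t =m= al ** p t).
  { intros t Ht; unfold psi0; rewrite (Hp0 (- t)), mmul_1_r, (mul_minv_l g a _ Aa) by lra; reflexivity. }
  assert (Hneg : forall t, t <= 0 -> psi0 t =m= al ** minv g a ** p (- t) ** a).
  { intros t Ht; unfold psi0; rewrite (Hp0 t), mmul_1_r by lra; reflexivity. }
  assert (Hcent : forall t, p t ** (a ** a) =m= a ** a ** p t) by (intros; apply HP).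
  assert (Hint0 : forall t, psi0 t ** a =m= a' ** psi0 (- t)).
  { intros t; unfold a'; destruct (Rle_dec 0 t) as [Ht|Ht].
    - rewrite Hpos, Hneg, Ropp_involutive by lra.
      rewrite !mmul_assoc, (mul_minv_l g al _ Aal), (mul_minv_r g a _ Aa); reflexivity.
    - rewrite Hneg, Hpos by lra.
      rewrite !mmul_assoc, (mul_minv_l g al _ Aal), <- (mmul_assoc g _ a a).
      rewrite <- (mmul_assoc g _ (p (- t))), Hcent, !mmul_assoc, (mul_minv_l g a _ Aa); reflexivity. }
  (* On the overlap [p] is constantly al^-1 be, so the gluing condition is a purely algebraic
     identity, verified after multiplication by b' on the left. *)
  assert (Hover : forall t, Rabs (t + PI) < PI / 2 -> psi0 (t + 2 * PI) ** s =m= s' ** psi0 t).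
  { intros t Ht; apply Rabs_def2 in Ht; rewrite Hpos, Hneg, !Hp1 by lra.
    apply mmul_cancel_l with (1 := Ab').
    assert (E1 : al ** (minv g al ** be) =m= be) by (rewrite mmul_assoc, minv_r, mmul_1_l by exact Aal; reflexivity).
    rewrite E1, (mmul_assoc g b' s'), Es'; unfold a', b'.
    rewrite !mmul_assoc, (mul_minv_l g be _ Abe), <- (mmul_assoc g be b s), Es.
    rewrite (mul_minv_l g al _ Aal), (mul_minv_r g a _ Aa), minv_r, mmul_1_l by exact Aal; reflexivity. }
  (* The action matching the equivariance required of a gauge transformation from L(g, s) to L(g,
     s'). *)
  set (T := fun (k : Z) (M : mat) => zpow g s' k ** M ** zpow g s (- k)).
  assert (Tadd : forall k m x, T (k + m)%Z x =m= T k (T m x)).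
  { intros k m x; unfold T; rewrite zpow_add by exact As'.
    replace (- (k + m))%Z with (- m + - k)%Z by lia; rewrite zpow_add by exact As.
    rewrite !mmul_assoc; reflexivity. }
  set (psi := twisted_ext mat T psi0).
  assert (Hspec : forall t k, Rabs (t - 2 * PI * IZR k) < PI + PI / 2 ->
    psi t =m= zpow g s' k ** psi0 (t - 2 * PI * IZR k) ** zpow g s (- k)).
  { apply (twisted_ext_spec mat (meq g) T); [apply meq_equiv| |exact Tadd|lra|].
    - intros k x y E; unfold T; rewrite E; reflexivity.
    - intros t Ht; unfold T; rewrite zpow_1, <- Hover by exact Ht.
      change (- (1))%Z with (-1)%Z.
      rewrite <- mmul_assoc, zpow_m1_r, mmul_1_r by exact As; reflexivity. }
  assert (Apsi : forall t, AutG g (psi t)).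
  { intros t; unfold psi, twisted_ext, T; apply AutG_mul; [apply AutG_mul; [apply AutG_zpow, As' | apply Apsi0] | apply AutG_zpow, As]. }
  apply quasiconj_gauge with psi (fun t => minv g (psi t)); try assumption.
  - apply msmooth_local; intros t0; destruct (near_period_center t0) as [k Hk].
    exists (PI / 2), (fun t => zpow g s' k ** psi0 (t - 2 * PI * IZR k) ** zpow g s (- k)).
    split; [lra | split; [|intros t Ht; apply Hspec, Hk, Ht]].
    apply (msmooth_mul g (fun t => zpow g s' k ** psi0 (t - 2 * PI * IZR k))); [|apply msmooth_const].
    apply (msmooth_mul g (fun _ => zpow g s' k)); [apply msmooth_const|].
    apply (msmooth_comp g psi0 _ Spsi0), smooth_minus; [apply smooth_id | apply smooth_const].
  - apply msmooth_local; intros t0; destruct (near_period_center t0) as [k Hk].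
    exists (PI / 2), (fun t => zpow g s k ** chi0 (t - 2 * PI * IZR k) ** zpow g s' (- k)).
    split; [lra | split].
    + apply (msmooth_mul g (fun t => zpow g s k ** chi0 (t - 2 * PI * IZR k))); [|apply msmooth_const].
      apply (msmooth_mul g (fun _ => zpow g s k)); [apply msmooth_const|].
      apply (msmooth_comp g chi0 _ Schi0), smooth_minus; [apply smooth_id | apply smooth_const].
    + intros t Ht; apply minv_eq; [apply Apsi|]; rewrite (Hspec t k) by (apply Hk, Ht).
      rewrite !mmul_assoc, <- (mmul_assoc g _ (zpow g s' (- k))), <- zpow_add by exact As'.
      replace (- k + k)%Z with 0%Z by lia; rewrite zpow_0, mmul_1_r.
      rewrite <- (mmul_assoc g _ (chi0 _)), Hinv0, mmul_1_r, <- zpow_add by exact As.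
      replace (k + - k)%Z with 0%Z by lia; apply zpow_0.
  - intros t; apply aut_inverse, Apsi.
  - intros t; unfold psi; rewrite (twisted_ext_period mat (meq g) T); [|apply meq_equiv|exact Tadd].
    unfold T at 1; change (- (1))%Z with (-1)%Z.
    rewrite zpow_1, <- mmul_assoc, zpow_m1_l, mmul_1_r by exact As; reflexivity.
  - intros t; set (k := period_index t).
    assert (H := period_index_spec t); fold k in H.
    assert (Hsq' : a' ** a' =m= b' ** b').
    { unfold a', b'; rewrite !mmul_assoc, (mul_minv_l g al _ Aal), (mul_minv_l g be _ Abe).
      apply mmul_cancel_r with (1 := Abe).
      rewrite (mul_minv_l g be _ Abe), <- (mmul_assoc g _ (minv g al) be), <- (Hp1 PI) by lra.
      rewrite <- (mmul_assoc g al a a), <- (mmul_assoc g al), <- Hcent, (Hp1 PI) by lra.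
      rewrite !mmul_assoc, minv_r, mmul_1_l, <- (mmul_assoc g be a a), Hsq by exact Aal.
      rewrite !mmul_assoc; reflexivity. }
    (* The enlarged windows matter here: if [t] is at the left end of its period, then -t is at the
       excluded right end of the period of index -k. The dihedral relations on both sides then
       reduce the claim to [psi0]. *)
    rewrite (Hspec t k), (Hspec (- t) (- k)%Z) by (rewrite ?opp_IZR; apply Rabs_def1; lra).
    replace (- t - 2 * PI * IZR (- k)) with (- (t - 2 * PI * IZR k)) by (rewrite opp_IZR; ring).
    rewrite <- mmul_assoc, (zpow_reflection g a b s Aa Ab Hsq Es), Z.opp_involutive.
    rewrite !mmul_assoc, <- (mmul_assoc g _ (psi0 (t - 2 * PI * IZR k)) a), Hint0.
    rewrite mmul_assoc, (zpow_reflection g a' b' s' Aa' Ab' Hsq' Es'); reflexivity.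
Qed.

(** The reflection t |-> -t of the circle fixes 0 and pi, and there the automorphism acts by [a] and
    by a s^-1 = b respectively. The map t |-> pi - t exchanges these two points. *)
Lemma quasiconj_swap a b s s' : compatible_pair a b -> b ** s =m= a -> a ** s' =m= b ->
  quasiconj g s (Phi_pair g a) s' (Phi_pair g b).
Proof.
  intros [Aa [Ab Hsq]] Es Es'.
  assert (Hss : s' ** s =m= mid).
  { apply mmul_cancel_l with (1 := Aa); rewrite mmul_assoc, Es', Es, mmul_1_r; reflexivity. }
  assert (As := twist_AutG g a b s Aa Ab Es).
  assert (Hss' : s ** s' =m= mid).
  { apply mmul_cancel_r with (1 := As); rewrite <- mmul_assoc, Hss, mmul_1_l, mmul_1_r; reflexivity. }
  assert (Smu : smooth (fun t => PI - t)) by (apply smooth_minus; [apply smooth_const | apply smooth_id]).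
  exists (fun u t => mid $ u (PI - t)); split.
  - apply (LIso_standard g s s' (fun _ => mid) (fun _ => mid) (fun t => PI - t) (fun t => PI - t));
      try apply msmooth_const; try exact Smu; try (intros; ring).
    + intros _; apply AutG_1.
    + intros _; split; apply mmul_1_l.
    + intros u Lu t; rewrite !mapply_1.
      replace (PI - t) with (PI - (t + 2 * PI) + 2 * PI) by ring.
      rewrite (proj2 Lu (PI - (t + 2 * PI))), <- mapply_mmul, Hss, mapply_1; reflexivity.
    + intros w Lw t; rewrite !mapply_1.
      replace (PI - t) with (PI - (t + 2 * PI) + 2 * PI) by ring.
      rewrite (proj2 Lw (PI - (t + 2 * PI))), <- mapply_mmul, Hss', mapply_1; reflexivity.
  - intros u Lu t; unfold Phi_pair; rewrite !mapply_1.
    replace (PI - - t) with (- (PI - t) + 2 * PI) by ring.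
    rewrite (proj2 Lu (- (PI - t))), <- mapply_mmul, Es; reflexivity.
Qed.

Lemma Phi_pair_ext a u v : leqL g u v -> leqL g (Phi_pair g a u) (Phi_pair g a v).
Proof. intros E t; unfold Phi_pair; rewrite (E (- t)); reflexivity. Qed.

Lemma quasiconj_sym a b s a' b' s' : compatible_pair a b -> compatible_pair a' b' ->
  b ** s =m= a -> b' ** s' =m= a' ->
  quasiconj g s (Phi_pair g a) s' (Phi_pair g a') -> quasiconj g s' (Phi_pair g a') s (Phi_pair g a).
Proof.
  intros [Aa [Ab Hsq]] [Aa' [Ab' Hsq']] Es Es' [psi [Hpsi Hint]].
  assert (As := twist_AutG g a b s Aa Ab Es).
  destruct (LIso_inverse g s s' psi As Hpsi) as [chi [Hchi [E1 E2]]].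
  exists chi; split; [exact Hchi|]; intros w Lw.
  assert (Lc : in_L g s (chi w)) by (apply Hchi, Lw).
  assert (LP : in_L g s (Phi_pair g a (chi w))) by (apply (Phi_pair_in_L g a b); assumption).
  apply (proj1 (proj2 Hpsi)).
  - apply Hchi, (Phi_pair_in_L g a' b'); assumption.
  - exact LP.
  - intros t; rewrite (Hint _ Lc t), (E1 _ (Phi_pair_in_L g a' b' s' Ab' Hsq' Es' w Lw) t).
    apply Phi_pair_ext; intros r; symmetry; apply E1, Lw.
Qed.

Lemma quasiconj_trans s1 Phi1 s2 Phi2 s3 Phi3 : AutG g s1 ->
  (forall u, in_L g s1 u -> in_L g s1 (Phi1 u)) -> (forall u, in_L g s2 u -> in_L g s2 (Phi2 u)) ->
  quasiconj g s1 Phi1 s2 Phi2 -> quasiconj g s2 Phi2 s3 Phi3 -> quasiconj g s1 Phi1 s3 Phi3.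
Proof.
  intros As1 H1 H2 [psi [Hpsi Hint]] [chi [Hchi Hint']].
  exists (fun u => chi (psi u)); split; [apply LIso_compose with s2; assumption|].
  intros u Lu t.
  assert (Lp : in_L g s2 (psi u)) by (apply Hpsi, Lu).
  rewrite <- (Hint' _ Lp t); apply (proj1 (proj2 (proj1 Hchi))); [apply (proj1 (proj1 Hpsi)), H1, Lu | apply H2, Lp | apply Hint, Lu].
Qed.

(** [pair_rel] relates arbitrary matrices, so the induction also shows that compatibility passes in
    both directions. The symmetric and transitive cases rely on this for pairs not known in advance
    to consist of automorphisms. *)
Lemma pair_rel_quasiconj a b a' b' : pair_rel g a b a' b' ->
  (compatible_pair a b <-> compatible_pair a' b') /\
  (compatible_pair a b -> forall s s', b ** s =m= a -> b' ** s' =m= a' ->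
     quasiconj g s (Phi_pair g a) s' (Phi_pair g a')).
Proof.
  induction 1 as [a b a' b' Ea Eb|a b|a b al ali be bei Aal Abe E1 E2 E3 E4 Hc
    |a b a' b' H [IH1 IH2]|a b a' b' a'' b'' H1 [IH1 IH2] H3 [IH3 IH4]].
  - split; [unfold compatible_pair; rewrite Ea, Eb; reflexivity|].
    intros [Aa [Ab Hsq]] s s' Es Es'.
    assert (As := twist_AutG g a b s Aa Ab Es).
    assert (Ess : s =m= s').
    { apply mmul_cancel_l with (1 := Ab); rewrite Es, Eb, Es', Ea; reflexivity. }
    apply quasiconj_gauge with (fun _ => mid) (fun _ => mid); try apply msmooth_const; try assumption.
    + rewrite <- Ess; exact As.
    + intros _; apply AutG_1.
    + intros _; split; apply mmul_1_l.
    + intros t; rewrite mmul_1_l, mmul_1_r; exact Ess.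
    + intros t; rewrite mmul_1_l, mmul_1_r; exact Ea.
  - split.
    + unfold compatible_pair; split; intros [Aa [Ab Hsq]]; (split; [|split]); try assumption; symmetry; assumption.
    + intros Hab s s' Es Es'; apply quasiconj_swap; assumption.
  - assert (Eal : ali =m= minv g al) by (symmetry; apply minv_eq; assumption).
    assert (Ebe : bei =m= minv g be) by (symmetry; apply minv_eq; assumption).
    assert (Ea : al ** (a ** ali) =m= al ** a ** minv g al) by (rewrite mmul_assoc, Eal; reflexivity).
    assert (Eb : be ** (b ** bei) =m= be ** b ** minv g be) by (rewrite mmul_assoc, Ebe; reflexivity).
    assert (Hpath := centralizer_smooth_path _ _ Hc).
    apply (smooth_path_proper _ _ (minv g al ** be)) in Hpath; [|rewrite Eal; reflexivity].
    (* The endpoint of the path commutes with a^2, so conjugating this square by [al] or by [be]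
       gives the same matrix. *)
    assert (Hcomm : al ** a ** minv g al ** (al ** a ** minv g al) ** be =m= be ** (a ** a)).
    { destruct Hpath as [P [P' [_ [_ HP]]]]; destruct (HP 1) as [_ [_ [E [_ EP]]]].
      rewrite EP in E by lra; apply mmul_cancel_l with (1 := AutG_minv g al Aal).
      rewrite (mmul_assoc g (minv g al) be), E, !mmul_assoc, minv_l, mmul_1_l by exact Aal.
      rewrite (mul_minv_l g al _ Aal); reflexivity. }
    assert (Hb2 : be ** b ** minv g be ** (be ** b ** minv g be) ** be =m= be ** (b ** b)).
    { rewrite !mmul_assoc, !(mul_minv_l g be _ Abe); reflexivity. }
    assert (Hiff : compatible_pair a b <-> compatible_pair (al ** a ** minv g al) (be ** b ** minv g be)).
    { split; intros [Aa [Ab Hsq]].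
      - split; [|split]; try (repeat apply AutG_mul; try apply AutG_minv; assumption).
        apply mmul_cancel_r with (1 := Abe); rewrite Hcomm, Hb2, Hsq; reflexivity.
      - assert (Aa0 : AutG g (minv g al ** (al ** a ** minv g al) ** al))
          by (apply AutG_mul; [apply AutG_mul; [apply AutG_minv|]|]; assumption).
        assert (Ab0 : AutG g (minv g be ** (be ** b ** minv g be) ** be))
          by (apply AutG_mul; [apply AutG_mul; [apply AutG_minv|]|]; assumption).
        rewrite !mmul_assoc, minv_l, mmul_1_l, mul_minv_l in Aa0 by assumption.
        rewrite !mmul_assoc, minv_l, mmul_1_l, mul_minv_l in Ab0 by assumption.
        split; [exact Aa0 | split; [exact Ab0|]].
        apply mmul_cancel_l with (1 := Abe); rewrite <- Hcomm, <- Hb2, Hsq; reflexivity. }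
    split; [rewrite Hiff; unfold compatible_pair; rewrite Ea, Eb; reflexivity|].
    intros Hab s s' Es Es'; rewrite Ea, Eb in Es'.
    assert (Q := quasiconj_conj a b s s' al be Hab Aal Abe Hpath Es Es').
    destruct Q as [psi [Hpsi Hint]]; exists psi; split; [exact Hpsi|].
    intros u Lu t; rewrite (Hint u Lu t); unfold Phi_pair; rewrite Ea; reflexivity.
  - split; [symmetry; exact IH1|].
    intros Hab s s' Es Es'.
    assert (Hab0 : compatible_pair a b) by (apply IH1, Hab).
    apply (quasiconj_sym a b s' a' b' s); try assumption; apply IH2; assumption.
  - split; [rewrite IH1; exact IH3|].
    intros Hab s s' Es Es'.
    assert (Hab' : compatible_pair a' b') by (apply IH1, Hab).
    destruct Hab as [Aa [Ab Hsq]]; destruct (Hab') as [Aa' [Ab' Hsq']].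
    (* The intermediate loop algebra is the one twisted by b'^-1 a'. *)
    assert (Em : b' ** (minv g b' ** a') =m= a') by (rewrite mmul_assoc, minv_r, mmul_1_l by exact Ab'; reflexivity).
    apply quasiconj_trans with (minv g b' ** a') (Phi_pair g a').
    + apply (twist_AutG g a b); assumption.
    + apply (Phi_pair_in_L g a b); assumption.
    + apply (Phi_pair_in_L g a' b'); assumption.
    + apply IH2; [split; [exact Aa | split; assumption] | exact Es | exact Em].
    + apply IH4; assumption.
Qed.

End SmoothPaths.

(** * Linear differential equations *)

Lemma geometric_limit (u : nat -> R) c : (forall m, Rabs (u (S m) - u m) <= c * (/ 2) ^ m) ->
  exists l, Un_cv u l /\ forall m, Rabs (l - u m) <= 2 * c * (/ 2) ^ m.
Proof.
  intros H.
  assert (Hc : 0 <= c) by (specialize (H O); simpl in H; assert (P := Rabs_pos (u 1%nat - u O)); lra).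
  assert (Hp : forall m, 0 < (/ 2) ^ m) by (intros; apply pow_lt; lra).
  assert (Hmp : forall m p, Rabs (u (m + p)%nat - u m) <= 2 * c * (/ 2) ^ m - 2 * c * (/ 2) ^ (m + p)).
  { intros m p; induction p as [|p IH].
    - rewrite Nat.add_0_r, Rminus_diag, Rabs_R0; lra.
    - rewrite Nat.add_succ_r; specialize (H (m + p)%nat).
      replace (u (S (m + p)) - u m) with ((u (S (m + p)) - u (m + p)%nat) + (u (m + p)%nat - u m)) by ring.
      apply Rle_trans with (1 := Rabs_triang _ _); simpl pow; lra. }
  assert (Hle : forall m p, Rabs (u (m + p)%nat - u m) <= 2 * c * (/ 2) ^ m).
  { intros m p; specialize (Hmp m p); specialize (Hp (m + p)%nat); nra. }
  destruct (Rcomplete.R_complete u) as [l Hl].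
  - intros e He.
    destruct (pow_lt_1_zero (/ 2) ltac:(rewrite Rabs_pos_eq; lra) (e / (4 * c + 1)) ltac:(apply Rdiv_lt_0_compat; lra)) as [M HM].
    exists M; intros n m Hn Hm; unfold Rdist.
    specialize (HM M (le_n M)); rewrite Rabs_pos_eq in HM by (left; apply Hp).
    assert (HM2 : (4 * c + 1) * (/ 2) ^ M < e).
    { apply Rmult_lt_reg_r with (/ (4 * c + 1)); [apply Rinv_0_lt_compat; lra|].
      rewrite Rmult_comm, <- Rmult_assoc, Rinv_l by lra; unfold Rdiv in HM; lra. }
    assert (H1 := Hle M (n - M)%nat); assert (H2 := Hle M (m - M)%nat).
    replace (M + (n - M))%nat with n in H1 by lia; replace (M + (m - M))%nat with m in H2 by lia.
    replace (u n - u m) with ((u n - u M) - (u m - u M)) by ring.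
    apply Rle_lt_trans with (1 := Rabs_triang _ _); rewrite Rabs_Ropp.
    assert (Hp' := Hp M); lra.
  - exists l; split; [exact Hl|]; intros m.
    destruct (Rle_dec (Rabs (l - u m)) (2 * c * (/ 2) ^ m)) as [L|L]; [exact L | exfalso].
    destruct (Hl (Rabs (l - u m) - 2 * c * (/ 2) ^ m) ltac:(lra)) as [M HM].
    specialize (HM (m + M)%nat ltac:(lia)); unfold Rdist in HM.
    specialize (Hle m M).
    assert (Rabs (l - u m) <= Rabs (u (m + M)%nat - l) + Rabs (u (m + M)%nat - u m)); [|lra].
    replace (l - u m) with (- (u (m + M)%nat - l) + (u (m + M)%nat - u m)) by ring.
    rewrite <- (Rabs_Ropp (u (m + M)%nat - l)); apply Rabs_triang.
Qed.

Lemma deriv_nonneg_le (f f' : R -> R) a b : a <= b ->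
  (forall t, a <= t <= b -> derivable_pt_lim f t (f' t)) -> (forall t, a <= t <= b -> 0 <= f' t) -> f a <= f b.
Proof.
  intros Hab Hd Hp; destruct (Req_dec a b) as [->|Hne]; [lra|].
  destruct (MVT_cor2 f f' a b) as [c [Hc Hc2]]; [lra | exact Hd|].
  specialize (Hp c ltac:(lra)); nra.
Qed.

Lemma derivable_exp_lin L t : derivable_pt_lim (fun t => exp (L * t)) t (exp (L * t) * L).
Proof.
  apply (derivable_pt_lim_comp (fun t => L * t) exp); [|apply derivable_pt_lim_exp].
  apply derivable_pt_lim_eq with (L * 1); [|ring]; apply (derivable_pt_lim_scal (fun t => t)), derivable_pt_lim_id.
Qed.

Lemma exp_growth_half (f f' : R -> R) c L r : 0 <= c -> f 0 = 0 ->
  (forall t, 0 <= t <= r -> derivable_pt_lim f t (f' t)) ->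
  (forall t, 0 <= t <= r -> Rabs (f' t) <= c * (exp (L * t) * L)) ->
  forall t, 0 <= t <= r -> Rabs (f t) <= c * exp (L * t).
Proof.
  intros Hc H0 Hd Hb t Ht.
  assert (Hg : forall e, e = 1 \/ e = -1 -> 0 <= c * exp (L * t) + e * f t).
  { intros e He; apply Rle_trans with (c * exp (L * 0) + e * f 0).
    - rewrite H0, Rmult_0_r, exp_0; lra.
    - apply (deriv_nonneg_le (fun t => c * exp (L * t) + e * f t) (fun t => c * (exp (L * t) * L) + e * f' t)); [lra| |].
      + intros x Hx; apply (derivable_pt_lim_plus (fun t => c * exp (L * t)) (fun t => e * f t)).
        * apply (derivable_pt_lim_scal (fun t => exp (L * t))), derivable_exp_lin.
        * apply derivable_pt_lim_scal, Hd; lra.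
      + intros x Hx; assert (H := Hb x ltac:(lra)); apply Rabs_le_between in H; destruct He; subst; lra. }
  assert (H1 := Hg 1 ltac:(auto)); assert (H2 := Hg (-1) ltac:(auto)).
  apply Rabs_le; lra.
Qed.

Lemma exp_growth (f f' : R -> R) c L r : 0 <= c -> f 0 = 0 ->
  (forall t, - r <= t <= r -> derivable_pt_lim f t (f' t)) ->
  (forall t, - r <= t <= r -> Rabs (f' t) <= c * (exp (L * Rabs t) * L)) ->
  forall t, - r <= t <= r -> Rabs (f t) <= c * exp (L * Rabs t).
Proof.
  intros Hc H0 Hd Hb t Ht; destruct (Rle_dec 0 t) as [P|P].
  - rewrite (Rabs_pos_eq t) by exact P.
    apply (exp_growth_half f f' c L r); try assumption; try lra; intros x Hx; [apply Hd; lra|].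
    rewrite <- (Rabs_pos_eq x) at 2 by lra; apply Hb; lra.
  - rewrite (Rabs_left t) by lra; replace (f t) with (f (- - t)) by (f_equal; ring).
    apply (exp_growth_half (fun t => f (- t)) (fun t => - f' (- t)) c L r); try lra.
    + rewrite Ropp_0; exact H0.
    + intros x Hx; apply derivable_pt_lim_eq with (f' (- x) * (- 1)); [|ring].
      apply (derivable_pt_lim_comp (fun t => - t) f); [|apply Hd; lra].
      apply (derivable_pt_lim_opp (fun t => t)), derivable_pt_lim_id.
    + intros x Hx; rewrite Rabs_Ropp; rewrite <- (Rabs_pos_eq x) at 2 by lra; rewrite <- (Rabs_Ropp x).
      apply Hb; lra.
Qed.

Section ODE.
Variable g : LieData.
Let N := dim g.

Notation "A =m= B" := (meq g A B) (at level 70).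
Notation "v =v= w" := (veq g v w) (at level 70).
Notation "A ** B" := (mmul g A B) (at level 40, left associativity).
Notation "A $ v" := (mapply g A v) (at level 45, right associativity).

Lemma msmooth_bounded X a b : msmooth g X -> a <= b ->
  exists K, 0 < K /\ forall i j t, (i < N)%nat -> (j < N)%nat -> a <= t <= b -> Rabs (X t i j) <= K.
Proof.
  intros SX Hab.
  (* One plus the sum of squares dominates the absolute value of each entry, and unlike that
     absolute value it is smooth. *)
  set (F := fun t => 1 + rsum N (fun i => rsum N (fun j => X t i j * X t i j))).
  assert (SF : smooth F).
  { apply smooth_plus; [apply smooth_const|].
    apply (smooth_rsum N (fun i t => rsum N (fun j => X t i j * X t i j))); intros i Hi.
    apply (smooth_rsum N (fun j t => X t i j * X t i j)); intros j Hj; apply smooth_mult; apply SX; assumption. }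
  assert (Hnn : forall t i, 0 <= rsum N (fun j => X t i j * X t i j)).
  { intros; apply rsum_nonneg; intros; apply Rle_0_sqr. }
  destruct (continuity_ab_maj F a b Hab) as [m [Hm _]]; [intros; apply smooth_continuity, SF|].
  exists (F m); split.
  - unfold F; assert (0 <= rsum N (fun i => rsum N (fun j => X m i j * X m i j))) by (apply rsum_nonneg; auto); lra.
  - intros i j t Hi Hj Ht; apply Rle_trans with (2 := Hm t Ht); unfold F.
    assert (H1 := rsum_ge_term N (fun i => rsum N (fun j => X t i j * X t i j)) i (fun k _ => Hnn t k) Hi).
    assert (H2 := rsum_ge_term N (fun j => X t i j * X t i j) j (fun k _ => Rle_0_sqr _) Hj).
    cbv beta in H1, H2; unfold Rabs; destruct Rcase_abs; nra.
Qed.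

Section Solve.
Variable X : R -> mat.
Hypothesis SX : msmooth g X.

Lemma picard_step (x0 : vec) (v : R -> vec) : vsmooth g v ->
  exists w, vsmooth g w /\ (forall i, (i < N)%nat -> w 0 i = x0 i) /\ forall t, vderiv g w t (X t $ v t).
Proof.
  intros Sv.
  destruct (choice_lt (fun _ => 0) N _ (fun i Hi => smooth_antiderivative (fun t => (X t $ v t) i) 0 (x0 i)
    (vsmooth_mapply g X v SX Sv i Hi))) as [F HF].
  exists (fun t i => F i t); split; [|split].
  - intros i Hi; apply HF, Hi.
  - intros i Hi; apply HF, Hi.
  - intros t i Hi; apply HF, Hi.
Qed.

(** Picard iteration measured with the weight exp(L |t|): for large [L] every step halves the
    weighted distance. Convergence is therefore uniform on every bounded interval and the solution
    is global. *)
Theorem linear_ode_solution (x0 : vec) :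
  exists y, vsmooth g y /\ y 0 =v= x0 /\ forall t, vderiv g y t (X t $ y t).
Proof.
  assert (st : forall v : {v | vsmooth g v}, exists w : {v | vsmooth g v},
    (forall i, (i < N)%nat -> proj1_sig w 0 i = x0 i) /\
    forall t, vderiv g (proj1_sig w) t (X t $ proj1_sig v t)).
  { intros [v Sv]; destruct (picard_step x0 v Sv) as [w [Sw Hw]]; exists (exist _ w Sw); exact Hw. }
  destruct (functional_choice _ st) as [next Hnext].
  set (Y := fun m => proj1_sig (Nat.iter m next (exist _ (fun _ => x0) (vsmooth_const g x0)))).
  assert (SY : forall m, vsmooth g (Y m)) by (intros m; exact (proj2_sig (Nat.iter m next _))).
  assert (Y0 : forall m i, (i < N)%nat -> Y m 0 i = x0 i).
  { intros [|m] i Hi; [reflexivity|].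
    apply Hnext, Hi. }
  assert (DY : forall m t, vderiv g (Y (S m)) t (X t $ Y m t)).
  { intros m; apply Hnext. }
  clearbody Y; clear next st Hnext.
  assert (Hgeo : forall r, 0 < r -> exists c, forall i m t, (i < N)%nat -> - r <= t <= r ->
    Rabs (Y (S m) t i - Y m t i) <= c * (/ 2) ^ m).
  { intros r Hr; destruct (msmooth_bounded X (- r) r SX ltac:(lra)) as [K [HK HX]].
    destruct (msmooth_bounded (fun t i j => Y 1%nat t i - Y O t i) (- r) r) as [C [HC HY]]; [|lra|].
    { intros i j Hi Hj; apply smooth_minus; apply SY; assumption. }
    assert (Hn := pos_INR N).
    (* Twice the Lipschitz constant [INR N * K] gives the factor 1/2; the summand 1 keeps [L]
       positive also in dimension 0. *)
    set (L := 2 * (INR N * K) + 1).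
    assert (HL : 0 < L) by (assert (0 <= INR N * K) by (apply Rmult_le_pos; lra); unfold L; lra).
    assert (Hind : forall m i t, (i < N)%nat -> - r <= t <= r ->
      Rabs (Y (S m) t i - Y m t i) <= C * (/ 2) ^ m * exp (L * Rabs t)).
    { induction m as [|m IH]; intros i t Hi Ht.
      - apply Rle_trans with (C * 1); [rewrite Rmult_1_r; apply (HY i i); assumption|].
        replace (C * (/ 2) ^ 0) with C by (simpl; ring); apply Rmult_le_compat_l; [lra|].
        rewrite <- exp_0; destruct (Req_dec t 0) as [->|Ht0]; [rewrite Rabs_R0, Rmult_0_r; lra|].
        left; apply exp_increasing, Rmult_lt_0_compat; [exact HL | apply Rabs_pos_lt, Ht0].
      - assert (Hp : 0 < (/ 2) ^ m) by (apply pow_lt; lra).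
        apply (exp_growth (fun t => Y (S (S m)) t i - Y (S m) t i)
          (fun t => (X t $ Y (S m) t) i - (X t $ Y m t) i) (C * (/ 2) ^ S m) L r); try exact Ht.
        + simpl; apply Rmult_le_pos; lra.
        + rewrite !Y0 by exact Hi; ring.
        + intros x Hx; apply (derivable_pt_lim_minus (fun t => Y (S (S m)) t i) (fun t => Y (S m) t i)); apply DY, Hi.
        + intros x Hx; unfold mapply.
          replace (rsum (dim g) (fun j => X x i j * Y (S m) x j) - rsum (dim g) (fun j => X x i j * Y m x j))
            with (rsum N (fun j => X x i j * (Y (S m) x j - Y m x j))).
          2:{ rewrite <- rsum_minus; apply rsum_ext; intros; ring. }
          apply Rle_trans with (INR N * (K * (C * (/ 2) ^ m * exp (L * Rabs x)))).
          * apply rsum_Rabs_le; intros j Hj; rewrite Rabs_mult.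
            apply Rmult_le_compat; try apply Rabs_pos; [apply HX | apply IH]; assumption.
          * assert (He : 0 < exp (L * Rabs x)) by apply exp_pos.
            replace (INR N * (K * (C * (/ 2) ^ m * exp (L * Rabs x))))
              with (C * (/ 2) ^ m * exp (L * Rabs x) * (INR N * K)) by ring.
            replace (C * (/ 2) ^ S m * (exp (L * Rabs x) * L))
              with (C * (/ 2) ^ m * exp (L * Rabs x) * (/ 2 * L)) by (simpl; ring).
            apply Rmult_le_compat_l; [|unfold L; lra].
            apply Rmult_le_pos; [apply Rmult_le_pos|]; lra. }
    exists (C * exp (L * r)); intros i m t Hi Ht.
    apply Rle_trans with (1 := Hind m i t Hi Ht).
    replace (C * exp (L * r) * (/ 2) ^ m) with (C * (/ 2) ^ m * exp (L * r)) by ring.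
    apply Rmult_le_compat_l; [apply Rmult_le_pos; [lra | apply pow_le; lra]|].
    assert (Hle : L * Rabs t <= L * r) by (apply Rmult_le_compat_l; [lra | apply Rabs_le; lra]).
    destruct (Req_dec (L * Rabs t) (L * r)) as [->|Hne]; [lra | left; apply exp_increasing; lra]. }
  assert (Hlim : forall t, exists l, forall i, (i < N)%nat -> Un_cv (fun m => Y m t i) (l i)).
  { intros t; apply (choice_lt 0 N (fun i l => Un_cv (fun m => Y m t i) l)); intros i Hi.
    destruct (Hgeo (Rabs t + 1)) as [c Hc]; [assert (P := Rabs_pos t); lra|].
    destruct (geometric_limit (fun m => Y m t i) c) as [l [Hl _]].
    - intros m; apply Hc; [exact Hi|]; assert (P := Rle_abs t); assert (P' := Rle_abs (- t)).
      rewrite Rabs_Ropp in P'; lra.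
    - exists l; exact Hl. }
  destruct (functional_choice _ Hlim) as [y Hy].
  assert (Hunif : forall r, 0 < r -> exists c, 0 <= c /\ forall i m t, (i < N)%nat -> - r <= t <= r ->
    Rabs (y t i - Y m t i) <= c * (/ 2) ^ m).
  { intros r Hr; destruct (Hgeo r Hr) as [c Hc]; exists (2 * Rabs c); split; [assert (P := Rabs_pos c); lra|].
    intros i m t Hi Ht.
    destruct (geometric_limit (fun m => Y m t i) c) as [l [Hl Hb]]; [intros; apply Hc; assumption|].
    rewrite (UL_sequence _ _ _ (Hy t i Hi) Hl).
    apply Rle_trans with (1 := Hb m); apply Rmult_le_compat_r; [apply pow_le; lra|].
    assert (P := Rle_abs c); lra. }
  assert (Dy : forall t, vderiv g y t (X t $ y t)).
  { intros t i Hi; set (r := Rabs t + 1).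
    assert (Hr : 0 < r) by (unfold r; assert (P := Rabs_pos t); lra).
    assert (Hball : forall z, Boule 0 (mkposreal r Hr) z -> - r <= z <= r).
    { intros z Hz; unfold Boule in Hz; simpl in Hz; rewrite Rminus_0_r in Hz; apply Rabs_def2 in Hz; lra. }
    (* Uniform convergence of the derivatives allows passing to the limit in the differential
       equation. *)
    assert (HCVU : CVU (fun m t => (X t $ Y m t) i) (fun t => (X t $ y t) i) 0 (mkposreal r Hr)).
    { destruct (msmooth_bounded X (- r) r SX ltac:(lra)) as [K [HK HX]].
      destruct (Hunif r Hr) as [c [Hc0 Hc]].
      intros e He.
      assert (Hn := pos_INR N).
      set (B := INR N * (K * c) + 1).
      assert (HB : 0 < B) by (assert (0 <= INR N * (K * c)) by (apply Rmult_le_pos; [lra | apply Rmult_le_pos; lra]); unfold B; lra).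
      destruct (pow_lt_1_zero (/ 2) ltac:(rewrite Rabs_pos_eq; lra) (e / B) ltac:(apply Rdiv_lt_0_compat; lra)) as [M HM].
      exists M; intros m z Hm Hz; apply Hball in Hz; unfold mapply.
      replace (rsum (dim g) (fun j => X z i j * y z j) - rsum (dim g) (fun j => X z i j * Y m z j))
        with (rsum N (fun j => X z i j * (y z j - Y m z j))).
      2:{ rewrite <- rsum_minus; apply rsum_ext; intros; ring. }
      specialize (HM m Hm); rewrite Rabs_pos_eq in HM by (apply pow_le; lra).
      apply Rle_lt_trans with (INR N * (K * (c * (/ 2) ^ m))).
      - apply rsum_Rabs_le; intros j Hj; rewrite Rabs_mult.
        apply Rmult_le_compat; try apply Rabs_pos; [apply HX | apply Hc]; assumption.
      - replace (INR N * (K * (c * (/ 2) ^ m))) with (INR N * (K * c) * (/ 2) ^ m) by ring.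
        apply Rle_lt_trans with (B * (/ 2) ^ m); [apply Rmult_le_compat_r; [apply pow_le; lra | unfold B; lra]|].
        apply Rlt_le_trans with (B * (e / B)); [apply Rmult_lt_compat_l; assumption | right; field; lra]. }
    apply (derivable_pt_lim_CVU (fun m t => Y (S m) t i) (fun m t => (X t $ Y m t) i) (fun t => y t i)
      (fun t => (X t $ y t) i) t 0 (mkposreal r Hr)).
    - unfold Boule; simpl; rewrite Rminus_0_r; unfold r; lra.
    - intros z m _; apply DY, Hi.
    - intros z _ e He; destruct (Hy z i Hi e He) as [M HM]; exists M; intros m Hm; apply HM; lia.
    - exact HCVU.
    - apply (CVU_continuity _ _ _ _ HCVU); intros m z _.
      apply smooth_continuity, (vsmooth_mapply g X (Y m) SX (SY m) i Hi). }
  exists y; split; [|split; [|exact Dy]].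
  - intros i Hi.
    apply (smooth_upto (fun f => exists i, (i < N)%nat /\ f = fun t => y t i)); [|apply gen_base; exists i; auto].
    intros f [k [Hk ->]]; exists (fun t => (X t $ y t) k); split; [|intros t; apply Dy, Hk].
    apply gen_rsum; intros j Hj; apply gen_mult; [apply gen_smooth, SX; assumption | apply gen_base; exists j; auto].
  - intros i Hi; apply UL_sequence with (1 := Hy 0 i Hi).
    intros e He; exists O; intros m _; unfold Rdist; rewrite Y0 by exact Hi.
    rewrite Rminus_diag, Rabs_R0; exact He.
Qed.

(** Gronwall's argument for E = |v|^2: from |E'| <= L E the functions E exp(-L t) and E exp(L t) are
    decreasing and increasing, so a zero of [E] spreads in both directions. *)
Theorem linear_ode_zero (v : R -> vec) t0 : (forall t, vderiv g v t (X t $ v t)) -> v t0 =v= vzero ->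
  forall t, v t =v= vzero.
Proof.
  intros Dv H0 t1.
  set (a := Rmin t0 t1); set (b := Rmax t0 t1).
  assert (Hab : a <= t0 <= b /\ a <= t1 <= b)
    by (unfold a, b; split; split; try apply Rmin_l; try apply Rmin_r; try apply Rmax_l; apply Rmax_r).
  destruct (msmooth_bounded X a b SX ltac:(lra)) as [K [HK HX]].
  set (E := fun t => rsum N (fun i => v t i * v t i)).
  set (E' := fun t => rsum N (fun i => (X t $ v t) i * v t i + v t i * (X t $ v t) i)).
  assert (DE : forall t, derivable_pt_lim E t (E' t)).
  { intros t; apply (rsum_derivable N (fun i t => v t i * v t i)
      (fun i t => (X t $ v t) i * v t i + v t i * (X t $ v t) i)); intros i Hi.
    apply (derivable_pt_lim_mult (fun t => v t i) (fun t => v t i)); apply Dv, Hi. }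
  assert (Enn : forall t, 0 <= E t) by (intros; apply rsum_nonneg; intros; apply Rle_0_sqr).
  set (L := 2 * (INR N * K)).
  assert (HE : forall t, a <= t <= b -> Rabs (E' t) <= L * E t).
  { intros t Ht.
    assert (Es : L * E t = rsum N (fun i => rsum N (fun j => K * (v t i * v t i + v t j * v t j)))).
    { transitivity (rsum N (fun i => INR N * (K * (v t i * v t i)) + K * E t)).
      - rewrite rsum_plus, rsum_const; unfold L.
        rewrite (rsum_ext N _ (fun i => INR N * K * (v t i * v t i))) by (intros; ring).
        rewrite rsum_scal; fold (E t); ring.
      - apply rsum_ext; intros i Hi; unfold E; rewrite <- rsum_const, <- rsum_scal, <- rsum_plus.
        apply rsum_ext; intros; ring. }
    rewrite Es; unfold E'; apply Rle_trans with (1 := rsum_Rabs _ _); apply rsum_le; intros i Hi.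
    unfold mapply.
    replace (rsum (dim g) (fun j => X t i j * v t j) * v t i + v t i * rsum (dim g) (fun j => X t i j * v t j))
      with (rsum N (fun j => X t i j * (2 * (v t i * v t j)))).
    2:{ replace (rsum (dim g) (fun j => X t i j * v t j) * v t i + v t i * rsum (dim g) (fun j => X t i j * v t j))
          with (2 * v t i * rsum (dim g) (fun j => X t i j * v t j)) by ring.
        rewrite <- rsum_scal; apply rsum_ext; intros; ring. }
    apply Rle_trans with (1 := rsum_Rabs _ _); apply rsum_le; intros j Hj; rewrite Rabs_mult.
    apply Rmult_le_compat; try apply Rabs_pos; [apply HX; assumption|].
    assert (Q1 := Rle_0_sqr (v t i - v t j)); assert (Q2 := Rle_0_sqr (v t i + v t j)).
    unfold Rsqr in Q1, Q2; apply Rabs_le; split; lra. }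
  assert (HE0 : E t0 = 0) by (apply rsum_zero; intros i Hi; rewrite (H0 i Hi); unfold vzero; ring).
  assert (HE1 : E t1 <= 0).
  { assert (Dg : forall c t, derivable_pt_lim (fun t => E t * exp (c * t)) t ((E' t + c * E t) * exp (c * t))).
    { intros c t; apply derivable_pt_lim_eq with (E' t * exp (c * t) + E t * (exp (c * t) * c)); [|ring].
      apply (derivable_pt_lim_mult E (fun t => exp (c * t))); [apply DE | apply derivable_exp_lin]. }
    destruct (Rle_dec t0 t1) as [Hle|Hle].
    - assert (H := deriv_nonneg_le (fun t => - (E t * exp (- L * t))) (fun t => - ((E' t + - L * E t) * exp (- L * t)))
        t0 t1 Hle (fun t _ => derivable_pt_lim_opp _ _ _ (Dg (- L) t))).
      cbv beta in H; rewrite HE0, Rmult_0_l in H.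
      assert (Hp := exp_pos (- L * t1)).
      assert (E t1 * exp (- L * t1) <= 0); [|nra].
      assert (- 0 <= - (E t1 * exp (- L * t1))); [|lra].
      apply H; intros t Ht; assert (Hb := HE t ltac:(lra)); apply Rabs_le_between in Hb.
      assert (Hp' := exp_pos (- L * t)); nra.
    - assert (H := deriv_nonneg_le (fun t => E t * exp (L * t)) (fun t => (E' t + L * E t) * exp (L * t))
        t1 t0 ltac:(lra) (fun t _ => Dg L t)).
      cbv beta in H; rewrite HE0, Rmult_0_l in H.
      assert (Hp := exp_pos (L * t1)).
      assert (E t1 * exp (L * t1) <= 0); [|nra].
      apply H; intros t Ht; assert (Hb := HE t ltac:(lra)); apply Rabs_le_between in Hb.
      assert (Hp' := exp_pos (L * t)); nra. }
  intros i Hi; unfold vzero.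
  assert (H1 := rsum_ge_term N (fun i => v t1 i * v t1 i) i (fun k _ => Rle_0_sqr _) Hi).
  cbv beta in H1; fold (E t1) in H1; nra.
Qed.

Lemma linear_ode_unique (v w : R -> vec) t0 : (forall t, vderiv g v t (X t $ v t)) ->
  (forall t, vderiv g w t (X t $ w t)) -> v t0 =v= w t0 -> forall t, v t =v= w t.
Proof.
  intros Dv Dw E t.
  assert (H : vadd (v t) (vscal (-1) (w t)) =v= vzero).
  { apply (linear_ode_zero (fun t => vadd (v t) (vscal (-1) (w t))) t0).
    - intros r i Hi.
      apply derivable_pt_lim_eq with ((X r $ v r) i + (-1) * (X r $ w r) i).
      + apply (derivable_pt_lim_plus (fun t => v t i) (fun t => (-1) * w t i)); [apply Dv, Hi|].
        apply derivable_pt_lim_scal, Dw, Hi.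
      + rewrite (mapply_vadd g (X r) (v r) _ i Hi); unfold vadd; f_equal.
        rewrite (mapply_vscal g (X r) _ _ i Hi); reflexivity.
    - rewrite E; intros i _; unfold vadd, vscal, vzero; ring. }
  intros i Hi; specialize (H i Hi); unfold vadd, vscal, vzero in H; lra.
Qed.

Lemma matrix_ode_unique P Q t0 : (forall t, mderiv g P t (X t ** P t)) ->
  (forall t, mderiv g Q t (X t ** Q t)) -> P t0 =m= Q t0 -> forall t, P t =m= Q t.
Proof.
  intros DP DQ E t i j Hi Hj.
  apply (linear_ode_unique (fun t i => P t i j) (fun t i => Q t i j) t0).
  - intros r k Hk; apply DP; assumption.
  - intros r k Hk; apply DQ; assumption.
  - intros k Hk; apply E; assumption.
  - exact Hi.
Qed.

End Solve.

Lemma matrix_ode_solution X t0 : msmooth g X ->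
  exists Y, msmooth g Y /\ Y t0 =m= mid /\ forall t, mderiv g Y t (X t ** Y t).
Proof.
  intros SX.
  assert (SX' : msmooth g (fun t => X (t + t0))).
  { apply (msmooth_comp g X (fun t => t + t0) SX), smooth_plus; [apply smooth_id | apply smooth_const]. }
  destruct (functional_choice _ (fun j => linear_ode_solution (fun t => X (t + t0)) SX' (basis j))) as [y Hy].
  exists (fun t i j => y j (t - t0) i); split; [|split].
  - intros i j Hi Hj; apply (smooth_comp (fun t => y j t i) (fun t => t - t0)); [apply Hy, Hi|].
    apply smooth_minus; [apply smooth_id | apply smooth_const].
  - intros i j Hi Hj; rewrite Rminus_diag, (proj1 (proj2 (Hy j)) i Hi); reflexivity.
  - intros t i j Hi Hj.
    assert (D := proj2 (proj2 (Hy j)) (t - t0) i Hi).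
    replace (t - t0 + t0) with t in D by ring.
    apply derivable_pt_lim_eq with ((X t $ y j (t - t0)) i * (1 - 0)); [|unfold mapply, mmul; ring].
    apply (derivable_pt_lim_comp (fun t => t - t0) (fun t => y j t i)); [|exact D].
    apply (derivable_pt_lim_minus (fun t => t) (fun _ => t0)); [apply derivable_pt_lim_id | apply derivable_pt_lim_const].
Qed.

Lemma mderiv_mul P Q t dP dQ : mderiv g P t dP -> mderiv g Q t dQ ->
  mderiv g (fun t => P t ** Q t) t (fun i j => (dP ** Q t) i j + (P t ** dQ) i j).
Proof.
  intros HP HQ i j Hi Hj; unfold mmul; rewrite <- rsum_plus.
  apply (rsum_derivable _ (fun l t => P t i l * Q t l j) (fun l _ => dP i l * Q t l j + P t i l * dQ l j)).
  intros l Hl; apply (derivable_pt_lim_mult (fun t => P t i l) (fun t => Q t l j)); [apply HP | apply HQ]; assumption.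
Qed.

Lemma mderiv_const A t : mderiv g (fun _ => A) t (fun _ _ => 0).
Proof. intros i j _ _; apply derivable_pt_lim_const. Qed.

Lemma mderiv_eq P t dP dP' : mderiv g P t dP -> dP =m= dP' -> mderiv g P t dP'.
Proof. intros H E i j Hi Hj; apply derivable_pt_lim_eq with (1 := H i j Hi Hj), E; assumption. Qed.

Lemma mmul_0_l A : (fun _ _ => 0) ** A =m= (fun _ _ => 0).
Proof. intros i j _ _; unfold mmul; apply rsum_zero; intros; ring. Qed.

Lemma mmul_0_r A : A ** (fun _ _ => 0) =m= (fun _ _ => 0).
Proof. intros i j _ _; unfold mmul; apply rsum_zero; intros; ring. Qed.

Lemma mderiv_const_mul A P t dP : mderiv g P t dP -> mderiv g (fun t => A ** P t) t (A ** dP).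
Proof.
  intros HP; eapply mderiv_eq; [apply (mderiv_mul (fun _ => A) P); [apply mderiv_const | exact HP]|].
  intros i j Hi Hj; cbv beta; rewrite (mmul_0_l (P t) i j Hi Hj); ring.
Qed.

Lemma mderiv_mul_const A P t dP : mderiv g P t dP -> mderiv g (fun t => P t ** A) t (dP ** A).
Proof.
  intros HP; eapply mderiv_eq; [apply (mderiv_mul P (fun _ => A)); [exact HP | apply mderiv_const]|].
  intros i j Hi Hj; cbv beta; rewrite (mmul_0_r (P t) i j Hi Hj); ring.
Qed.

Lemma mderiv_comp P f t dP df : mderiv g P (f t) dP -> derivable_pt_lim f t df ->
  mderiv g (fun t => P (f t)) t (fun i j => df * dP i j).
Proof.
  intros HP Hf i j Hi Hj; rewrite Rmult_comm.
  apply (derivable_pt_lim_comp f (fun t => P t i j)); [exact Hf | apply HP; assumption].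
Qed.

Lemma mderiv_unique P t A B : mderiv g P t A -> mderiv g P t B -> A =m= B.
Proof. intros HA HB i j Hi Hj; apply uniqueness_limite with (1 := HA i j Hi Hj), HB; assumption. Qed.

Lemma mderiv_ext P Q t dP : (forall t, P t =m= Q t) -> mderiv g P t dP -> mderiv g Q t dP.
Proof.
  intros E HP i j Hi Hj; apply derivable_pt_lim_ext with (2 := HP i j Hi Hj).
  intros y; apply E; assumption.
Qed.

(** * Flows of derivations and logarithmic derivatives *)

Definition is_derivation (C : mat) : Prop :=
  (forall x y, C $ br g x y =v= vadd (br g (C $ x) y) (br g x (C $ y))) /\
  (cx g = true -> C ** Jm g =m= Jm g ** C).

(** Y_t [x, y] and [Y_t x, Y_t y] solve the same linear equation exactly because X_t is a
    derivation, and they agree at 0. Commutation with the complex structure follows in the same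
    way. *)
Theorem derivation_flow X : msmooth g X -> (forall t, is_derivation (X t)) ->
  exists Y Z, msmooth g Y /\ msmooth g Z /\ Y 0 =m= mid /\ (forall t, AutG g (Y t)) /\
    (forall t, inverse_of g (Y t) (Z t)) /\ forall t, mderiv g Y t (X t ** Y t).
Proof.
  intros SX HX.
  destruct (matrix_ode_solution X 0 SX) as [Y [SY [Y0 DY]]].
  (* The inverse solves Z' = -Z X, where the coefficient stands on the right; transposition brings
     this equation into the standard form. *)
  destruct (matrix_ode_solution (fun t i j => - X t j i) 0) as [W [SW [W0 DW]]].
  { intros i j Hi Hj; apply smooth_opp, SX; assumption. }
  set (Z := fun t i j => W t j i).
  assert (SZ : msmooth g Z) by (intros i j Hi Hj; apply SW; assumption).
  assert (DZ : forall t, mderiv g Z t (fun i j => - (Z t ** X t) i j)).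
  { intros t i j Hi Hj; apply derivable_pt_lim_eq with (1 := DW t j i Hj Hi).
    unfold mmul, Z; rewrite <- (Rmult_1_l (rsum _ (fun l => W t l i * X t l j))), Ropp_mult_distr_l, <- rsum_scal.
    apply rsum_ext; intros; ring. }
  assert (HZY : forall t, Z t ** Y t =m= mid).
  { intros t.
    assert (HD : forall t, mderiv g (fun t => Z t ** Y t) t (fun _ _ => 0)).
    { intros r; eapply mderiv_eq; [apply (mderiv_mul Z Y); [apply DZ | apply DY]|].
      intros i j Hi Hj; cbv beta.
      rewrite (mmul_assoc g (Z r) (X r) (Y r) i j Hi Hj).
      unfold mmul at 1; rewrite (rsum_ext _ _ (fun l => (-1) * ((Z r ** X r) i l * Y r l j))) by (intros; ring).
      rewrite rsum_scal; unfold mmul at 2; ring. }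
    intros i j Hi Hj.
    rewrite (deriv_zero_const (fun t => (Z t ** Y t) i j) 0 t) by (intros; apply HD; assumption).
    assert (E : Z 0 ** Y 0 =m= mid).
    { rewrite Y0, mmul_1_r; intros a b Ha Hb; unfold Z; rewrite W0 by assumption; unfold mid.
      rewrite Nat.eqb_sym; reflexivity. }
    apply E; assumption. }
  (* The solution [V] normalised at [t] is Y V(0), so Y_t has the right inverse V(0), which must
     coincide with the left inverse Z_t. *)
  assert (HYZ : forall t, Y t ** Z t =m= mid).
  { intros t; destruct (matrix_ode_solution X t SX) as [V [SV [V0 DV]]].
    assert (E : forall r, V r =m= Y r ** V 0).
    { apply (matrix_ode_unique X SX V (fun r => Y r ** V 0) 0); [exact DV| |].
      - intros r; eapply mderiv_eq; [apply mderiv_mul_const, DY | rewrite mmul_assoc; reflexivity].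
      - rewrite Y0, mmul_1_l; reflexivity. }
    assert (E1 : Y t ** V 0 =m= mid) by (rewrite <- E; exact V0).
    assert (E2 : Z t =m= V 0).
    { rewrite <- (mmul_1_r g (Z t)), <- E1, mmul_assoc, HZY, mmul_1_l; reflexivity. }
    rewrite E2; exact E1. }
  exists Y, Z; split; [exact SY | split; [exact SZ | split; [exact Y0 | split; [|split; [|exact DY]]]]].
  - intros t; split; [|split].
    + intros Hc; apply (matrix_ode_unique X SX (fun t => Y t ** Jm g) (fun t => Jm g ** Y t) 0).
      * intros r; eapply mderiv_eq; [apply mderiv_mul_const, DY | rewrite mmul_assoc; reflexivity].
      * intros r; eapply mderiv_eq; [apply mderiv_const_mul, DY|].
        rewrite mmul_assoc, <- (proj2 (HX r) Hc), <- mmul_assoc; reflexivity.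
      * rewrite Y0, mmul_1_l, mmul_1_r; reflexivity.
    + intros x y.
      assert (Dv : forall z r, vderiv g (fun t => Y t $ z) r (X r $ Y r $ z)).
      { intros z r; eapply vderiv_eq; [apply (vderiv_mapply g Y (fun _ => z)); [apply DY | apply vderiv_const]|].
        rewrite mapply_mmul, mapply_zero; intros i _; unfold vadd, vzero; ring. }
      apply (linear_ode_unique X SX (fun t => Y t $ br g x y) (fun t => br g (Y t $ x) (Y t $ y)) 0).
      * intros r; apply Dv.
      * intros r; eapply vderiv_eq; [apply (vderiv_br g (fun t => Y t $ x) (fun t => Y t $ y)); apply Dv|].
        symmetry; apply HX.
      * rewrite !Y0, !mapply_1; reflexivity.
    + exists (Z t); split; [apply HYZ | apply HZY].
  - intros t; split; [apply HYZ | apply HZY].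
Qed.

(** Differentiate P [x', y'] = [P x', P y'] at [t], where x' and y' are the preimages of x and y
    under P_t. *)
Lemma log_derivative_derivation P t C : (forall t, AutG g (P t)) -> mderiv g P t (C ** P t) -> is_derivation C.
Proof.
  intros AP DP; split.
  - intros x y.
    set (x' := minv g (P t) $ x); set (y' := minv g (P t) $ y).
    assert (Ex : P t $ x' =v= x) by (unfold x'; rewrite <- mapply_mmul, minv_r, mapply_1 by apply AP; reflexivity).
    assert (Ey : P t $ y' =v= y) by (unfold y'; rewrite <- mapply_mmul, minv_r, mapply_1 by apply AP; reflexivity).
    assert (Dv : forall z, vderiv g (fun t => P t $ z) t (C $ P t $ z)).
    { intros z; eapply vderiv_eq; [apply (vderiv_mapply g P (fun _ => z)); [exact DP | apply vderiv_const]|].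
      rewrite mapply_mmul, mapply_zero; intros i _; unfold vadd, vzero; ring. }
    assert (D2 := vderiv_br g (fun t => P t $ x') (fun t => P t $ y') t _ _ (Dv x') (Dv y')).
    assert (E : C $ P t $ br g x' y' =v= vadd (br g (C $ P t $ x') (P t $ y')) (br g (P t $ x') (C $ P t $ y'))).
    { intros i Hi; apply uniqueness_limite with (1 := Dv (br g x' y') i Hi).
      apply derivable_pt_lim_ext with (2 := D2 i Hi); intros r; symmetry; apply (proj1 (proj2 (AP r))), Hi. }
    rewrite (proj1 (proj2 (AP t))), Ex, Ey in E; exact E.
  - intros Hc; apply mmul_cancel_r with (1 := AP t).
    rewrite <- !mmul_assoc, <- (proj1 (AP t) Hc), mmul_assoc.
    apply (mderiv_unique (fun t => P t ** Jm g) t).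
    + apply mderiv_mul_const, DP.
    + apply mderiv_ext with (fun t => Jm g ** P t).
      * intros r; symmetry; apply (proj1 (AP r) Hc).
      * apply mderiv_const_mul, DP.
Qed.

End ODE.

(** * Automorphisms of the second kind *)

Section SecondKind.
Variable g : LieData.
Let N := dim g.

Notation "A =m= B" := (meq g A B) (at level 70).
Notation "v =v= w" := (veq g v w) (at level 70).
Notation "A ** B" := (mmul g A B) (at level 40, left associativity).
Notation "A $ v" := (mapply g A v) (at level 45, right associativity).

Hypothesis simple_g : simple g.

Lemma lpow_in_L s Phi k u : (forall u, in_L g s u -> in_L g s (Phi u)) -> in_L g s u -> in_L g s (lpow Phi k u).
Proof. intros H Lu; induction k as [|k IH]; simpl; [exact Lu | apply H, IH]. Qed.

Section Iterates.
Variables (s : mat) (Phi : loop -> loop) (lam : R -> R) (phi : R -> mat).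
Hypotheses (As : AutG g s) (HPhi : LAut g s Phi).
Hypotheses (Slam : smooth lam) (Hlam : forall t, lam (t + 2 * PI) = lam t - 2 * PI).
Hypotheses (Sphi : msmooth g phi) (Aphi : forall t, AutG g (phi t)).
Hypothesis Hform : forall u, in_L g s u -> forall t, Phi u t =v= phi t $ u (lam t).

Fixpoint iter_lam (k : nat) (t : R) : R := match k with O => t | S k' => iter_lam k' (lam t) end.
Fixpoint iter_phi (k : nat) (t : R) : mat := match k with O => mid | S k' => phi t ** iter_phi k' (lam t) end.

Lemma iter_form k u : in_L g s u -> forall t, lpow Phi k u t =v= iter_phi k t $ u (iter_lam k t).
Proof.
  intros Lu; induction k as [|k IH]; intros t; simpl; [rewrite mapply_1; reflexivity|].
  rewrite Hform by (apply lpow_in_L; [apply HPhi | exact Lu]).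
  rewrite (IH (lam t)), mapply_mmul; reflexivity.
Qed.

Lemma iter_lam_smooth k : smooth (iter_lam k).
Proof.
  induction k as [|k IH]; [apply smooth_id | apply (smooth_comp (iter_lam k) lam IH Slam)].
Qed.

Lemma iter_phi_smooth k : msmooth g (iter_phi k).
Proof.
  induction k as [|k IH]; simpl; [apply msmooth_const|].
  apply (msmooth_mul g phi (fun t => iter_phi k (lam t)) Sphi), (msmooth_comp g _ _ IH Slam).
Qed.

Lemma iter_phi_AutG k t : AutG g (iter_phi k t).
Proof. revert t; induction k as [|k IH]; intros t; simpl; [apply AutG_1 | apply AutG_mul; auto]. Qed.

Lemma iter_lam_period k t : iter_lam k (t + 2 * PI) = iter_lam k t + (-1) ^ k * (2 * PI) /\
  iter_lam k (t - 2 * PI) = iter_lam k t - (-1) ^ k * (2 * PI).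
Proof.
  assert (Hlam' : forall t, lam (t - 2 * PI) = lam t + 2 * PI).
  { intros r; assert (E := Hlam (r - 2 * PI)); replace (r - 2 * PI + 2 * PI) with r in E by ring; lra. }
  revert t; induction k as [|k IH]; intros t; simpl; [split; ring|].
  rewrite Hlam, Hlam', (proj1 (IH _)), (proj2 (IH _)); split; ring.
Qed.

Lemma trivial_iterate_shift k : (forall u, in_L g s u -> leqL g (lpow Phi k u) u) ->
  exists m : Z, forall t, iter_lam k t = t + 2 * PI * IZR m.
Proof.
  intros Hk.
  destruct (continuous_2PI_valued_const (fun t => iter_lam k t - t)) as [m Hm].
  - apply smooth_continuity, smooth_minus; [apply iter_lam_smooth | apply smooth_id].
  - intros t.
    destruct (evaluation_point g simple_g s (iter_phi k t) mid (iter_lam k t) t As (iter_phi_AutG k t)) as [m Hm].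
    + intros u Lu; rewrite mapply_1, <- iter_form by exact Lu; apply Hk, Lu.
    + exists m; lra.
  - exists m; intros t; specialize (Hm t); lra.
Qed.

(** A trivial iterate makes lam^k a translation, which commutes with the shift by 2 pi, while lam^k
    multiplies that shift by (-1)^k. *)
Lemma trivial_iterate_even k : (forall u, in_L g s u -> leqL g (lpow Phi k u) u) -> Nat.Even k.
Proof.
  intros Hk; destruct (trivial_iterate_shift k Hk) as [m Hm].
  destruct (Nat.Even_or_Odd k) as [E|[j Ej]]; [exact E | exfalso].
  assert (H := proj1 (iter_lam_period k 0)); rewrite !Hm in H.
  replace ((-1) ^ k) with (-1) in H; [assert (HPI := PI_RGT_0); lra|].
  rewrite Ej, Nat.add_1_r; symmetry; apply pow_1_odd.
Qed.

(** lam t - t drops by 4 pi over each period, so it has opposite signs at 2 pi k and -2 pi k once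
    [k] exceeds |lam 0|. *)
Lemma lam_fixed_point : exists t0, lam t0 = t0.
Proof.
  assert (HPI := PI_RGT_0).
  destruct (archimed (Rabs (lam 0))) as [Ha _]; set (k := up (Rabs (lam 0))) in *.
  assert (Hk : 0 < IZR k) by (assert (P := Rabs_pos (lam 0)); lra).
  assert (HPI1 : 1 <= PI) by (assert (P := PI2_1); lra).
  assert (Hq : forall j : Z, lam (2 * PI * IZR j) = lam 0 - 2 * PI * IZR j).
  { intros j; assert (E := quasi_periodic_Z lam (-1) j 0).
    rewrite Rplus_0_l, mult_IZR in E; rewrite E; [ring|].
    intros t; rewrite Hlam; ring. }
  assert (P1 := Rle_abs (lam 0)); assert (P2 := Rle_abs (- lam 0)); rewrite Rabs_Ropp in P2.
  destruct (IVT_gen (fun t => lam t - t) (2 * PI * IZR k) (2 * PI * IZR (- k)) 0) as [t0 [_ Ht0]].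
  - apply smooth_continuity, smooth_minus; [exact Slam | apply smooth_id].
  - rewrite !Hq, opp_IZR; rewrite Rmin_left, Rmax_right by nra; nra.
  - exists t0; lra.
Qed.

(** The fixed point of [lam] is fixed by all its iterates, and this rules out a nonzero
    translation. *)
Lemma trivial_iterate k : (forall u, in_L g s u -> leqL g (lpow Phi k u) u) ->
  (forall t, iter_lam k t = t) /\ forall t, iter_phi k t =m= mid.
Proof.
  intros Hk; destruct (trivial_iterate_shift k Hk) as [m Hm].
  destruct lam_fixed_point as [t0 Ht0].
  assert (Hfix : iter_lam k t0 = t0) by (clear Hk Hm; induction k as [|k IH]; simpl; [|rewrite Ht0]; auto).
  assert (Hl : forall t, iter_lam k t = t).
  { intros t; assert (E := Hm t0); rewrite Hfix in E; rewrite Hm; lra. }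
  split; [exact Hl|].
  intros t; apply (evaluation_matrix g s _ _ t As); intros u Lu.
  assert (E := iter_form k u Lu t); rewrite Hl in E; rewrite mapply_1, <- E; apply Hk, Lu.
Qed.

End Iterates.

(** The square of [lam] is increasing, so a point it moves keeps moving in the same direction and
    never returns. *)
Lemma decreasing_finite_order lam k : (forall x y, x < y -> lam y < lam x) -> (0 < k)%nat ->
  (forall t, iter_lam lam (2 * k) t = t) -> forall t, lam (lam t) = t.
Proof.
  intros Hdec Hk Hid.
  assert (Hinc : forall x y, x < y -> lam (lam x) < lam (lam y)) by (intros; apply Hdec, Hdec; assumption).
  assert (Hstep : forall j t, iter_lam lam (2 * S j) t = iter_lam lam (2 * j) (lam (lam t))).
  { intros j t; replace (2 * S j)%nat with (S (S (2 * j))) by lia; reflexivity. }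
  assert (Hup : forall j t, t < lam (lam t) -> t < iter_lam lam (2 * S j) t).
  { induction j as [|j IH]; intros t Ht; rewrite Hstep; [exact Ht|].
    apply Rlt_trans with (1 := Ht), IH, Hinc, Ht. }
  assert (Hdown : forall j t, lam (lam t) < t -> iter_lam lam (2 * S j) t < t).
  { induction j as [|j IH]; intros t Ht; rewrite Hstep; [exact Ht|].
    apply Rlt_trans with (2 := Ht), IH, Hinc, Ht. }
  destruct k as [|j]; [lia|].
  intros t; destruct (Rtotal_order (lam (lam t)) t) as [H|[H|H]]; [|exact H|].
  - apply (Hdown j) in H; rewrite Hid in H; lra.
  - apply (Hup j) in H; rewrite Hid in H; lra.
Qed.

(** A smooth inverse keeps the derivative away from 0, the drop by 2 pi over a period makes it
    negative somewhere, and by continuity it is negative everywhere. *)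
Lemma reflection_decreasing (lam linv : R -> R) : smooth lam -> smooth linv -> (forall x, linv (lam x) = x) ->
  (forall t, lam (t + 2 * PI) = lam t - 2 * PI) ->
  exists lam', smooth lam' /\ (forall t, derivable_pt_lim lam t (lam' t)) /\ forall t, lam' t < 0.
Proof.
  intros Sl Si Hli Hlam; assert (HPI := PI_RGT_0).
  destruct (smooth_derivative lam Sl) as [lam' [Sl' Dl]].
  destruct (smooth_derivative linv Si) as [linv' [_ Di]].
  exists lam'; split; [exact Sl' | split; [exact Dl|]].
  assert (Hn : forall t, lam' t <> 0).
  { intros t E.
    assert (D := derivable_pt_lim_comp lam linv t _ _ (Dl t) (Di (lam t))).
    rewrite E, Rmult_0_r in D.
    assert (D1 := derivable_pt_lim_ext _ (fun x => x) _ _ Hli D).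
    assert (D2 := uniqueness_limite _ _ _ _ D1 (derivable_pt_lim_id t)); lra. }
  destruct (MVT_cor2 lam lam' 0 (0 + 2 * PI)) as [c [Hc _]]; [lra | intros; apply Dl|].
  rewrite Hlam in Hc.
  assert (Hneg : lam' c < 0) by nra.
  intros t; destruct (Rlt_dec (lam' t) 0) as [L|L]; [exact L | exfalso].
  destruct (IVT_gen lam' c t 0) as [z [_ Hz]]; [apply smooth_continuity, Sl' | | exact (Hn z Hz)].
  rewrite Rmin_left, Rmax_right by lra; lra.
Qed.

(** * Linear combinations of matrices and derivations *)

Definition msum (n : nat) (F : nat -> mat) : mat := fun i j => rsum n (fun k => F k i j).
Definition mscal (a : R) (A : mat) : mat := fun i j => a * A i j.

Definition madd (A B : mat) : mat := fun i j => A i j + B i j.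

Global Instance madd_proper : Proper (meq g ==> meq g ==> meq g) madd.
Proof. intros A A' HA B B' HB i j Hi Hj; unfold madd; rewrite HA, HB by assumption; reflexivity. Qed.

Global Instance mscal_proper a : Proper (meq g ==> meq g) (mscal a).
Proof. intros A A' HA i j Hi Hj; unfold mscal; rewrite HA by assumption; reflexivity. Qed.

Lemma mmul_madd_l A B C : madd A B ** C =m= madd (A ** C) (B ** C).
Proof. intros i j Hi Hj; unfold mmul, madd; rewrite <- rsum_plus; apply rsum_ext; intros; ring. Qed.

Lemma mmul_madd_r A B C : C ** madd A B =m= madd (C ** A) (C ** B).
Proof. intros i j Hi Hj; unfold mmul, madd; rewrite <- rsum_plus; apply rsum_ext; intros; ring. Qed.

Lemma msum_S n F : msum (S n) F =m= madd (msum n F) (F n).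
Proof. intros i j Hi Hj; reflexivity. Qed.

Lemma mmul_msum_l n F B : msum n F ** B =m= msum n (fun k => F k ** B).
Proof.
  intros i j Hi Hj; unfold mmul, msum; rewrite rsum_swap; apply rsum_ext; intros l Hl.
  rewrite <- rsum_scal_r; reflexivity.
Qed.

Lemma mmul_msum_r n F B : B ** msum n F =m= msum n (fun k => B ** F k).
Proof.
  intros i j Hi Hj; unfold mmul, msum; rewrite rsum_swap; apply rsum_ext; intros l Hl.
  rewrite <- rsum_scal; reflexivity.
Qed.

Lemma mmul_mscal_l a A B : mscal a A ** B =m= mscal a (A ** B).
Proof. intros i j Hi Hj; unfold mmul, mscal; rewrite <- rsum_scal; apply rsum_ext; intros; ring. Qed.

Lemma mmul_mscal_r a A B : A ** mscal a B =m= mscal a (A ** B).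
Proof. intros i j Hi Hj; unfold mmul, mscal; rewrite <- rsum_scal; apply rsum_ext; intros; ring. Qed.

Lemma mapply_mscal a A v : mscal a A $ v =v= vscal a (A $ v).
Proof. intros i Hi; unfold mapply, mscal, vscal; rewrite <- rsum_scal; apply rsum_ext; intros; ring. Qed.

Lemma is_derivation_mscal a C : is_derivation g C -> is_derivation g (mscal a C).
Proof.
  intros [H1 H2]; split.
  - intros x y; rewrite !mapply_mscal, H1, br_vscal_l, br_vscal_r.
    intros i Hi; unfold vscal, vadd; ring.
  - intros Hc i j Hi Hj; rewrite (mmul_mscal_l a C (Jm g) i j Hi Hj), (mmul_mscal_r a (Jm g) C i j Hi Hj).
    unfold mscal; rewrite (H2 Hc i j Hi Hj); reflexivity.
Qed.

Lemma is_derivation_msum n F : (forall k, (k < n)%nat -> is_derivation g (F k)) -> is_derivation g (msum n F).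
Proof.
  induction n as [|n IH]; intros H.
  - split.
    + assert (Ez : forall v, msum 0 F $ v =v= vzero)
        by (intros v i _; unfold mapply, msum, vzero; simpl; apply rsum_zero; intros; ring).
      intros x y; rewrite !Ez; intros k _; unfold vadd, br, vzero.
      rewrite !rsum_zero; [ring| |]; intros; apply rsum_zero; intros; ring.
    + intros _ i j _ _; unfold mmul, msum; simpl; rewrite !rsum_zero; [reflexivity| |]; intros; ring.
  - destruct (IH ltac:(intros; apply H; lia)) as [H1 H2], (H n ltac:(lia)) as [K1 K2]; split.
    + assert (E : forall v, msum (S n) F $ v =v= vadd (msum n F $ v) (F n $ v)).
      { intros v i Hi; unfold mapply, vadd, msum; simpl; rewrite <- rsum_plus; apply rsum_ext; intros; ring. }
      intros x y; rewrite !E, H1, K1, br_vadd_l, br_vadd_r; intros i Hi; unfold vadd; ring.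
    + intros Hc; rewrite msum_S, mmul_madd_l, mmul_madd_r, (H2 Hc), (K2 Hc); reflexivity.
Qed.

Lemma smooth_matrix_derivative P : msmooth g P -> exists P', msmooth g P' /\ forall t, mderiv g P t (P' t).
Proof.
  intros SP.
  destruct (choice_lt (fun _ _ => 0) N _ (fun i Hi => choice_lt (fun _ => 0) N _
    (fun j Hj => smooth_derivative (fun t => P t i j) (SP i j Hi Hj)))) as [D HD].
  exists (fun t i j => D i j t); split.
  - intros i j Hi Hj; apply (HD i Hi j Hj).
  - intros t i j Hi Hj; apply (HD i Hi j Hj).
Qed.

Section InvariantConnection.
Variables (s : mat) (lam lam' : R -> R) (phi phi' pinv : R -> mat).
Hypotheses (As : AutG g s) (Sl : smooth lam) (Sl' : smooth lam').
Hypothesis Dl : forall t, derivable_pt_lim lam t (lam' t).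
Hypothesis Hlam : forall t, lam (t + 2 * PI) = lam t - 2 * PI.
Hypotheses (Sphi : msmooth g phi) (Sphi' : msmooth g phi') (Spinv : msmooth g pinv).
Hypothesis Dphi : forall t, mderiv g phi t (phi' t).
Hypothesis Aphi : forall t, AutG g (phi t).
Hypothesis Hpinv : forall t, inverse_of g (phi t) (pinv t).
Hypothesis Hphi : forall t, phi (t + 2 * PI) =m= s ** (phi t ** s).

(* The action of the automorphism [u |-> phi_t (u (lam t))] on the connections [d/dt - X]. *)
Definition connection_action (X : R -> mat) (t : R) : mat :=
  madd (phi' t ** pinv t) (mscal (lam' t) (phi t ** X (lam t) ** pinv t)).

(** The image of the flat connection d/dt under the k-th power of the automorphism. It is the
    logarithmic derivative of [iter_phi k], from which its properties are read off. *)
Fixpoint iter_connection (k : nat) : R -> mat :=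
  match k with O => fun _ _ _ => 0 | S k' => connection_action (iter_connection k') end.

Lemma connection_action_deriv X P : (forall t, mderiv g P t (X t ** P t)) ->
  forall t, mderiv g (fun t => phi t ** P (lam t)) t (connection_action X t ** (phi t ** P (lam t))).
Proof.
  intros DP t; eapply mderiv_eq.
  - apply (mderiv_mul g phi (fun t => P (lam t))); [apply Dphi | apply mderiv_comp; [apply DP | apply Dl]].
  - assert (E1 : phi' t ** pinv t ** (phi t ** P (lam t)) =m= phi' t ** P (lam t)).
    { rewrite mmul_assoc, <- (mmul_assoc g _ (pinv t)), (proj2 (Hpinv t)), mmul_1_r; reflexivity. }
    assert (E2 : phi t ** X (lam t) ** pinv t ** (phi t ** P (lam t)) =m= phi t ** (X (lam t) ** P (lam t))).
    { rewrite mmul_assoc, <- (mmul_assoc g _ (pinv t)), (proj2 (Hpinv t)), mmul_1_r, mmul_assoc; reflexivity. }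
    unfold connection_action; rewrite mmul_madd_l, mmul_mscal_l, E1, E2, <- mmul_mscal_r; reflexivity.
Qed.

Lemma iter_connection_deriv k t :
  mderiv g (iter_phi lam phi k) t (iter_connection k t ** iter_phi lam phi k t).
Proof.
  revert t; induction k as [|k IH]; intros t; simpl.
  - eapply mderiv_eq; [apply mderiv_const | symmetry; apply mmul_0_l].
  - apply connection_action_deriv, IH.
Qed.

Lemma connection_action_smooth X : msmooth g X -> msmooth g (connection_action X).
Proof.
  intros SX i j Hi Hj; apply smooth_plus.
  - apply (msmooth_mul g phi' pinv Sphi' Spinv i j Hi Hj).
  - apply smooth_mult; [exact Sl'|].
    apply (msmooth_mul g (fun t => phi t ** X (lam t)) pinv); try assumption.
    apply (msmooth_mul g phi (fun t => X (lam t)) Sphi), (msmooth_comp g X lam SX Sl).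
Qed.

Lemma iter_connection_smooth k : msmooth g (iter_connection k).
Proof.
  induction k as [|k IH]; [apply msmooth_const | apply connection_action_smooth, IH].
Qed.

Lemma iter_connection_derivation k t : is_derivation g (iter_connection k t).
Proof.
  apply (log_derivative_derivation g (iter_phi lam phi k) t).
  - apply iter_phi_AutG, Aphi.
  - apply iter_connection_deriv.
Qed.

(** The right factor [e] alternates between s^-1 and [s], since [lam] reverses the period. It is
    constant in t and so drops out of the logarithmic derivative. *)
Lemma iter_phi_period k : exists e, AutG g e /\
  forall t, iter_phi lam phi k (t + 2 * PI) =m= s ** iter_phi lam phi k t ** e.
Proof.
  induction k as [|k [e [Ae He]]]; simpl.
  - exists (minv g s); split; [apply AutG_minv, As|].
    intros _; rewrite mmul_1_r, minv_r by exact As; reflexivity.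
  - exists (minv g e); split; [apply AutG_minv, Ae|]; intros t.
    assert (E : iter_phi lam phi k (lam t - 2 * PI) =m= minv g s ** iter_phi lam phi k (lam t) ** minv g e).
    { assert (E := He (lam t - 2 * PI)); replace (lam t - 2 * PI + 2 * PI) with (lam t) in E by ring.
      rewrite E, !mmul_assoc, minv_l, mmul_1_l, mul_minv_r by assumption; reflexivity. }
    rewrite Hlam, E, Hphi, !mmul_assoc, (mul_minv_r g s _ As); reflexivity.
Qed.

Lemma iter_connection_period k t : iter_connection k (t + 2 * PI) ** s =m= s ** iter_connection k t.
Proof.
  destruct (iter_phi_period k) as [e [Ae He]].
  assert (D1 : mderiv g (fun t => iter_phi lam phi k (t + 2 * PI)) t
    (iter_connection k (t + 2 * PI) ** iter_phi lam phi k (t + 2 * PI))).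
  { eapply mderiv_eq; [eapply (mderiv_comp g (iter_phi lam phi k) (fun t => t + 2 * PI) t _ 1)|].
    - apply iter_connection_deriv.
    - apply derivable_pt_lim_eq with (1 + 0); [|ring].
      apply (derivable_pt_lim_plus (fun t => t) (fun _ => 2 * PI)); [apply derivable_pt_lim_id | apply derivable_pt_lim_const].
    - intros i j _ _; ring. }
  assert (D2 : mderiv g (fun t => iter_phi lam phi k (t + 2 * PI)) t
    (s ** (iter_connection k t ** iter_phi lam phi k t) ** e)).
  { apply mderiv_ext with (fun t => s ** iter_phi lam phi k t ** e); [intros r; symmetry; apply He|].
    apply mderiv_mul_const, mderiv_const_mul, iter_connection_deriv. }
  assert (E := mderiv_unique g _ _ _ _ D1 D2); rewrite He, !mmul_assoc in E.
  apply (mmul_cancel_r g (iter_phi lam phi k t)); [apply iter_phi_AutG, Aphi|].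
  apply (mmul_cancel_r g e); [exact Ae | exact E].
Qed.

Lemma rsum_shift n (f : nat -> R) : rsum n f + f n = f O + rsum n (fun k => f (S k)).
Proof. induction n as [|n IH]; simpl; [ring | rewrite IH; ring]. Qed.

(** The action is affine, so it sends the average of the first [q] iterates to the average of
    iterates 1 to q. The extra term equals the missing one: iterate [q] is the logarithmic
    derivative of a constant, that is 0. *)
Lemma invariant_connection q : (0 < q)%nat -> (forall t, iter_phi lam phi q t =m= mid) ->
  exists X, msmooth g X /\ (forall t, is_derivation g (X t)) /\
    (forall t, X (t + 2 * PI) ** s =m= s ** X t) /\ forall t, connection_action X t =m= X t.
Proof.
  intros Hq Hid.
  assert (Hq0 : INR q <> 0) by (apply not_0_INR; lia).
  exists (fun t => mscal (/ INR q) (msum q (fun k => iter_connection k t))); split; [|split; [|split]].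
  - intros i j Hi Hj; apply smooth_scal.
    apply (smooth_rsum q (fun k t => iter_connection k t i j)); intros k _; apply iter_connection_smooth; assumption.
  - intros t; apply is_derivation_mscal, is_derivation_msum; intros k _; apply iter_connection_derivation.
  - intros t; rewrite mmul_mscal_l, mmul_mscal_r, mmul_msum_l, mmul_msum_r; apply mscal_proper.
    intros i j Hi Hj; apply rsum_ext; intros k _; apply iter_connection_period; assumption.
  - intros t.
    assert (Hc : iter_connection q t =m= (fun _ _ => 0)).
    { rewrite <- (mmul_1_r g (iter_connection q t)), <- (Hid t).
      apply (mderiv_unique g (iter_phi lam phi q) t); [apply iter_connection_deriv|].
      apply mderiv_ext with (fun _ => mid); [intros r; symmetry; apply Hid | apply mderiv_const]. }
    unfold connection_action; rewrite mmul_mscal_r, mmul_mscal_l, mmul_msum_r, mmul_msum_l.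
    intros i j Hi Hj; unfold madd, mscal, msum.
    assert (Hs := rsum_shift q (fun k => iter_connection k t i j)); cbv beta in Hs.
    rewrite (Hc i j Hi Hj) in Hs; simpl in Hs; rewrite Rplus_0_r, Rplus_0_l in Hs; rewrite Hs.
    unfold connection_action at 1, madd, mscal.
    rewrite rsum_plus, rsum_const, rsum_scal; field; exact Hq0.
Qed.

End InvariantConnection.

Lemma lpow_Phi_pair_double a j u t : lpow (Phi_pair g a) (2 * j) u t =v= mpow g (a ** a) j $ u t.
Proof.
  induction j as [|j IH]; [simpl; rewrite mapply_1; reflexivity|].
  replace (2 * S j)%nat with (S (S (2 * j))) by lia.
  change (lpow (Phi_pair g a) (S (S (2 * j))) u t) with (a $ a $ lpow (Phi_pair g a) (2 * j) u (- - t)).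
  rewrite Ropp_involutive, IH; simpl mpow; rewrite !mapply_mmul; reflexivity.
Qed.

Lemma lpow_conj s1 s2 psi Phi1 Phi2 k u : LIso g s1 s2 psi ->
  (forall u, in_L g s1 u -> in_L g s1 (Phi1 u)) -> LAut g s2 Phi2 ->
  (forall u, in_L g s1 u -> leqL g (psi (Phi1 u)) (Phi2 (psi u))) -> in_L g s1 u ->
  leqL g (psi (lpow Phi1 k u)) (lpow Phi2 k (psi u)).
Proof.
  intros Hpsi H1 H2 Hint Lu; induction k as [|k IH]; intros t; simpl; [reflexivity|].
  assert (Lk := lpow_in_L s1 Phi1 k u H1 Lu).
  rewrite (Hint _ Lk t); apply (proj1 (proj2 (proj1 H2))); [apply Hpsi, Lk | | exact IH].
  apply lpow_in_L; [apply H2 | apply Hpsi, Lu].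
Qed.

Theorem second_kind_normal_form s Phi j :
  AutG g s -> LAut g s Phi -> second_kind g s Phi -> lorder g s Phi (2 * j) ->
  exists ap am s', inJq g (2 * j) ap am /\ am ** s' =m= ap /\ quasiconj g s' (Phi_pair g ap) s Phi.
Proof.
  intros As HPhi [lam [phi [Slam [[linv [Slinv [_ Hli]]] [Hlam [Sphi [Aphi [Hphi Hform]]]]]]]] [Hj [Hord Hmin]].
  assert (Hj0 : (0 < j)%nat) by lia.
  assert (Hform' : forall u, in_L g s u -> forall t, Phi u t =v= phi t $ u (lam t)) by exact Hform.
  destruct (trivial_iterate s Phi lam phi As HPhi Slam Hlam Aphi Hform' _ Hord) as [Hl Hid].
  destruct (reflection_decreasing lam linv Slam Slinv Hli Hlam) as [lam' [Slam' [Dl Hneg]]].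
  assert (Hdec : forall x y, x < y -> lam y < lam x).
  { intros x y Hxy; destruct (MVT_cor2 lam lam' x y Hxy) as [c [Hc _]]; [intros; apply Dl|].
    specialize (Hneg c); nra. }
  assert (Hinv := decreasing_finite_order lam j Hdec Hj0 Hl).
  destruct (lam_fixed_point lam Slam Hlam) as [t0 Ht0].
  destruct (smooth_matrix_derivative phi Sphi) as [phi' [Sphi' Dphi]].
  assert (Hq : exists q, (2 * j)%nat = S q) by (exists (pred (2 * j)); lia); destruct Hq as [q Hq].
  (* Finite order supplies a smooth inverse of [phi]: the matrix of the full iterate is 1, and
     stripping its first factor leaves this curve. *)
  set (pinv := fun t => iter_phi lam phi q (lam t)).
  assert (Spinv : msmooth g pinv)
    by (apply (msmooth_comp g _ lam (iter_phi_smooth lam phi Slam Sphi q) Slam)).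
  assert (Hpinv : forall t, inverse_of g (phi t) (pinv t)).
  { intros t; assert (E := Hid t); rewrite Hq in E; simpl in E; split; [exact E|].
    assert (E' : minv g (phi t) =m= pinv t).
    { rewrite <- (mmul_1_r g (minv g (phi t))), <- E, mmul_assoc, minv_l, mmul_1_l by apply Aphi; reflexivity. }
    rewrite <- E'; apply minv_l, Aphi. }
  destruct (invariant_connection s lam lam' phi phi' pinv As Slam Slam' Dl Hlam Sphi Sphi' Spinv Dphi Aphi Hpinv Hphi
    (2 * j) Hj Hid) as [X [SX [HX [HXper HXinv]]]].
  destruct (derivation_flow g X SX HX) as [Y [Z [SY [SZ [Y0 [AY [HYZ DY]]]]]]].
  set (ap := Z t0 ** phi t0 ** Y t0).
  assert (AZ : forall t, AutG g (Z t)) by (intros t; apply AutG_inverse with (Y t); [apply AY | apply HYZ]).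
  assert (Aap : AutG g ap) by (apply AutG_mul; [apply AutG_mul|]; auto).
  (* Both sides are parallel for the invariant connection, and they agree at the fixed point of
     [lam], where [ap] was defined for this purpose. *)
  assert (K : forall t, Y t ** ap =m= phi t ** Y (lam t)).
  { apply (matrix_ode_unique g X SX (fun t => Y t ** ap) (fun t => phi t ** Y (lam t)) t0).
    - intros t; eapply mderiv_eq; [apply mderiv_mul_const, DY | rewrite mmul_assoc; reflexivity].
    - intros t; eapply mderiv_eq; [apply (connection_action_deriv lam lam' phi phi' pinv Dl Dphi Hpinv X Y DY)|].
      rewrite HXinv; reflexivity.
    - unfold ap; rewrite Ht0, !mmul_assoc, (proj1 (HYZ t0)), mmul_1_l; reflexivity. }
  (* The monodromy of parallel transport over one period, corrected by the twist [s]. Its inverse is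
     the twist of the normal form. *)
  set (C := minv g s ** Y (0 + 2 * PI)).
  assert (AC : AutG g C) by (apply AutG_mul; [apply AutG_minv, As | apply AY]).
  assert (HYper : forall t, Y (t + 2 * PI) =m= s ** Y t ** C).
  { assert (SX2 : msmooth g (fun t => X (t + 2 * PI)))
      by (apply (msmooth_comp g X _ SX), smooth_plus; [apply smooth_id | apply smooth_const]).
    apply (matrix_ode_unique g (fun t => X (t + 2 * PI)) SX2 (fun t => Y (t + 2 * PI)) (fun t => s ** Y t ** C) 0).
    - intros t; eapply mderiv_eq; [eapply (mderiv_comp g Y (fun t => t + 2 * PI) t _ 1); [apply DY|]|].
      + apply derivable_pt_lim_eq with (1 + 0); [|ring].
        apply (derivable_pt_lim_plus (fun t => t) (fun _ => 2 * PI)); [apply derivable_pt_lim_id | apply derivable_pt_lim_const].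
      + intros a b _ _; ring.
    - intros t; eapply mderiv_eq; [apply mderiv_mul_const, mderiv_const_mul, DY|].
      rewrite !mmul_assoc, HXper; reflexivity.
    - unfold C; rewrite Y0, mmul_1_r, mmul_assoc, minv_r, mmul_1_l by exact As; reflexivity. }
  set (s' := minv g C); set (am := ap ** C).
  assert (As' : AutG g s') by (apply AutG_minv, AC).
  assert (Es' : am ** s' =m= ap) by (apply mul_minv_r, AC).
  assert (Hrefl : C ** ap ** C =m= ap).
  (* Compare [K] at t + 2 pi with [K] at t, using the quasi-periodicity of [Y], [phi] and [lam]. *)
  { set (t := t0).
    assert (K2 := K (t + 2 * PI)); rewrite Hlam, !HYper, Hphi in K2.
    assert (E : Y (lam t - 2 * PI) =m= minv g s ** Y (lam t) ** minv g C).
    { assert (E := HYper (lam t - 2 * PI)); replace (lam t - 2 * PI + 2 * PI) with (lam t) in E by ring.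
      rewrite E, !mmul_assoc, minv_l, mmul_1_l, mul_minv_r by assumption; reflexivity. }
    rewrite E, !mmul_assoc, (mul_minv_r g s _ As), <- (mmul_assoc g s (phi t)), <- K in K2.
    apply (mmul_cancel_l g (s ** Y t)); [apply AutG_mul; [exact As | apply AY]|].
    rewrite !mmul_assoc, K2, !mmul_assoc, mul_minv_l by exact AC; reflexivity. }
  assert (Hsq : ap ** ap =m= am ** am).
  { unfold am; rewrite !mmul_assoc, <- (mmul_assoc g ap C ap), <- (mmul_assoc g ap (C ** ap) C), Hrefl; reflexivity. }
  assert (Aam : AutG g am) by (apply AutG_mul; assumption).
  (* For an involution [lam] the map mu(t) = (t - lam t)/2 satisfies mu(lam t) = -mu(t), so it
     conjugates [lam] to t |-> -t. *)
  assert (HD : exists mu', (forall t, derivable_pt_lim (fun t => / 2 * (t - lam t)) t (mu' t)) /\ forall t, / 2 <= mu' t).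
  { exists (fun t => / 2 * (1 - lam' t)); split.
    - intros t; apply (derivable_pt_lim_scal (fun t => t - lam t)).
      apply (derivable_pt_lim_minus (fun t => t) lam); [apply derivable_pt_lim_id | apply Dl].
    - intros t; specialize (Hneg t); lra. }
  destruct HD as [mu' [Dmu Hmu']].
  assert (Smu : smooth (fun t => / 2 * (t - lam t))) by (apply smooth_scal, smooth_minus; [apply smooth_id | exact Slam]).
  destruct (smooth_inverse _ mu' Smu Dmu Hmu') as [nu [Snu [Hmn Hnm]]].
  assert (Hpsi : LIso g s' s (fun u t => Y t $ u (/ 2 * (t - lam t)))).
  { apply (gauge_LIso g s' s Y Z (fun t => / 2 * (t - lam t)) nu); try assumption.
    - intros t; rewrite Hlam; field.
    - intros t; rewrite HYper; apply mul_minv_r, AC. }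
  assert (Hint : forall u, in_L g s' u ->
    leqL g (fun t => Y t $ Phi_pair g ap u (/ 2 * (t - lam t))) (Phi (fun t => Y t $ u (/ 2 * (t - lam t))))).
  { intros u Lu t; rewrite (Hform' _ (proj1 (proj1 Hpsi) u Lu) t); unfold Phi_pair.
    rewrite Hinv; replace (/ 2 * (lam t - t)) with (- (/ 2 * (t - lam t))) by ring.
    rewrite <- !mapply_mmul, K; reflexivity. }
  assert (LP : forall u, in_L g s' u -> in_L g s' (Phi_pair g ap u)) by (intros; apply (Phi_pair_in_L g ap am); assumption).
  exists ap, am, s'; split; [|split; [exact Es' | exists (fun u t => Y t $ u (/ 2 * (t - lam t))); split; assumption]].
  split; [exact Aap | split; [exact Aam | split; [exact Hsq|]]].
  (* Even powers of the normal form act pointwise by powers of ap^2, so the order 2j of [Phi]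
     becomes the order j of this square. *)
  assert (Hpow : forall i, (forall u, in_L g s u -> leqL g (lpow Phi (2 * i) u) u) <-> mpow g (ap ** ap) i =m= mid).
  { intros i; split; intros H.
    - apply (evaluation_matrix g s' _ _ 0 As'); intros u Lu.
      rewrite mapply_1, <- lpow_Phi_pair_double.
      apply (proj1 (proj2 Hpsi)); [apply lpow_in_L; [exact LP | exact Lu] | exact Lu|].
      intros t; etransitivity; [apply (lpow_conj s' s _ (Phi_pair g ap) Phi (2 * i) u Hpsi LP HPhi Hint Lu)|].
      apply H, Hpsi, Lu.
    - intros w Lw; destruct (proj2 (proj2 Hpsi) w Lw) as [u [Lu Eu]]; intros t.
      assert (Lpsi := proj1 (proj1 Hpsi) u Lu).
      assert (Hext : forall k, leqL g (lpow Phi k w) (lpow Phi k (fun t => Y t $ u (/ 2 * (t - lam t))))).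
      { induction k as [|k IH]; simpl; [intros r; symmetry; apply Eu|].
        apply (proj1 (proj2 (proj1 HPhi))); [apply lpow_in_L | apply lpow_in_L | exact IH]; try assumption; apply HPhi. }
      rewrite (Hext _ t), <- (Eu t).
      rewrite <- (lpow_conj s' s _ (Phi_pair g ap) Phi (2 * i) u Hpsi LP HPhi Hint Lu t).
      rewrite lpow_Phi_pair_double, H, mapply_1; reflexivity. }
  replace (Nat.div (2 * j) 2) with j by (rewrite Nat.mul_comm, Nat.div_mul; lia).
  split; [exact Hj0 | split; [apply Hpow, Hord|]].
  intros i Hi0 Hij H; apply (Hmin (2 * i)%nat); [lia | lia | apply Hpow, H].
Qed.

End SecondKind.

(** * Classification *)

Lemma second_kind_order_even g s Phi k : simple g -> AutG g s -> LAut g s Phi -> second_kind g s Phi ->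
  (forall u, in_L g s u -> leqL g (lpow Phi k u) u) -> Nat.Even k.
Proof.
  intros Hg As HPhi [lam [phi [Slam [_ [Hlam [_ [Aphi [_ Hform]]]]]]]] Hk.
  apply (trivial_iterate_even g Hg s Phi lam phi As HPhi Slam Hlam Aphi Hform k Hk).
Qed.

Lemma Phi_pair_LAut g a b s : compatible_pair g a b -> meq g (mmul g b s) a -> LAut g s (Phi_pair g a).
Proof.
  intros [Aa [Ab Hsq]] Es.
  assert (As := twist_AutG g a b s Aa Ab Es).
  assert (Hr := twist_reflection g a b s Ab Hsq Es).
  assert (Sneg : smooth (fun t => - t)) by apply smooth_opp, smooth_id.
  apply (LIso_standard g s s (fun _ => a) (fun _ => minv g a) (fun t => - t) (fun t => - t));
    try apply msmooth_const; try exact Sneg; try (intros; ring).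
  - intros _; exact Aa.
  - intros _; apply aut_inverse, Aa.
  - intros u Lu t; apply (Phi_pair_in_L g a b s Ab Hsq Es u Lu).
  - intros w Lw t.
    assert (E := proj2 Lw (- (t + 2 * PI))); replace (- (t + 2 * PI) + 2 * PI) with (- t) in E by ring.
    rewrite E, <- !mapply_mmul.
    assert (Esa : meq g (mmul g s a) (mmul g a (minv g s))).
    { apply mmul_cancel_r with (1 := As); rewrite Hr, mul_minv_l by exact As; reflexivity. }
    assert (E2 : meq g (minv g a) (mmul g s (mmul g (minv g a) s))).
    { apply minv_eq; [exact Aa|].
      rewrite <- !mmul_assoc, Esa, (mmul_assoc g (minv g a)), minv_l, mmul_1_l, minv_r by assumption; reflexivity. }
    rewrite E2 at 1; rewrite mmul_assoc; reflexivity.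
Qed.

Lemma Phi_pair_second_kind g a b s : compatible_pair g a b -> meq g (mmul g b s) a ->
  second_kind g s (Phi_pair g a).
Proof.
  intros [Aa [Ab Hsq]] Es.
  assert (Sneg : smooth (fun t => - t)) by apply smooth_opp, smooth_id.
  exists (fun t => - t), (fun _ => a); split; [exact Sneg | split; [|split; [|split; [|split; [|split]]]]].
  - exists (fun t => - t); split; [exact Sneg | split; intros; ring].
  - intros t; ring.
  - apply msmooth_const.
  - intros _; exact Aa.
  - intros _; rewrite mmul_assoc, (twist_reflection g a b s) by assumption; reflexivity.
  - intros u _ t; reflexivity.
Qed.

(** Odd exponents are excluded by the parity result; even ones reduce to the order of the square,
    tested on loops through arbitrary vectors at 0. *)
Lemma Phi_pair_lorder g j a b s : simple g -> inJq g (2 * j) a b -> meq g (mmul g b s) a ->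
  lorder g s (Phi_pair g a) (2 * j).
Proof.
  intros Hg [Aa [Ab [Hsq Hord]]] Es.
  assert (Hab : compatible_pair g a b) by (split; [|split]; assumption).
  assert (As := twist_AutG g a b s Aa Ab Es).
  replace (Nat.div (2 * j) 2) with j in Hord by (rewrite Nat.mul_comm, Nat.div_mul; lia).
  destruct Hord as [Hj [Hid Hmin]]; split; [lia | split].
  - intros u _ t; rewrite lpow_Phi_pair_double, Hid, mapply_1; reflexivity.
  - intros i Hi0 Hij Hi.
    destruct (second_kind_order_even g s (Phi_pair g a) i Hg As (Phi_pair_LAut g a b s Hab Es)
      (Phi_pair_second_kind g a b s Hab Es) Hi) as [m ->].
    apply (Hmin m); [lia | lia|].
    apply (evaluation_matrix g s _ _ 0 As); intros u Lu.
    rewrite mapply_1, <- lpow_Phi_pair_double; apply Hi, Lu.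
Qed.

Theorem theorem4p3 (g : LieData) (q : nat) :
  simple_lie_alg g -> (0 < q)%nat ->
  (* automorphisms of finite order of the second kind have even order *)
  (forall (s : mat) (Phi : loop -> loop) (k : nat),
      AutG g s -> LAut g s Phi -> second_kind g s Phi -> lorder g s Phi k ->
      Nat.Even k) /\
  (Nat.Even q ->
    (* [a+, a-] |-> (u |-> a+(u(-t))) on L(g, a-^{-1} a+) lands in the
       automorphisms of order q of the second kind *)
    (forall ap am s, inJq g q ap am -> meq g (mmul g am s) ap ->
       LAut g s (Phi_pair g ap) /\ second_kind g s (Phi_pair g ap) /\
       lorder g s (Phi_pair g ap) q) /\
    (* well defined and injective on classes *)
    (forall ap am s ap' am' s',
       inJq g q ap am -> inJq g q ap' am' ->
       meq g (mmul g am s) ap -> meq g (mmul g am' s') ap' ->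
       (pair_rel g ap am ap' am' <->
        quasiconj g s (Phi_pair g ap) s' (Phi_pair g ap'))) /\
    (* surjective onto quasiconjugacy classes *)
    (forall (s : mat) (Phi : loop -> loop),
       AutG g s -> LAut g s Phi -> second_kind g s Phi -> lorder g s Phi q ->
       exists ap am s', inJq g q ap am /\ meq g (mmul g am s') ap /\
         quasiconj g s' (Phi_pair g ap) s Phi)).
Proof.
  intros [_ [_ [Hg _]]] Hq.
  split.
  - intros s Phi k As HPhi H2 Hord.
    apply (second_kind_order_even g s Phi k Hg As HPhi H2), Hord.
  - intros [j ->].
    assert (Hc : forall a b, inJq g (2 * j) a b -> compatible_pair g a b)
      by (intros a b [Aa [Ab [Hsq _]]]; split; [|split]; assumption).
    split; [|split].
    + intros ap am s HJ Es; split; [|split].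
      * apply (Phi_pair_LAut g ap am); auto.
      * apply (Phi_pair_second_kind g ap am); auto.
      * apply (Phi_pair_lorder g j ap am); assumption.
    + intros ap am s ap' am' s' HJ HJ' Es Es'; split.
      * intros HR; apply (pair_rel_quasiconj g ap am ap' am' HR); auto.
      * apply (quasiconj_pair_rel g Hg (2 * j) ap am s ap' am' s'); assumption.
    + intros s Phi; apply second_kind_normal_form, Hg.
Qed.
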